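(* There exist constants $C_W,\gamma_W,C_{BL},\gamma_{BL},\delta,b,q,C>0$, independent of $\varepsilon$ and $\mu$, such that for all $0<\varepsilon\le\mu\le1$ with $\varepsilon/\mu\le q$ the solution $\mathbf U$ of $L_{\varepsilon,\mu}\mathbf U=\mathbf F$ in $I$, $\mathbf U(0)=\mathbf U(1)=0$, can be written as $\mathbf U=\mathbf W+\widehat{\mathbf U}_{BL}+\mathbf R$, where $\mathbf W\in\mathcal A(\mu,C_W,\gamma_W)$, $\widehat{\mathbf U}_{BL}\in\mathcal{BL}^\infty(\delta\varepsilon,C_{BL},\gamma_{BL})$, and $$\|\mathbf R\|_{L^\infty(\partial I)}+\|L_{\varepsilon,\mu}\mathbf R\|_{L^\infty(I)}\le Ce^{-b/\varepsilon}.$$ In particular, $\|\mathbf R\|_{E,I}\le Ce^{-b/\varepsilon}$. Additionally, the second component $\widehat v$ of $\widehat{\mathbf U}_{BL}$ satisfies $\widehat v\in\mathcal{BL}^\infty(\delta\varepsilon,C_{BL}(\varepsilon/\mu)^2,\gamma_{BL})$.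
   Context: $I=(0,1)$, $\partial I=\{0,1\}$. Fixed real data: $\mathbf F=(f,g)^T$ and $\mathbf A(x)=(a_{ij}(x))_{i,j=1,2}$ with $f,g,a_{ij}$ analytic on $[0,1]$: for some constants $C_f,\gamma_f,C_g,\gamma_g,C_a,\gamma_a>0$ and all $n\in\mathbb N_0$, $\|f^{(n)}\|_{L^\infty(I)}\le C_f\gamma_f^n n!$, $\|g^{(n)}\|_{L^\infty(I)}\le C_g\gamma_g^n n!$, $\|a_{ij}^{(n)}\|_{L^\infty(I)}\le C_a\gamma_a^n n!$. For some fixed $\alpha>0$, $\xi^T\mathbf A(x)\xi\ge\alpha^2\xi^T\xi$ for all $\xi\in\mathbb R^2$, $x\in[0,1]$. $L_{\varepsilon,\mu}\mathbf U:=-\mathrm{diag}(\varepsilon^2,\mu^2)\mathbf U''+\mathbf A(x)\mathbf U$; the problem has a unique solution in $[H_0^1(I)]^2$. Energy norm: $\|(u,v)\|_{E,I}^2=\varepsilon^2\|u'\|_{L^2(I)}^2+\mu^2\|v'\|_{L^2(I)}^2+\alpha^2(\|u\|_{L^2(I)}^2+\|v\|_{L^2(I)}^2)$. $\|\mathbf R\|_{L^\infty(\partial I)}$ is the maximum of $|\mathbf R|$ over the two endpoints. $w\in\mathcal A(\nu,C_w,\gamma_w)$ means $\|w^{(n)}\|_{L^\infty(I)}\le C_w\gamma_w^n\max\{n,\nu^{-1}\}^n$ for all $n\in\mathbb N_0$. $w\in\mathcal{BL}^\infty(\nu,C_w,\gamma_w)$ means $w$ is an entire function with $|w^{(n)}(x)|\le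 C_w\gamma_w^n\nu^{-n}e^{-\operatorname{dist}(x,\partial I)/\nu}$ for all $x\in I$, $n\in\mathbb N_0$. Bounds are componentwise for vector-valued functions. *)

(* Defs.v *)
From HB Require Import structures.
From mathcomp Require Import all_boot all_order all_algebra.
From mathcomp Require Import all_classical all_reals all_analysis.
Set Implicit Arguments.
Unset Strict Implicit.
Unset Printing Implicit Defensive.
Import Order.TTheory GRing.Theory Num.Theory.
Import numFieldNormedType.Exports.
Local Open Scope ring_scope.
Local Open Scope classical_set_scope.

(* Functions on I = ]0, 1[ or on its closure are represented by total functions
   R -> R.  Derivatives are only ever evaluated on I, which is open, so they do
   not depend on the values taken outside I. *)

Section Defs.
Context {R : realType}.
Implicit Types (f g u v w : R -> R) (A : R -> 'M[R]_2).

Definition I01 : set R := `]0, 1[%classic.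
Definition cI01 : set R := `[0, 1]%classic.

(* The L^p(I) norm: the library's L^p norm on R of the extension by zero. *)
Definition LpI (p : \bar R) f : \bar R :=
  ('N[@lebesgue_measure R]_p[EFin \o (f \_ I01)])%E.

(* C^infinity on I and continuous up to the boundary.  Continuity on [0, 1]
   ties the endpoint values to those on I. *)
Definition smoothI w : Prop :=
  {within cI01, continuous w} /\
  forall (n : nat) (x : R), I01 x -> derivable (derive1n n w) x 1.

Definition analyticI (C gamma : R) f : Prop :=
  smoothI f /\
  forall n : nat, (LpI +oo (derive1n n f) <= (C * gamma ^+ n * n`!%:R)%:E)%E.

Definition coercive (alpha : R) A : Prop :=
  forall (xi : 'cV[R]_2) (x : R), cI01 x ->
    alpha ^+ 2 * (xi^T *m xi) 0 0 <= (xi^T *m A x *m xi) 0 0.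

Definition classA (nu C gamma : R) w : Prop :=
  smoothI w /\
  forall n : nat,
    (LpI +oo (derive1n n w) <= (C * gamma ^+ n * Num.max n%:R nu^-1 ^+ n)%:E)%E.

(* A real function on R is the restriction of an entire function with real
   values on R iff it is the sum of an everywhere convergent power series. *)
Definition entire w : Prop :=
  exists a : R^nat, forall x : R, pseries a x @ \oo --> w x.

Definition dist_bd (x : R) : R := Num.min `|x - 0| `|x - 1|.

Definition classBL (nu C gamma : R) w : Prop :=
  entire w /\
  forall (n : nat) (x : R), I01 x ->
    `|derive1n n w x| <= C * gamma ^+ n * nu ^- n * expR (- (dist_bd x / nu)).

(* u, through its continuous representative on [0, 1], lies in H^1_0(I) and du
   is a weak derivative of u: in dimension one this means that u is the
   primitive vanishing at 0 of du in L^2(I), with u 1 = 0. *)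
Definition H10 (u du : R -> R) : Prop :=
  [/\ measurable_fun I01 du,
      (LpI 2%:E du < +oo)%E,
      forall x : R, cI01 x ->
        u x = (\int[@lebesgue_measure R]_(t in `[0, x]) du t)%R
    & u 1 = 0].

(* Weak form in [H^1_0(I)]^2 of L_{eps,mu} (u, v) = (f, g) in I, with
   homogeneous Dirichlet conditions. *)
Definition solution (eps mu : R) A f g u v : Prop :=
  exists du dv : R -> R,
  [/\ H10 u du, H10 v dv &
    forall phi dphi psi dpsi : R -> R, H10 phi dphi -> H10 psi dpsi ->
      (\int[@lebesgue_measure R]_(x in I01)
        (eps ^+ 2 * du x * dphi x + mu ^+ 2 * dv x * dpsi x +
         (A x 0 0 * u x + A x 0 1 * v x) * phi x +
         (A x 1 0 * u x + A x 1 1 * v x) * psi x))%R =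
      (\int[@lebesgue_measure R]_(x in I01) (f x * phi x + g x * psi x))%R].

Definition L1 (eps : R) A u v (x : R) : R :=
  - eps ^+ 2 * derive1n 2 u x + A x 0 0 * u x + A x 0 1 * v x.
Definition L2 (mu : R) A u v (x : R) : R :=
  - mu ^+ 2 * derive1n 2 v x + A x 1 0 * u x + A x 1 1 * v x.

(* Euclidean norm of a vector-valued function, pointwise. *)
Definition enorm u v (x : R) : R := Num.sqrt (u x ^+ 2 + v x ^+ 2).

Definition bd_norm u v : R := Num.max (enorm u v 0) (enorm u v 1).

Definition energy_norm (eps mu alpha : R) u v : \bar R :=
  (((eps ^+ 2)%:E * LpI 2%:E (derive1 u) ^+ 2 +
    (mu ^+ 2)%:E * LpI 2%:E (derive1 v) ^+ 2 +
    (alpha ^+ 2)%:E * (LpI 2%:E u ^+ 2 + LpI 2%:E v ^+ 2)) `^ 2^-1)%E.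

Definition twice_derivableI w : Prop :=
  forall x : R, I01 x -> derivable w x 1 /\ derivable (derive1 w) x 1.

End Defs.

(* Main.v *)
Require Import Defs.
From HB Require Import structures.
From mathcomp Require Import all_boot all_order all_algebra.
From mathcomp Require Import all_classical all_reals all_analysis.
From mathcomp Require Import ring lra zify.
From mathcomp Require Import ess_sup_inf measurable_realfun.
Set Implicit Arguments.
Unset Strict Implicit.
Unset Printing Implicit Defensive.
Import Order.TTheory GRing.Theory Num.Theory.
Import numFieldNormedType.Exports.
Local Open Scope ring_scope.
Local Open Scope classical_set_scope.

(** Write tau = (eps / mu)^2. The approximation is assembled from a smooth
    expansion and two boundary layers, each with an exponentially small
    residual, and the energy estimate turns the residual into a bound for the
    remainder.

    Smooth part. In powers of eps^2 the expansion (w1, w2) = sum_i eps^(2i)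
    (u_i, v_i) leads to the reduced problems a11 u + a12 v = h1, - mu^2 v'' +
    a21 u + a22 v = h2 with h1 = u_(i-1)''. Eliminating u leaves a scalar
    equation for v whose zeroth order coefficient det A / a11 is at least
    alpha^2 by coercivity, so that the maximum principle bounds v
    independently of mu. With the weights T(m) = max(m, 1/mu)^m, solving a
    reduced problem preserves bounds of the form |w^(n)| <= C g^n T(n + j) up
    to a constant factor ([reduced_problem]), and taking h1 = u'' raises j by
    2. Hence the i-th term is bounded by K1^i T(n + 2i), the products eps^(2i)
    T(2i) decay geometrically as long as i <= c / eps, and stopping at i ~ c /
    eps leaves a residual of order (1/2)^i = e^(-b / eps)
    ([smooth_expansion]).

    Layers. The reduced problems leave no freedom to prescribe w1 at the
    endpoints. Its values there are compensated by approximate solutions of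
    the homogeneous system of the form e^(- beta s) (G(s), tau H(s)), where s
    = x / eps, beta^2 = a11(0), G(0) = 1 and G, H are polynomials of degree
    about c / eps. The layer equations for (G, H) are solved by a Neumann
    series in the norm sum_k |p_k| k! / eta^k: differentiation costs eta
    there, multiplication by eps s costs eps N / eta, so the iteration map
    halves the norm when eta, eps N and tau are small ([pair_nrm_step]); after
    N steps the residual is again exponentially small ([layer_approx]). The
    right layer is the left layer of the reflected coefficients. As H(0) need
    not vanish, the layer also pollutes the second component at the endpoints,
    by tau H(0) times the amplitude of the layer. The boundary values of
    v_(i+1) are therefore prescribed as a multiple of u_i, which makes w2 =
    tau H(0) w1 up to an exponentially small error at 0, and likewise at 1.

    Remainder. Testing the weak formulation with Green's functions of the
    second derivative shows that the weak solution satisfies the system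
    classically ([weak_classical]). The boundary defect of smooth part plus
    layers is exponentially small and is removed by an affine function, put
    into the smooth part ([asymptotic_approx]), so that the remainder vanishes
    at both endpoints and [energy_norm_le] applies. *)

(** * Calculus on the unit interval *)

Section Calc.
Context {R : realType}.
Implicit Types (f g u v w : R -> R).

Lemma I01E (x : R) : I01 x <-> 0 < x < 1.
Proof. by rewrite /I01 /= in_itv. Qed.
Lemma cI01E (x : R) : cI01 x <-> 0 <= x <= 1.
Proof. by rewrite /cI01 /= in_itv. Qed.

Lemma I01_cI01 (x : R) : I01 x -> cI01 x.
Proof. by move=> /I01E /andP[h1 h2]; apply/cI01E; rewrite !ltW. Qed.

Lemma near_I01 (x : R) : I01 x -> \forall y \near x, I01 y.
Proof. move=> hx. apply: open_nbhs_nbhs; split => //; exact: interval_open. Qed.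

(** The names d*, w* and c* below abbreviate closure of derivatives, of
    continuity on a subset and of continuity on R under the operation that
    follows. They fix the eta-expanded form in which these facts are needed
    for unification. *)
Lemma dcst (c x : R) : is_derive x (1 : R) (fun=> c) 0.
Proof. exact: is_derive_cst. Qed.
Lemma did (x : R) : is_derive x (1 : R) (fun t => t) 1.
Proof. exact: is_derive_id. Qed.
Lemma dD f g (x a b : R) : is_derive x 1 f a -> is_derive x 1 g b ->
  is_derive x 1 (fun t => f t + g t) (a + b).
Proof. move=> h1 h2; exact: is_deriveD. Qed.
Lemma dN f (x a : R) : is_derive x 1 f a -> is_derive x 1 (fun t => - f t) (- a).
Proof. move=> h1; exact: is_deriveN. Qed.
Lemma dB f g (x a b : R) : is_derive x 1 f a -> is_derive x 1 g b ->
  is_derive x 1 (fun t => f t - g t) (a - b).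
Proof. move=> h1 h2; exact: is_deriveB. Qed.
Lemma dM f g (x a b : R) : is_derive x 1 f a -> is_derive x 1 g b ->
  is_derive x 1 (fun t => f t * g t) (a * g x + f x * b).
Proof.
move=> h1 h2; have h := is_deriveM h1 h2.
by apply: (is_derive_eq h); rewrite /GRing.scale /= addrC [g x * _]mulrC.
Qed.
Lemma dZ c f (x a : R) : is_derive x 1 f a -> is_derive x 1 (fun t => c * f t) (c * a).
Proof. move=> h1; exact: is_deriveZ. Qed.
Lemma dcomp f g (x a b : R) : is_derive (g x) 1 f a -> is_derive x 1 g b ->
  is_derive x 1 (fun t => f (g t)) (a * b).
Proof. move=> h1 h2; exact: is_derive1_comp. Qed.
Lemma dsum (n : nat) (F : nat -> R -> R) (a : nat -> R) (x : R) :
  (forall k, (k < n)%N -> is_derive x 1 (F k) (a k)) ->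
  is_derive x 1 (fun t => \sum_(k < n) F k t) (\sum_(k < n) a k).
Proof.
elim: n => [|n IH] h.
  under [X in is_derive _ _ X _]eq_fun do rewrite big_ord0.
  by rewrite big_ord0; exact: dcst.
under [X in is_derive _ _ X _]eq_fun do rewrite big_ord_recr /=.
rewrite big_ord_recr /=; apply: dD; last exact: h.
by apply: IH => k kn; apply: h; rewrite ltnS ltnW.
Qed.
Lemma dexp (l x : R) : is_derive x 1 (fun t => expR (l * t)) (l * expR (l * x)).
Proof.
have h := dcomp (is_derive_expR (l * x)) (dZ l (did x)).
by apply: (is_derive_eq h); rewrite mulr1 mulrC.
Qed.
Lemma dpoly (p : {poly R}) (x : R) : is_derive x 1 (horner p) p^`().[x].
Proof.
have := derivableP (@derivable_horner R p x).
by rewrite derivE derive1E.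
Qed.
Lemma dcont f (x a : R) : is_derive x 1 f a -> {for x, continuous f}.
Proof. by move=> [h _]; apply: differentiable_continuous; apply/derivable1_diffP. Qed.
Lemma dE f (x a : R) : is_derive x 1 f a -> f^`()%classic x = a.
Proof. by move=> h; rewrite derive1E; apply: derive_val. Qed.
Lemma derivd f (x : R) : derivable f x 1 -> is_derive x 1 f (f^`()%classic x).
Proof. by move=> h; rewrite derive1E; apply: derivableP. Qed.
Lemma dnear f g (x a : R) : (\near x, f x = g x) -> is_derive x 1 f a -> is_derive x 1 g a.
Proof. exact: near_eq_is_derive. Qed.
Lemma dI f g (x a : R) : I01 x -> (forall y, I01 y -> f y = g y) ->
  is_derive x 1 f a -> is_derive x 1 g a.
Proof. by move=> /near_I01 hx h; apply: dnear; apply: filterS hx => y; exact: h. Qed.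
Lemma contw f (A : set R) : continuous f -> {within A, continuous f}.
Proof. exact: continuous_subspaceT. Qed.

Lemma wB f g (A : set R) : {within A, continuous f} -> {within A, continuous g} ->
  {within A, continuous (fun x => f x - g x)}.
Proof. by move=> cf cg x; apply: (@continuousB _ _ (subspace A) f g x); [exact: cf|exact: cg]. Qed.
Lemma wM f g (A : set R) : {within A, continuous f} -> {within A, continuous g} ->
  {within A, continuous (fun x => f x * g x)}.
Proof. by move=> cf cg x; apply: (@continuousM _ (subspace A) f g x); [exact: cf|exact: cg]. Qed.
Lemma wZ c f (A : set R) : {within A, continuous f} -> {within A, continuous (fun x => c * f x)}.
Proof. by move=> cf; apply: wM => //; apply: contw; exact: cst_continuous. Qed.

Lemma cB f g : continuous f -> continuous g -> continuous (fun x => f x - g x).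
Proof. by move=> cf cg x; apply: (@continuousB _ _ _ f g x); [exact: cf|exact: cg]. Qed.
Lemma cD f g : continuous f -> continuous g -> continuous (fun x => f x + g x).
Proof. by move=> cf cg x; apply: (@continuousD _ _ _ f g x); [exact: cf|exact: cg]. Qed.
Lemma cM f g : continuous f -> continuous g -> continuous (fun x => f x * g x).
Proof. by move=> cf cg x; apply: (@continuousM _ _ f g x); [exact: cf|exact: cg]. Qed.
Lemma cC (c : R) : continuous (fun _ : R => c).
Proof. exact: cst_continuous. Qed.
Lemma cX : continuous (fun x : R => x).
Proof. by move=> x. Qed.
Lemma cZ (c : R) f : continuous f -> continuous (fun x => c * f x).
Proof. by move=> cf; apply: cM => //; exact: cC. Qed.

Lemma mean_value_thm f (f' : R -> R) (a b : R) : a < b ->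
  (forall x, a < x < b -> is_derive x 1 f (f' x)) ->
  (forall x, a <= x <= b -> {for x, continuous f}) ->
  exists2 c, a < c < b & f b - f a = f' c * (b - a).
Proof.
move=> ab df cf.
have h1 x : x \in `]a, b[%R -> is_derive x 1 f (f' x).
  by rewrite in_itv /=; exact: df.
have h2 : {within `[a, b], continuous f}.
  by apply: continuous_in_subspaceT => z; rewrite inE /= in_itv /=; exact: cf.
have [c] := @MVT R f f' a b ab h1 h2.
by rewrite in_itv /= => hc e; exists c.
Qed.

(** Comparing f with a dominating g, and not only with a linear function,
    serves both for Taylor remainders and for the exponentially weighted norms
    of the Picard iteration. *)
Lemma mean_value_ineq f g (f' g' : R -> R) (a b : R) : a <= b ->
  {within `[a, b], continuous f} -> {within `[a, b], continuous g} ->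
  (forall x, a < x < b -> is_derive x 1 f (f' x)) ->
  (forall x, a < x < b -> is_derive x 1 g (g' x)) ->
  (forall x, a < x < b -> `|f' x| <= g' x) ->
  `|f b - f a| <= g b - g a.
Proof.
rewrite le_eqVlt => /predU1P[<-|ab]; first by rewrite !subrr normr0.
move=> cf cg df dg le.
have h s : s \in [:: 1; -1] -> s * (f b - f a) <= g b - g a.
  move=> hs.
  have [||c] := @MVT R (fun x => g x - s * f x) (fun x => g' x - s * f' x) a b ab.
  - by move=> x; rewrite in_itv /= => xab; apply: dB; [exact: dg|apply: dZ; exact: df].
  - by apply: wB => //; exact: wZ.
  rewrite in_itv /= => cab e.
  have : 0 <= (g' c - s * f' c) * (b - a).
    rewrite mulr_ge0 ?subr_ge0 ?(ltW ab) //.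
    apply: le_trans (le _ cab).
    rewrite (le_trans (ler_norm _)) // normrM.
    by move: hs; rewrite !inE => /orP[]/eqP->; rewrite ?normrN normr1 mul1r.
  rewrite -e; lra.
rewrite ler_norml.
have := h 1; have := h (-1); rewrite !inE !eqxx ?orbT /= => h1 h2.
have := h1 isT; have := h2 isT; lra.
Qed.

Lemma derive1n_ext f g n (x : R) : (forall y, I01 y -> f y = g y) -> I01 x ->
  derive1n n f x = derive1n n g x.
Proof.
move=> h; elim: n x => [|n IH] x hx; first exact: h.
rewrite !derive1nS !derive1E; apply: near_eq_derive.
by apply: filterS (near_I01 hx) => y; exact: IH.
Qed.

(** Derivatives are only required on the open interval; endpoint values enter
    separately, through continuity. *)
Definition smooth w := forall (n : nat) (x : R), I01 x -> derivable (derive1n n w) x 1.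

Lemma smooth_d w n x : smooth w -> I01 x -> is_derive x 1 (derive1n n w) (derive1n n.+1 w x).
Proof. by move=> sw hx; rewrite derive1nS; apply: derivd; exact: sw. Qed.

(** A family W with W n' = W n.+1 on I identifies all derivatives of its first
    member at once. The formulas below for sums, products and reflections are
    instances. *)
Lemma smooth_jet (W : nat -> R -> R) w :
  (forall x, I01 x -> w x = W 0%N x) ->
  (forall n x, I01 x -> is_derive x 1 (W n) (W n.+1 x)) ->
  smooth w /\ forall n x, I01 x -> derive1n n w x = W n x.
Proof.
move=> h0 hW.
have h n x : I01 x -> derive1n n w x = W n x.
  elim: n x => [|n IH] x hx; first exact: h0.
  rewrite derive1nS; apply: dE; apply: dI (hW n x hx) => // y hy.
  by rewrite IH.
split=> // n x hx; have := hW n x hx => d.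
have : is_derive x 1 (derive1n n w) (W n.+1 x) by apply: dI d => // y hy; rewrite h.
by case.
Qed.

Lemma smooth_ext f g : (forall y, I01 y -> f y = g y) -> smooth f -> smooth g.
Proof.
move=> h sf; have [] // := @smooth_jet (fun n => derive1n n f) g.
- by move=> x hx; rewrite -h.
- by move=> n x hx; exact: smooth_d.
Qed.

Lemma smooth_deriv w k : smooth w -> smooth (derive1n k w) /\
  (forall n x, I01 x -> derive1n n (derive1n k w) x = derive1n (n + k) w x).
Proof.
move=> sw; apply: (@smooth_jet (fun n => derive1n (n + k) w)) => // n x hx.
rewrite addSn; exact: smooth_d.
Qed.

Lemma derive1n_add f g : smooth f -> smooth g -> smooth (fun x => f x + g x) /\
  forall n x, I01 x -> derive1n n (fun x => f x + g x) x = derive1n n f x + derive1n n g x.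
Proof.
move=> sf sg; apply: (@smooth_jet (fun n x => derive1n n f x + derive1n n g x)) => // n x hx.
by apply: dD; exact: smooth_d.
Qed.
Lemma derive1n_scale c f : smooth f -> smooth (fun x => c * f x) /\
  forall n x, I01 x -> derive1n n (fun x => c * f x) x = c * derive1n n f x.
Proof.
move=> sf; apply: (@smooth_jet (fun n x => c * derive1n n f x)) => // n x hx.
by apply: dZ; exact: smooth_d.
Qed.
Lemma derive1n_sum m (F : nat -> R -> R) : (forall k, (k < m)%N -> smooth (F k)) ->
  smooth (fun x => \sum_(k < m) F k x) /\
  forall n x, I01 x -> derive1n n (fun x => \sum_(k < m) F k x) x = \sum_(k < m) derive1n n (F k) x.
Proof.
move=> sF; apply: (@smooth_jet (fun n x => \sum_(k < m) derive1n n (F k) x)) => // n x hx.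
by apply: (dsum (F := fun k t => derive1n n (F k) t) (a := fun k => derive1n n.+1 (F k) x))
  => k km; apply: smooth_d => //; exact: sF.
Qed.

Definition leibniz_sum f g n (x : R) :=
  \sum_(k < n.+1) 'C(n, k)%:R * (derive1n k f x * derive1n (n - k) g x).

Lemma derive1n_mul f g : smooth f -> smooth g -> smooth (fun x => f x * g x) /\
  forall n x, I01 x -> derive1n n (fun x => f x * g x) x = leibniz_sum f g n x.
Proof.
move=> sf sg; apply: smooth_jet => [x hx|n x hx].
  by rewrite /leibniz_sum big_ord1 bin0 mul1r.
rewrite /leibniz_sum.
pose a k := derive1n k f x; pose b k := derive1n k g x.
have h : is_derive x 1 (leibniz_sum f g n) (\sum_(k < n.+1) 'C(n, k)%:R * (a k.+1 * b (n - k)%N + a k * b (n - k).+1)).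
  apply: (dsum (F := fun k x => 'C(n, k)%:R * (derive1n k f x * derive1n (n - k) g x))
    (a := fun k => 'C(n, k)%:R * (a k.+1 * b (n - k)%N + a k * b (n - k).+1))) => k _.
  by apply: dZ; apply: dM; exact: smooth_d.
apply: (is_derive_eq h); rewrite -/a -/b.
under eq_bigr do rewrite mulrDr; rewrite big_split /=.
rewrite [RHS]big_ord_recl /= bin0 mul1r ?subn0.
under [in RHS]eq_bigr => i _.
  rewrite /bump /= add1n binS natrD mulrDl subSS addrC.
  over.
rewrite big_split /= addrCA; congr (_ + _).
rewrite [in LHS]big_ord_recl /= bin0 mul1r ?subn0; congr (_ + _).
rewrite [in RHS]big_ord_recr /= bin_small // mul0r addr0.
apply: eq_bigr => i _; rewrite /bump /= add1n /a /b.
by rewrite -subSn // ltn_ord.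
Qed.

End Calc.

(** * Smoothness and extension of derivatives *)

Section Calc2.
Context {R : realType}.
Implicit Types (f g u v w : R -> R).

(** Finite order differentiability, on which inductions for reciprocals and
    for solutions of differential equations can be run. *)
Definition Ck (n : nat) w := forall k (x : R), (k < n)%N -> I01 x -> derivable (derive1n k w) x 1.

Lemma CkS n w : Ck n.+1 w <-> (forall x, I01 x -> derivable w x 1) /\ Ck n (w^`()%classic).
Proof.
split=> [h|[h0 h]].
  split=> [x hx|k x kn hx]; first exact: (h 0%N).
  by rewrite -derive1Sn; exact: h.
by move=> [|k] x kn hx; [exact: h0 | rewrite derive1Sn; exact: h].
Qed.

Lemma Ck_ext n f g : (forall y, I01 y -> f y = g y) -> Ck n f -> Ck n g.
Proof.
move=> e h k x kn hx.
apply: near_eq_derivable (h k x kn hx).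
by apply: filterS (near_I01 hx) => y hy; exact: derive1n_ext.
Qed.

Lemma Ck_le m n w : (m <= n)%N -> Ck n w -> Ck m w.
Proof. by move=> mn h k x km; apply: h; apply: leq_trans km mn. Qed.

Lemma Ck_smooth w : (forall n, Ck n w) -> smooth w.
Proof. by move=> h n x; exact: (h n.+1). Qed.

Lemma smooth_Ck n w : smooth w -> Ck n w.
Proof. by move=> h k x _; exact: h. Qed.

Lemma Ck_add n f g : Ck n f -> Ck n g -> Ck n (fun x => f x + g x).
Proof.
elim: n f g => [|n IH] f g; first by move=> _ _ k x; rewrite ltn0.
move=> /CkS[f0 f1] /CkS[g0 g1]; apply/CkS.
have d x : I01 x -> is_derive x 1 (fun x => f x + g x) (f^`()%classic x + g^`()%classic x).
  by move=> hx; apply: dD; apply: derivd; [exact: f0|exact: g0].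
split=> [x /d[]//|]; apply: Ck_ext (IH _ _ f1 g1) => y /d h.
by rewrite (dE h).
Qed.

Lemma Ck_mul n f g : Ck n f -> Ck n g -> Ck n (fun x => f x * g x).
Proof.
elim: n f g => [|n IH] f g hf hg; first by move=> k x; rewrite ltn0.
have hf' := Ck_le (leqnSn n) hf; have hg' := Ck_le (leqnSn n) hg.
move: hf hg => /CkS[f0 f1] /CkS[g0 g1]; apply/CkS.
have d x : I01 x -> is_derive x 1 (fun x => f x * g x)
    (f^`()%classic x * g x + f x * g^`()%classic x).
  by move=> hx; apply: dM; apply: derivd; [exact: f0|exact: g0].
split=> [x /d[]//|]; apply: Ck_ext (Ck_add (IH _ _ f1 hg') (IH _ _ hf' g1)) => y /d h.
by rewrite (dE h).
Qed.

Lemma smooth_cst (c : R) : smooth (fun=> c).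
Proof.
have [] // := @smooth_jet R (fun n x => if n is 0%N then c else 0) (fun=> c).
Qed.

Lemma derive1n_zero n (x : R) : I01 x -> derive1n n (fun=> 0 : R) x = 0.
Proof.
have [_ h] := @smooth_jet R (fun _ _ => 0) (fun=> 0) (fun _ _ => erefl) (fun _ x _ => dcst 0 x).
exact: h.
Qed.

Lemma dV f (x a : R) : f x != 0 -> is_derive x 1 f a ->
  is_derive x 1 (fun t => (f t)^-1) (- a * (f x)^-1 ^+ 2).
Proof.
move=> f0 h; have := is_deriveV f0 h => h'.
by apply: (is_derive_eq h'); rewrite /GRing.scale /= -exprVn mulrC mulrN mulNr mulrC.
Qed.

Lemma Ck_inv n f : (forall x, I01 x -> f x != 0) -> Ck n f -> Ck n (fun x => (f x)^-1).
Proof.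
move=> nz; elim: n => [|n IH] hf; first by move=> k x; rewrite ltn0.
have hi := IH (Ck_le (leqnSn n) hf).
move: hf => /CkS[f0 f1]; apply/CkS.
have d x : I01 x -> is_derive x 1 (fun x => (f x)^-1) (- f^`()%classic x * (f x)^-1 ^+ 2).
  by move=> hx; apply: dV; [exact: nz | apply: derivd; exact: f0].
split=> [x /d[]//|].
have h1 : Ck n (fun=> -1 : R) by apply: smooth_Ck; exact: smooth_cst.
apply: Ck_ext (Ck_mul (Ck_mul h1 f1) (Ck_mul hi hi)) => y /d h.
by rewrite (dE h) expr2 mulN1r.
Qed.

Lemma smooth_mul f g : smooth f -> smooth g -> smooth (fun x => f x * g x).
Proof. by move=> sf sg; have [] := derive1n_mul sf sg. Qed.
Lemma smooth_add f g : smooth f -> smooth g -> smooth (fun x => f x + g x).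
Proof. by move=> sf sg; have [] := derive1n_add sf sg. Qed.
Lemma smooth_scale c f : smooth f -> smooth (fun x => c * f x).
Proof. by move=> sf; have [] := derive1n_scale c sf. Qed.
Lemma smooth_sub f g : smooth f -> smooth g -> smooth (fun x => f x - g x).
Proof.
move=> sf sg; have H := smooth_add sf (smooth_scale (c := -1) sg).
refine (smooth_ext _ H) => y _ /=.
by rewrite mulN1r.
Qed.
Lemma smooth_inv f : (forall x, I01 x -> f x != 0) -> smooth f -> smooth (fun x => (f x)^-1).
Proof. by move=> nz sf; apply: Ck_smooth => n; apply: Ck_inv => //; exact: smooth_Ck. Qed.

(** Bootstrap: if v has n derivatives then so has v'' = k v - h, hence v has
    n.+2. *)
Lemma smooth_of_ode (k h v v1 : R -> R) : smooth k -> smooth h ->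
  (forall x, I01 x -> is_derive x 1 v (v1 x)) ->
  (forall x, I01 x -> is_derive x 1 v1 (k x * v x - h x)) -> smooth v.
Proof.
move=> sk sh dv dv1; apply: Ck_smooth.
suff H n : Ck n v /\ Ck n.+1 v by move=> n; have [] := H n.
elim: n => [|n [IH1 IH2]].
  by split=> //; apply/CkS; split=> // x /dv[].
split=> //; apply/CkS; split=> [x /dv[]//|].
have : Ck n.+1 v1.
  apply/CkS; split=> [x /dv1[]//|].
  apply: Ck_ext (Ck_add (Ck_mul (smooth_Ck sk) IH1) (Ck_mul (smooth_Ck (smooth_cst (c := -1))) (smooth_Ck sh))).
  by move=> y hy; rewrite (dE (dv1 y hy)) mulN1r.
by apply: Ck_ext => y hy; rewrite (dE (dv y hy)).
Qed.

Lemma lipschitz_continuous f K : (forall x y, `|f x - f y| <= K * `|x - y|) -> continuous f.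
Proof.
move=> h x; apply/cvgrPdist_lt => e e0.
have K1 : 0 < `|K| + 1 by rewrite ltr_wpDl.
near=> y.
apply: le_lt_trans (h x y) _.
apply: (@le_lt_trans _ _ ((`|K| + 1) * `|x - y|)).
  by rewrite ler_wpM2r // (le_trans (ler_norm _)) // lerDl.
rewrite -ltr_pdivlMl //; near: y.
by apply/nbhs_ballP; exists ((`|K| + 1)^-1 * e) => //=; rewrite mulr_gt0 ?invr_gt0.
Unshelve. all: by end_near. Qed.

(** The infimum of the cones g y + K |x - y|; it provides continuous functions
    on the whole line, which primitives and integrals are built from. *)
Lemma mcshane_extension (A : set R) g K (a0 : R) : 0 <= K -> A a0 ->
  (forall x y, A x -> A y -> `|g x - g y| <= K * `|x - y|) ->
  exists2 G : R -> R, (forall x y, `|G x - G y| <= K * `|x - y|) & forall x, A x -> G x = g x.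
Proof.
move=> K0 Aa0 hg.
pose S x := [set g y + K * `|x - y| | y in A].
have lb x y : A y -> g a0 - K * `|x - a0| <= g y + K * `|x - y|.
  move=> Ay; have := hg _ _ Aa0 Ay.
  have := ler_wpM2l K0 (ler_distD x a0 y); rewrite mulrDr [`|a0 - x|]distrC.
  by rewrite ler_norml => h /andP[_ h']; lra.
have hS x : has_inf (S x).
  split; first by exists (g a0 + K * `|x - a0|), a0.
  by exists (g a0 - K * `|x - a0|) => _ [y Ay <-]; exact: lb.
have le1 x x' : inf (S x) - inf (S x') <= K * `|x - x'|.
  suff : inf (S x) - K * `|x - x'| <= inf (S x') by lra.
  apply: lb_le_inf; first by case: (hS x').
  move=> _ [y Ay <-].
  have : inf (S x) <= g y + K * `|x - y| by apply: ge_inf; [case: (hS x)|exists y].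
  have := ler_wpM2l K0 (ler_distD x' x y); rewrite mulrDr; lra.
exists (fun x => inf (S x)) => [x y|x Ax].
  rewrite ler_norml; have := le1 x y; have := le1 y x.
  by rewrite distrC => h1 h2; rewrite h2 andbT; lra.
apply/eqP; rewrite eq_le; apply/andP; split.
  by apply: ge_inf; [case: (hS x)|exists x => //; rewrite subrr normr0 mulr0 addr0].
apply: lb_le_inf; first by case: (hS x).
move=> _ [y Ay <-].
have := hg _ _ Ax Ay; rewrite ler_norml => /andP[_ ]; lra.
Qed.

Lemma lipschitz_cI01 f (f' : R -> R) K : {within cI01, continuous f} -> 0 <= K ->
  (forall x, I01 x -> is_derive x 1 f (f' x)) ->
  (forall x, I01 x -> `|f' x| <= K) ->
  forall x y, cI01 x -> cI01 y -> `|f x - f y| <= K * `|x - y|.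
Proof.
move=> cf K0 df bf.
suff H x y : cI01 x -> cI01 y -> x <= y -> `|f y - f x| <= K * (y - x).
  move=> x y hx hy; have [xy|/ltW xy] := leP x y.
    by rewrite distrC [X in _ * X]distrC (ger0_norm (_ : 0 <= y - x)) ?subr_ge0 // H.
  by rewrite (ger0_norm (_ : 0 <= x - y)) ?subr_ge0 // H.
move=> /cI01E /andP[x0 x1] /cI01E /andP[y0 y1] xy.
have sub : `[x, y] `<=` cI01 by apply: subset_itv; rewrite bnd_simp.
have in1 z : x < z < y -> I01 z.
  by move=> /andP[h1 h2]; apply/I01E; rewrite (le_lt_trans x0 h1) (lt_le_trans h2 y1).
rewrite mulrBr; apply: (@mean_value_ineq R f (fun t => K * t) f' (fun=> K)) => //.
- exact: continuous_subspaceW sub cf.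
- by apply: contw => z; apply: (@dcont R _ _ K); apply: (is_derive_eq (dZ K (did z))); rewrite mulr1.
- by move=> z /in1; exact: df.
- by move=> z _; apply: (is_derive_eq (dZ K (did z))); rewrite mulr1.
- by move=> z /in1; exact: bf.
Qed.

Lemma lipschitz_I01 f (f' : R -> R) K : 0 <= K ->
  (forall x, I01 x -> is_derive x 1 f (f' x)) ->
  (forall x, I01 x -> `|f' x| <= K) ->
  forall x y, I01 x -> I01 y -> `|f x - f y| <= K * `|x - y|.
Proof.
move=> K0 df bf.
suff H x y : I01 x -> I01 y -> x <= y -> `|f y - f x| <= K * (y - x).
  move=> x y hx hy; have [xy|/ltW xy] := leP x y.
    by rewrite distrC [X in _ * X]distrC (ger0_norm (_ : 0 <= y - x)) ?subr_ge0 // H.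
  by rewrite (ger0_norm (_ : 0 <= x - y)) ?subr_ge0 // H.
move=> /I01E /andP[x0 x1] /I01E /andP[y0 y1] xy.
have in1 z : x <= z <= y -> I01 z.
  by move=> /andP[h1 h2]; apply/I01E; rewrite (lt_le_trans x0 h1) (le_lt_trans h2 y1).
have in2 z : x < z < y -> I01 z by move=> /andP[h1 h2]; apply: in1; rewrite !ltW.
have H1 : {within `[x, y], continuous f}.
  apply: continuous_in_subspaceT => z; rewrite inE /= in_itv /= => /in1 hz.
  exact: dcont (df z hz).
have H2 : {within `[x, y], continuous (fun z => K * z)}.
  by apply: contw; apply: cZ; exact: cX.
have H3 z : x < z < y -> is_derive z 1 f (f' z) by move=> /in2; exact: df.
have H4 z : x < z < y -> is_derive z 1 (fun z => K * z) K.
  by move=> _; apply: (is_derive_eq (dZ K (did z))); rewrite mulr1.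
by rewrite mulrBr; apply: (mean_value_ineq xy H1 H2 H3 H4) => z /in2; exact: bf.
Qed.

(** A bounded next derivative makes the n-th one Lipschitz on I, so it extends
    continuously up to the endpoints, where nothing is known about
    derivatives. *)
Lemma derive1n_extension n w K : smooth w -> (forall x, I01 x -> `|derive1n n.+1 w x| <= K) ->
  exists2 h : R -> R, continuous h & forall x, I01 x -> h x = derive1n n w x.
Proof.
move=> sw b; have I12 : I01 (1/2 : R) by apply/I01E; lra.
have K0 : 0 <= K by apply: le_trans (b _ I12).
have l := lipschitz_I01 K0 (fun x hx => smooth_d n sw hx) b.
have [h h1 h2] := mcshane_extension K0 I12 l.
by exists h => //; exact: lipschitz_continuous h1.
Qed.

End Calc2.

(** * Linear two-point boundary value problems *)

Section Bvp.
Context {R : realType}.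
Implicit Types (f g u v w k h : R -> R).
Notation mu := (@lebesgue_measure R).

Definition clamp (x : R) : R := Num.max 0 (Num.min 1 x).

Lemma clamp_id x : cI01 x -> clamp x = x.
Proof. by move=> /cI01E /andP[h1 h2]; rewrite /clamp min_r // max_r. Qed.

Lemma clamp_ge0 x : 0 <= clamp x.
Proof. by rewrite /clamp le_max lexx. Qed.

Lemma clamp_cont : continuous clamp.
Proof.
apply: (@lipschitz_continuous _ _ 1) => x y; rewrite mul1r /clamp ler_norml.
have := ler_norm (x - y); have := ler_norm (y - x); rewrite [`|y - x|]distrC.
have := normr_ge0 (x - y); set n := `|_|.
by rewrite /Num.max /Num.min; do !case: ifP; move=> *; apply/andP; split; lra.
Qed.

(** Starting the integrals at -1 keeps all points of [0, 1] in the interior of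
    the range of the fundamental theorem of calculus, and the clamp makes the
    primitive continuous on R. *)
Definition primitive f (x : R) : R :=
  \int[mu]_(t in `[-1, clamp x]) f t - \int[mu]_(t in `[-1, 0]) f t.

Lemma primitive0 f : primitive f 0 = 0.
Proof. by rewrite /primitive clamp_id ?subrr //; apply/cI01E; rewrite lexx ler01. Qed.

Lemma ftc1 f (x : R) : continuous f -> -1 < x ->
  is_derive x 1 (fun x => \int[mu]_(t in `[-1, x]) f t) (f x).
Proof.
move=> cf x1.
have [||d e] := @continuous_FTC1_closed R f (-1) x (x + 1) _ _ x1 (cf x).
- by rewrite ltrDl.
- by apply: continuous_compact_integrable; [exact: segment_compact|exact: contw].
- by rewrite -e; exact: derivd.
Qed.

Lemma is_derive_primitive f x : continuous f -> I01 x -> is_derive x 1 (primitive f) (f x).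
Proof.
move=> cf hx.
have x1 : -1 < x by move/I01E: hx => /andP[h _]; apply: lt_trans h; rewrite ltrN10.
have := dB (ftc1 cf x1) (dcst (\int[mu]_(t in `[-1, 0]) f t) x); rewrite subr0.
apply: dI => // y hy; rewrite /primitive clamp_id //; exact: I01_cI01.
Qed.

Lemma continuous_primitive f : continuous f -> continuous (primitive f).
Proof.
move=> cf; apply: cB; last exact: cC.
move=> x; apply: (@continuous_comp _ _ _ clamp (fun x => \int[mu]_(t in `[-1, x]) f t)).
  exact: clamp_cont.
by apply: dcont (ftc1 cf _); rewrite (lt_le_trans _ (clamp_ge0 x)) ?ltrN10.
Qed.

Lemma mean_value_ineq0 f g (f' g' : R -> R) (x : R) : cI01 x ->
  continuous f -> continuous g ->
  (forall x, I01 x -> is_derive x 1 f (f' x)) ->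
  (forall x, I01 x -> is_derive x 1 g (g' x)) ->
  (forall x, I01 x -> `|f' x| <= g' x) ->
  `|f x - f 0| <= g x - g 0.
Proof.
move=> /cI01E /andP[x0 x1] cf cg df dg h.
have ii z : 0 < z < x -> I01 z.
  by move=> /andP[z0 zx]; apply/I01E; rewrite z0 (lt_le_trans zx).
by apply: (@mean_value_ineq _ f g f' g') => //; [exact: contw|exact: contw
  |move=> z /ii; exact: df|move=> z /ii; exact: dg|move=> z /ii; exact: h].
Qed.

(** In the norm sup e^(- l x) |f x| integration gains the factor 1 / l. *)
Lemma primitive_exp_le f g (C l x : R) : continuous f -> continuous g -> 0 <= C -> 0 < l ->
  (forall t, I01 t -> `|f t - g t| <= C * expR (l * t)) -> cI01 x ->
  `|primitive f x - primitive g x| <= C / l * expR (l * x).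
Proof.
move=> cf cg C0 l0 h hx.
have dg (t : R) : is_derive t 1 (fun t => C / l * expR (l * t)) (C * expR (l * t)).
  apply: (is_derive_eq (dZ (C / l) (dexp l t))).
  by rewrite mulrA divfK // gt_eqF.
have := @mean_value_ineq0 (fun x => primitive f x - primitive g x) (fun t => C / l * expR (l * t))
  (fun t => f t - g t) (fun t => C * expR (l * t)) x hx.
rewrite !primitive0 subrr subr0 => H; apply: le_trans (H _ _ _ _ h) _.
- by apply: cB; exact: continuous_primitive.
- by move=> y; apply: dcont (dg y).
- by move=> y hy; apply: dB; exact: is_derive_primitive.
- by rewrite lerBlDr lerDl mulr_ge0 ?expR_ge0 ?divr_ge0 // ltW.
Qed.

Lemma le0_of_geometric (x C : R) : (forall n, x <= C / 2 ^+ n) -> x <= 0.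
Proof.
move=> h; rewrite leNgt; apply/negP => x0.
have C0 : 0 < C by apply: lt_le_trans x0 _; have := h 0%N; rewrite expr0 divr1.
have [n hn] : exists n : nat, C / x < n%:R.
  by exists (Num.bound (C / x)); rewrite archi_boundP // divr_ge0 // ltW.
have := h n; apply/negP; rewrite -ltNge.
rewrite ltr_pdivrMr ?exprn_gt0 // mulrC -ltr_pdivrMr //.
apply: lt_trans hn _; rewrite -natrX ltr_nat; exact: ltn_expl.
Qed.

(** The nested intervals u n +- 2 C / 2^n give the limit and its rate. *)
Lemma geometric_limit (u : nat -> R) (C : R) : (forall n, `|u n.+1 - u n| <= C / 2 ^+ n) ->
  exists l : R, forall n, `|l - u n| <= 2 * C / 2 ^+ n.
Proof.
move=> h.
have p2 n : (2 : R) * C / 2 ^+ n.+1 = C / 2 ^+ n.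
  by rewrite exprS; field; rewrite expf_eq0 pnatr_eq0 andbF.
pose a n := u n - 2 * C / 2 ^+ n; pose b n := u n + 2 * C / 2 ^+ n.
have C0 n : 0 <= C / 2 ^+ n by apply: le_trans (h n).
have ha n : a n <= a n.+1.
  have := h n; rewrite ler_norml /a p2 => /andP[h1 _].
  have e : 2 * C / 2 ^+ n = C / 2 ^+ n + C / 2 ^+ n by ring.
  rewrite e; lra.
have hb n : b n.+1 <= b n.
  have := h n; rewrite ler_norml /b p2 => /andP[_ h1].
  have e : 2 * C / 2 ^+ n = C / 2 ^+ n + C / 2 ^+ n by ring.
  rewrite e; lra.
have am : nondecreasing_seq a by apply/nondecreasing_seqP.
have bm : nonincreasing_seq b by apply/nonincreasing_seqP.
have ab n : a n <= b n.
  rewrite /a /b.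
  have -> : 2 * C / 2 ^+ n = C / 2 ^+ n + C / 2 ^+ n by ring.
  by have := C0 n; lra.
have abm m n : a m <= b n.
  have h1 := am _ _ (leq_maxl m n); have h2 := bm _ _ (leq_maxr m n).
  exact: le_trans h1 (le_trans (ab _) h2).
have ub n : ubound (range a) (b n) by move=> _ [m _ <-].
have hs : has_sup (range a) by split; [exists (a 0%N), 0%N|exists (b 0%N)].
exists (sup (range a)) => n.
have h1 : a n <= sup (range a) by apply: ub_le_sup; [case: hs|exists n].
have h2 : sup (range a) <= b n by apply: ge_sup; [case: hs|exact: ub].
by move: h1 h2; rewrite /a /b ler_norml => *; apply/andP; split; lra.
Qed.

Lemma cont_bounded f : continuous f -> exists2 B : R, 0 <= B & forall x, cI01 x -> `|f x| <= B.
Proof.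
move=> cf; have [||c _ h] := @EVT_max R (fun x => `|f x|) 0 1; first exact: ler01.
  by apply: contw => x; apply: continuous_comp; [exact: cf|exact: norm_continuous].
by exists `|f c| => // x /cI01E hx; apply: h; rewrite in_itv.
Qed.

(** Picard iteration, contracting by 1/2 in the norm with weight e^(- l x) for
    l large against sup |k|. The limit is first obtained pointwise, is
    Lipschitz because the iterates are so uniformly, and is then extended to
    R. *)
Lemma linear_ivp k h (y0 y1 : R) : continuous k -> continuous h ->
  exists v v1 : R -> R, [/\ continuous v, continuous v1,
   forall x, I01 x -> is_derive x 1 v (v1 x),
   forall x, I01 x -> is_derive x 1 v1 (k x * v x - h x) & v 0 = y0 /\ v1 0 = y1].
Proof.
move=> ck ch.
have [K K0 hK] := cont_bounded ck; have [H H0 hH] := cont_bounded ch.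
pose l := 1 + 2 * K.
have l0 : 0 < l by rewrite /l; lra.
pose F f x := k x * f x - h x.
have cF f : continuous f -> continuous (F f) by move=> cf; apply: cB => //; exact: cM.
pose T1 f x := y1 + primitive (F f) x.
have cT1 f : continuous f -> continuous (T1 f).
  by move=> /cF cf; apply: cD; [exact: cC | exact: continuous_primitive].
pose T f x := y0 + primitive (T1 f) x.
have cT f : continuous f -> continuous (T f).
  by move=> /cT1 cf; apply: cD; [exact: cC | exact: continuous_primitive].
have contr f g (C : R) : continuous f -> continuous g -> 0 <= C ->
    (forall x, cI01 x -> `|f x - g x| <= C * expR (l * x)) ->
    forall x, cI01 x -> `|T f x - T g x| <= C / 2 * expR (l * x).
  move=> cf cg C0 hfg x hx.
  have b1 t : I01 t -> `|F f t - F g t| <= K * C * expR (l * t).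
    move=> /I01_cI01 ht; have -> : F f t - F g t = k t * (f t - g t) by rewrite /F; ring.
    by rewrite normrM -mulrA ler_pM // ?hK ?hfg.
  have KC0 : 0 <= K * C by rewrite mulr_ge0.
  have b2 t : I01 t -> `|T1 f t - T1 g t| <= K * C / l * expR (l * t).
    move=> /I01_cI01 ht; have -> : T1 f t - T1 g t = primitive (F f) t - primitive (F g) t by rewrite /T1 opprD addrACA subrr add0r.
    by apply: primitive_exp_le => //; exact: cF.
  have -> : T f x - T g x = primitive (T1 f) x - primitive (T1 g) x by rewrite /T opprD addrACA subrr add0r.
  apply: (@le_trans _ _ (K * C / l / l * expR (l * x))).
    by apply: (primitive_exp_le (cT1 _ cf) (cT1 _ cg) _ l0 b2 hx); rewrite divr_ge0 // ltW.
  rewrite ler_wpM2r ?expR_ge0 // ler_pdivrMr // ler_pdivrMr //.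
  have e : C / 2 * l * l - K * C = C * (1/2 + K + 2 * K * K) by rewrite /l; field.
  have : 0 <= C * (1/2 + K + 2 * K * K) by apply: mulr_ge0 => //; nra.
  by rewrite -e; lra.
pose V n := iter n T (fun=> 0).
have cV n : continuous (V n).
  by elim: n => [|n IH]; [exact: cC | rewrite /V iterS; exact: cT].
have [B B0 hB] := cont_bounded (cV 1%N).
have el t : cI01 t -> 1 <= expR (l * t) <= expR l.
  move=> /cI01E /andP[t0 t1]; rewrite -[X in X <= _ <= _]expR0 !ler_expR.
  by rewrite mulr_ge0 ?(ltW l0) //= ler_piMr // ltW.
have step n x : cI01 x -> `|V n.+1 x - V n x| <= B / 2 ^+ n * expR (l * x).
  elim: n x => [|n IH] x hx.
    rewrite subr0 expr0 divr1 (le_trans (hB _ hx)) // ler_peMr //.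
    by case/andP: (el _ hx).
  have -> : B / 2 ^+ n.+1 * expR (l * x) = B / 2 ^+ n / 2 * expR (l * x).
    by rewrite exprS; field; rewrite expf_eq0 pnatr_eq0 andbF.
  have Bn : 0 <= B / 2 ^+ n by rewrite divr_ge0 // exprn_ge0.
  exact: (contr _ _ _ (cV n.+1) (cV n) Bn IH x hx).
pose E := B * expR l.
have E0 : 0 <= E by rewrite mulr_ge0 ?expR_ge0.
have stepE x : cI01 x -> forall n, `|V n.+1 x - V n x| <= E / 2 ^+ n.
  move=> hx n; apply: le_trans (step n x hx) _.
  rewrite /E mulrAC ler_wpM2r ?invr_ge0 ?exprn_ge0 // ler_wpM2l //.
  by case/andP: (el _ hx).
(* The pointwise limit of the iterates, with the default value 0 off [0, 1]. *)
pose v x := match pselect (cI01 x) with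
  | left p => projT1 (cid (geometric_limit (stepE x p))) | _ => 0 end.
have hv x : cI01 x -> forall n, `|v x - V n x| <= 2 * E / 2 ^+ n.
  by move=> hx; rewrite /v; case: pselect => // p; case: cid.
pose L := `|y1| + (K * (2 * E + 2 * E + 1) + H).
have bV n x : cI01 x -> `|V n x| <= 4 * E.
  move=> hx; have h0 := hv x hx 0%N; have hn := hv x hx n.
  rewrite subr0 expr0 divr1 in h0.
  have : 2 * E / 2 ^+ n <= 2 * E.
    by rewrite ler_pdivrMr ?exprn_gt0 // ler_peMr ?mulr_ge0 // exprn_ege1 // ler1n.
  have := ler_distD (v x) 0 (V n x); rewrite !sub0r !normrN; lra.
have bF n x : I01 x -> `|F (V n) x| <= K * (4 * E) + H.
  move=> /I01_cI01 hx; apply: le_trans (ler_normB _ _) _.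
  by rewrite lerD ?hH // normrM ler_pM ?hK ?bV.
pose L1 := K * (4 * E) + H.
have bT1 n x : I01 x -> `|T1 (V n) x| <= `|y1| + L1.
  move=> hx; apply: le_trans (ler_normD _ _) _; rewrite lerD2l.
  have c0 : continuous (fun _ : R => (0 : R)) by exact: cC.
  have := @mean_value_ineq0 (primitive (F (V n))) (fun t => L1 * t) (F (V n)) (fun=> L1) x (I01_cI01 hx)
     (continuous_primitive (cF _ (cV n))) (cZ (@cX _)).
  rewrite primitive0 subr0 mulr0 subr0 => hh; apply: le_trans (hh _ _ _) _.
  - by move=> y; exact: (is_derive_primitive (cF _ (cV n))).
  - by move=> y _; apply: (is_derive_eq (dZ L1 (did y))); rewrite mulr1.
  - by move=> y; exact: bF.
  rewrite ler_piMr //; first by rewrite /L1 !addr_ge0 ?mulr_ge0.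
  by move/I01E : hx => /andP[_ /ltW].
have L10 : 0 <= `|y1| + L1 by rewrite /L1 !addr_ge0 ?mulr_ge0.
have lipV n x y : cI01 x -> cI01 y -> `|V n x - V n y| <= (`|y1| + L1) * `|x - y|.
  case: n => [|n] hx hy; first by rewrite subrr normr0 mulr_ge0.
  apply: (@lipschitz_cI01 _ _ (T1 (V n))) => //; first exact: contw.
    move=> z hz; rewrite /V iterS -/(V n) /T.
    have := dD (dcst y0 z) (is_derive_primitive (cT1 _ (cV n)) hz).
    by rewrite add0r.
  by move=> z; exact: bT1.
have lipv x y : cI01 x -> cI01 y -> `|v x - v y| <= (`|y1| + L1) * `|x - y|.
  move=> hx hy; rewrite -subr_le0; apply: (@le0_of_geometric _ (4 * E)) => n.
  have h1 := hv x hx n; have h2 := hv y hy n; have h3 := lipV n x y hx hy.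
  have e : 4 * E / 2 ^+ n = 2 * E / 2 ^+ n + 2 * E / 2 ^+ n by ring.
  have := ler_distD (V n x) (v x) (v y); have := ler_distD (V n y) (V n x) (v y).
  rewrite [`|V n y - v y|]distrC e; lra.
have [w lw hw] : exists2 G : R -> R, (forall x y, `|G x - G y| <= (`|y1| + L1) * `|x - y|)
    & forall x, cI01 x -> G x = v x.
  by apply: (@mcshane_extension _ cI01 v _ 0) => //; apply/cI01E; rewrite lexx ler01.
have cw := lipschitz_continuous lw.
have fix_ x : cI01 x -> w x = T w x.
  move=> hx; apply/eqP; rewrite -subr_eq0 -normr_le0; apply: (@le0_of_geometric _ (4 * E * expR l)) => n.
  have hn : `|T w x - V n.+1 x| <= 2 * E / 2 ^+ n / 2 * expR (l * x).
    have En : 0 <= 2 * E / 2 ^+ n by rewrite divr_ge0 ?mulr_ge0 ?exprn_ge0.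
    apply: (contr _ _ _ cw (cV n) En _ x hx).
    move=> t ht; rewrite hw //; apply: le_trans (hv t ht n) _.
    rewrite ler_peMr ?divr_ge0 ?mulr_ge0 ?exprn_ge0 //.
    by case/andP: (el _ ht).
  have hn1 := hv x hx n.+1; rewrite -hw // in hn1.
  have e2 : 2 * E / 2 ^+ n.+1 = E / 2 ^+ n.
    by rewrite exprS; field; rewrite expf_eq0 pnatr_eq0 andbF.
  rewrite e2 in hn1.
  have EE : 0 <= E / 2 ^+ n by rewrite divr_ge0 ?exprn_ge0.
  have /andP[el1 el2] := el x hx.
  have htri : `|w x - T w x| <= `|w x - V n.+1 x| + `|T w x - V n.+1 x|.
    move: (V n.+1 x) (T w x) => z t; rewrite (distrC t); exact: ler_distD.
  apply: le_trans htri _.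
  have -> : 4 * E * expR l / 2 ^+ n = 4 * ((E / 2 ^+ n) * expR l) by ring.
  have e3 : 2 * E / 2 ^+ n / 2 * expR (l * x) = (E / 2 ^+ n) * expR (l * x).
    by field; rewrite expf_eq0 pnatr_eq0 andbF.
  rewrite e3 in hn.
  have := ler_wpM2l EE el2; have := ler_wpM2l EE el1; rewrite mulr1; lra.
exists (T w), (T1 w); split.
- exact: cT.
- exact: cT1.
- move=> x hx; have := dD (dcst y0 x) (is_derive_primitive (cT1 _ cw) hx); by rewrite add0r.
- move=> x hx; have := dD (dcst y1 x) (is_derive_primitive (cF _ cw) hx); rewrite add0r /F -fix_ //.
  exact: I01_cI01.
- by rewrite /T /T1 !primitive0 !addr0.
Qed.

(** At an interior maximum c with v c > M the equation gives v'' > 0 near c,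
    so v increases strictly to the right of c. *)
Lemma max_principle (v v1 k h : R -> R) M : continuous v ->
  (forall x, I01 x -> is_derive x 1 v (v1 x)) ->
  (forall x, I01 x -> is_derive x 1 v1 (k x * v x - h x)) ->
  (forall x, I01 x -> 0 < k x) -> (forall x, I01 x -> h x <= M * k x) ->
  v 0 <= M -> v 1 <= M -> forall x, cI01 x -> v x <= M.
Proof.
move=> cv dv dv1 k0 hM v0 v1M x hx.
have [||c] := @EVT_max R v 0 1; [exact: ler01|exact: contw|].
rewrite in_itv /= => /cI01E hc hmax.
suff : v c <= M by apply: le_trans; apply: hmax; rewrite in_itv; apply/cI01E.
rewrite leNgt; apply/negP => Mc.
have Ic : I01 c.
  move/cI01E: hc; rewrite !le_eqVlt => /andP[/predU1P[c0|c0] /predU1P[c1|c1]]; apply/I01E.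
  - by move: Mc; rewrite -c0 ltNge v0.
  - by move: Mc; rewrite -c0 ltNge v0.
  - by move: Mc; rewrite c1 ltNge v1M.
  - by rewrite c0.
have v1c : v1 c = 0.
  have d0 : is_derive c 1 v 0.
    apply: (@derive1_at_max _ v 0 1 c ler01).
    - by move=> t; rewrite in_itv /= => /I01E /dv[].
    - by rewrite in_itv /=; apply/I01E.
    - by move=> t; rewrite in_itv /= => /I01E/I01_cI01/cI01E ht; apply: hmax; rewrite in_itv.
  by rewrite -(dE (dv c Ic)) (dE d0).
have /nbhs_ballP[e /= e0 he] : \forall y \near c, I01 y /\ M < v y.
  near=> y; split; first by near: y; exact: near_I01.
  by near: y; apply: (cvgr_gt (v c)) => //; exact: cv.
have hb y : c <= y <= c + e / 2 -> I01 y /\ M < v y.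
  by move=> /andP[h1 h2]; apply: he; rewrite /ball /= distrC ger0_norm ?subr_ge0 //; lra.
have cv1 y : I01 y -> {for y, continuous v1} by move=> /dv1 /dcont.
have pos y : c < y <= c + e / 2 -> 0 < v1 y.
  move=> /andP[cy ye].
  have hd z : c < z < y -> is_derive z 1 v1 (k z * v z - h z).
    move=> /andP[cz zy]; apply: dv1.
    by have [] := hb z; rewrite ?(ltW cz) ?(le_trans (ltW zy)).
  have hc' z : c <= z <= y -> {for z, continuous v1}.
    move=> /andP[cz zy]; apply: cv1.
    by have [] := hb z; rewrite ?cz ?(le_trans zy).
  have [z /andP[cz zy] e1] := mean_value_thm cy hd hc'.
  have [Iz Mz] : I01 z /\ M < v z by apply: hb; rewrite (ltW cz) (le_trans (ltW zy)).
  rewrite v1c subr0 in e1; rewrite e1 mulr_gt0 ?subr_gt0 //.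
  by apply: le_lt_trans (hM z Iz) _; rewrite mulrC ltr_pM2l // k0.
have cy : c < c + e / 2 by lra.
have hd z : c < z < c + e / 2 -> is_derive z 1 v (v1 z).
  by move=> /andP[cz zy]; apply: dv; have [] := hb z; rewrite ?(ltW cz) ?(ltW zy).
have [z /andP[cz zy] e1] := mean_value_thm cy hd (fun z _ => cv z).
have [Iy _] : I01 (c + e / 2) /\ M < v (c + e / 2) by apply: hb; rewrite (ltW cy) lexx.
have := hmax (c + e / 2); rewrite in_itv /= => /(_ _) hh.
have : v (c + e / 2) <= v c by apply: hh; apply/cI01E/I01_cI01.
have : 0 < v1 z * (c + e / 2 - c) by rewrite mulr_gt0 ?subr_gt0 // pos // cz ltW.
rewrite -e1; lra.
Unshelve. all: by end_near. Qed.

Lemma max_principle_abs (v v1 k h : R -> R) M : continuous v ->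
  (forall x, I01 x -> is_derive x 1 v (v1 x)) ->
  (forall x, I01 x -> is_derive x 1 v1 (k x * v x - h x)) ->
  (forall x, I01 x -> 0 < k x) -> (forall x, I01 x -> `|h x| <= M * k x) ->
  `|v 0| <= M -> `|v 1| <= M -> forall x, cI01 x -> `|v x| <= M.
Proof.
move=> cv dv dv1 k0 hM v0 v1M x hx.
have cN f : continuous f -> continuous (fun x => - f x).
  by move=> cf y; apply: continuousN; exact: cf.
have h1 : v x <= M.
  apply: (@max_principle v v1 k h) => //; first by move=> y /hM; apply: le_trans; exact: ler_norm.
    by apply: le_trans v0; exact: ler_norm.
  by apply: le_trans v1M; exact: ler_norm.
have h2 : - v x <= M.
  apply: (@max_principle (fun x => - v x) (fun x => - v1 x) k (fun x => - h x) M (cN _ cv)) => //.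
  - by move=> y hy; apply: dN; exact: dv.
  - move=> y hy; have -> : k y * - v y - - h y = - (k y * v y - h y) by ring.
    by apply: dN; exact: dv1.
  - by move=> y /hM; apply: le_trans; rewrite -normrN; exact: ler_norm.
  - by apply: le_trans v0; rewrite -normrN; exact: ler_norm.
  - by apply: le_trans v1M; rewrite -normrN; exact: ler_norm.
by rewrite ler_norml h1 andbT lerNl.
Qed.

(** Shooting. The homogeneous solution with slope 1 at 0 cannot vanish at 1,
    by the maximum principle. *)
Lemma linear_bvp k h (y0 y1 : R) : continuous k -> continuous h -> (forall x, I01 x -> 0 < k x) ->
  exists v v1 : R -> R, [/\ continuous v, continuous v1,
   forall x, I01 x -> is_derive x 1 v (v1 x),
   forall x, I01 x -> is_derive x 1 v1 (k x * v x - h x) & v 0 = y0 /\ v 1 = y1].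
Proof.
move=> ck ch k0.
have I12 : I01 (1/2 : R) by apply/I01E; lra.
have [p [p1 [cp cp1 dp dp1 [p0 p10]]]] := linear_ivp 0 1 ck (@cC _ 0).
have [q [q1 [cq cq1 dq dq1 [q0 _]]]] := linear_ivp y0 0 ck ch.
(* If p 1 = 0 then p = 0, contradicting p1 0 = 1. *)
have pn : p 1 != 0.
  apply/negP => /eqP pe.
  have z x : cI01 x -> p x = 0.
    move=> hx; apply/eqP; rewrite -normr_le0.
    apply: (@max_principle_abs p p1 k (fun=> 0)) => //.
    - by move=> y hy; rewrite normr0 mul0r.
    - by rewrite p0 normr0.
    - by rewrite pe normr0.
  have z1 x : I01 x -> p1 x = 0.
    move=> hx; rewrite -(dE (dp x hx)).
    have := dI (f := fun=> 0) (g := p) hx _ (dcst 0 x); move=> /(_ _)/dE; apply.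
    by move=> y /I01_cI01 hy; rewrite z.
  have := @mean_value_ineq0 p1 (fun=> 0) (fun x => k x * p x - 0) (fun=> 0) (1/2) (I01_cI01 I12) cp1 (@cC _ 0) dp1.
  rewrite z1 // p10 => /(_ _ _) hh.
  have : `|0 - 1| <= 0 - 0 :> R.
    apply: hh => x hx.
    by rewrite z ?mulr0 ?subr0 ?normr0 //; exact: I01_cI01.
  by rewrite !sub0r normrN normr1 oppr0 ler10.
pose c := (y1 - q 1) / p 1.
exists (fun x => q x + c * p x), (fun x => q1 x + c * p1 x); split.
- by apply: cD => //; exact: cZ.
- by apply: cD => //; exact: cZ.
- by move=> x hx; apply: dD; [exact: dq|apply: dZ; exact: dp].
- move=> x hx; have := dD (dq1 x hx) (dZ c (dp1 x hx)); rewrite subr0 => hd.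
  by apply: (is_derive_eq hd); ring.
- by rewrite p0 q0 mulr0 addr0; split=> //; rewrite /c; field.
Qed.

End Bvp.

(** * Derivative weights and Leibniz estimates *)

Ltac pos := repeat first
 [ done | assumption | by apply: ltW | exact: expR_ge0 | exact: normr_ge0 | exact: ler0n | exact: ler01
 | apply: mulr_ge0 | apply: addr_ge0 | apply: exprn_ge0 | rewrite invr_ge0 ].

Section Misc.
Context {R : realType}.

Lemma geometric_half_le2 (r : R) n : 0 <= r -> r <= 1 / 2 -> \sum_(k < n) r ^+ k <= 2.
Proof.
move=> r0 r1; suff : \sum_(k < n) r ^+ k <= 2 - 2 * r ^+ n.
  by move/le_trans; apply; rewrite lerBlDr lerDl mulr_ge0 // exprn_ge0.
elim: n => [|n IH]; first by rewrite big_ord0 expr0 mulr1 subrr.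
rewrite big_ord_recr /= exprS.
have p0 := exprn_ge0 n r0; have := ler_wpM2r p0 r1.
move: IH p0; set s := \sum_(i < n) _; set p := r ^+ n; move=> *; lra.
Qed.

(** Turns the decay (1/2)^M, for an integer M close to X, into exponential
    decay in X; the reason is 1/2 <= e^(-1/2). *)
Lemma half_pow_le_exp (X : R) (M : nat) : X - 1 <= M%:R -> (1 / 2) ^+ M <= 2 * expR (- (X / 2)).
Proof.
move=> h.
have e1 : (1 / 2 : R) <= expR (- (1/2)).
  by have := expR_ge1Dx (- (1/2) : R); lra.
have e2 : (1 / 2 : R) ^+ M <= expR (- (1/2)) ^+ M by apply: lerXn2r; rewrite ?nnegrE ?expR_ge0 //; lra.
apply: le_trans e2 _; rewrite -expRM_natl.
apply: (@le_trans _ _ (expR (1/2) * expR (- (X / 2)))).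
  by rewrite -expRD ler_expR -mulr_natl; lra.
rewrite ler_wpM2r ?expR_ge0 //.
have : expR (1/2 : R) * expR (-(1/2)) = 1 by rewrite -expRD subrr expR0.
have := ler_wpM2l (expR_ge0 (1/2 : R)) e1; lra.
Qed.

Lemma ffact_le n k : (n ^_ k <= n ^ k)%N.
Proof.
elim: k n => [|k IH] n; first by rewrite ffactn0 expn0.
rewrite ffactnS expnS leq_mul2l; case: n => [//|n] /=.
apply: leq_trans (IH n) _; case: k {IH} => [|k]; first by rewrite !expn0.
by rewrite leq_exp2r.
Qed.
End Misc.

Section Weight.
Context {R : realType}.
Variable mu : R.
Hypothesis mu0 : 0 < mu.
Hypothesis mu1 : mu <= 1.

(** The weight of functions analytic on the length scale mu. *)
Definition dwgt (m : nat) : R := Num.max m%:R mu^-1 ^+ m.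

Let mx (m : nat) : R := Num.max m%:R mu^-1.

Lemma mx_ge1 m : 1 <= mx m.
Proof. by rewrite /mx le_max orbC invf_ge1 // mu1. Qed.
Lemma mx_ge0 m : 0 <= mx m.
Proof. by rewrite (le_trans ler01 (mx_ge1 m)). Qed.
Lemma mx_mono m n : (m <= n)%N -> mx m <= mx n.
Proof. by move=> mn; rewrite /mx ge_max !le_max lexx orbT andbT ler_nat mn. Qed.

Lemma dwgt_ge1 m : 1 <= dwgt m.
Proof. by rewrite exprn_ege1 // mx_ge1. Qed.
Lemma dwgt_ge0 m : 0 <= dwgt m.
Proof. exact: le_trans ler01 (dwgt_ge1 m). Qed.

(** Each derivative of v costs a factor 1 / mu, which the weight absorbs by a
    shift of its index. *)
Lemma dwgt_mu m k : mu^-1 ^+ k * dwgt m <= dwgt (m + k).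
Proof.
rewrite /dwgt addnC exprD; apply: ler_pM; rewrite ?exprn_ge0 ?mx_ge0 ?invr_ge0 ?(ltW mu0) //.
  by apply: lerXn2r; rewrite ?nnegrE ?invr_ge0 ?(ltW mu0) ?mx_ge0 // le_max lexx orbT.
by apply: lerXn2r; rewrite ?nnegrE ?mx_ge0 // mx_mono // leq_addl.
Qed.

(** 'C(n, k) k! is a falling factorial, at most n^k, and n <= max(n + j, 1 /
    mu). This is what makes Leibniz sums against analytic coefficients
    geometric. *)
Lemma dwgt_bin n k j : (k <= n)%N -> ('C(n, k) * k`!)%:R * dwgt (n - k + j) <= dwgt (n + j).
Proof.
move=> kn; have -> : (n + j = k + (n - k + j))%N by lia.
rewrite bin_ffact /dwgt [X in _ <= X]exprD.
have e : (k + (n - k + j) = n + j)%N by lia.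
rewrite e; apply: ler_pM; rewrite ?exprn_ge0 ?mx_ge0 //.
  apply: (@le_trans _ _ (n%:R ^+ k)); first by rewrite -natrX ler_nat ffact_le.
  by apply: lerXn2r; rewrite ?nnegrE ?ler0n ?mx_ge0 // le_max ler_nat leq_addr.
by apply: lerXn2r; rewrite ?nnegrE ?mx_ge0 // mx_mono //; lia.
Qed.

Lemma dwgt_fact n j : n`!%:R <= dwgt (n + j).
Proof.
have := @dwgt_bin n n j (leqnn n); rewrite binn mul1n subnn.
apply: le_trans; rewrite ler_peMr // dwgt_ge1 //.
Qed.

Lemma pow_shift (n m : nat) : (n + m)%:R ^+ n <= expR m%:R * n%:R ^+ n :> R.
Proof.
case: n => [|n]; first by rewrite !expr0 mulr1 -expR0 ler_expR.
have n0 : (0 : R) < n.+1%:R by rewrite ltr0n.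
have : 1 + m%:R / n.+1%:R <= expR (m%:R / n.+1%:R) :> R by apply: expR_ge1Dx.
move=> h; have -> : (n.+1 + m)%:R = n.+1%:R * (1 + m%:R / n.+1%:R) :> R.
  by rewrite natrD mulrDr mulr1 [X in _ = _ + X]mulrC divfK // pnatr_eq0.
rewrite exprMn mulrC ler_wpM2r ?exprn_ge0 ?ler0n //.
apply: (@le_trans _ _ (expR (m%:R / n.+1%:R) ^+ n.+1)).
  by apply: lerXn2r => //; rewrite nnegrE ?expR_ge0 // addr_ge0 ?ler01 // divr_ge0 ?ler0n.
by rewrite -expRM_natl -mulr_natl mulrC divfK // pnatr_eq0.
Qed.

(** The converse of the shift: it trades T(n + 2i) for T(n) T(2i), so that the
    powers of eps can be matched with T(2i) alone. The factor e^(n + m) comes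
    from (n + m)^n <= e^m n^n. *)
Lemma dwgt_split n m : dwgt (n + m) <= expR 1 ^+ (n + m) * (dwgt n * dwgt m).
Proof.
have eq : (expR 1 : R) ^+ (n + m) = expR m%:R * expR n%:R.
  by rewrite addnC exprD -!expRM_natl !mulr1.
have E1 : 1 <= (expR 1 : R) ^+ (n + m) by rewrite exprn_ege1 // -[X in X <= _]expR0 ler_expR.
rewrite {1}/dwgt; case: (leP (n + m)%:R mu^-1) => h.
  have h1 : mu^-1 ^+ n <= dwgt n by apply: lerXn2r; rewrite ?nnegrE ?invr_ge0 ?(ltW mu0) ?mx_ge0 // le_max lexx orbT.
  have h2 : mu^-1 ^+ m <= dwgt m by apply: lerXn2r; rewrite ?nnegrE ?invr_ge0 ?(ltW mu0) ?mx_ge0 // le_max lexx orbT.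
  rewrite [mu^-1 ^+ _]exprD; apply: (@le_trans _ _ (dwgt n * dwgt m)).
    by apply: ler_pM => //; rewrite exprn_ge0 // invr_ge0 ltW.
  by rewrite ler_peMl // mulr_ge0 ?dwgt_ge0.
have h1 k : (k%:R : R) ^+ k <= dwgt k.
  by apply: lerXn2r; rewrite ?nnegrE ?ler0n ?mx_ge0 // le_max lexx.
rewrite [_%:R ^+ _]exprD eq mulrACA; apply: ler_pM; rewrite ?exprn_ge0 ?ler0n //.
  by apply: le_trans (pow_shift n m) _; rewrite ler_wpM2l ?expR_ge0.
by rewrite addnC; apply: le_trans (pow_shift m n) _; rewrite ler_wpM2l ?expR_ge0.
Qed.

(** The shift j records how many derivatives have been spent on right-hand
    sides. *)
Definition classM (j : nat) (C g : R) (w : R -> R) := smooth w /\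
  forall n x, I01 x -> `|derive1n n w x| <= C * g ^+ n * dwgt (n + j).

Definition analytic_bd (C g : R) (w : R -> R) := smooth w /\
  forall n x, I01 x -> `|derive1n n w x| <= C * g ^+ n * n`!%:R.

Lemma analytic_bd_classM C g g' w : 0 <= C -> 0 <= g -> g <= g' -> analytic_bd C g w -> classM 0 C g' w.
Proof.
move=> C0 g0 gg [sw h]; split=> // n x hx; apply: le_trans (h n x hx) _.
apply: ler_pM; rewrite ?ler0n ?dwgt_fact ?mulr_ge0 ?exprn_ge0 //.
by apply: ler_wpM2l => //; apply: lerXn2r; rewrite ?nnegrE // (le_trans g0).
Qed.

Lemma leibniz_term_le (a w : R -> R) (Ca ga B g : R) j n k x : I01 x -> analytic_bd Ca ga a ->
  0 < Ca -> 0 < ga -> 0 <= B -> 0 < g -> (k <= n)%N ->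
  `|derive1n (n - k) w x| <= B * g ^+ (n - k) * dwgt (n - k + j) ->
  `|'C(n, k)%:R * (derive1n k a x * derive1n (n - k) w x)|
    <= Ca * B * g ^+ n * dwgt (n + j) * (ga / g) ^+ k.
Proof.
move=> hx [_ ha] Ca0 ga0 B0 g0 kn hw.
rewrite !normrM normr_nat.
apply: (@le_trans _ _ ('C(n, k)%:R * ((Ca * ga ^+ k * k`!%:R) * (B * g ^+ (n - k) * dwgt (n - k + j))))).
  by rewrite ler_wpM2l ?ler0n // ler_pM // ha.
have -> : 'C(n, k)%:R * (Ca * ga ^+ k * k`!%:R * (B * g ^+ (n - k) * dwgt (n - k + j))) =
   Ca * B * (ga ^+ k * g ^+ (n - k)) * (('C(n, k) * k`!)%:R * dwgt (n - k + j)).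
  by rewrite natrM; ring.
have e : ga ^+ k * g ^+ (n - k) = g ^+ n * (ga / g) ^+ k.
  have gk : g ^+ k != 0 by rewrite expf_neq0 // gt_eqF.
  have -> : g ^+ n = g ^+ (n - k) * g ^+ k by rewrite -exprD subnK.
  rewrite expr_div_n; move: (ga ^+ k) (g ^+ k) (g ^+ (n - k)) gk => a' b' c' gk.
  by field.
rewrite e.
have -> : Ca * B * g ^+ n * dwgt (n + j) * (ga / g) ^+ k = Ca * B * (g ^+ n * (ga / g) ^+ k) * dwgt (n + j) by ring.
apply: (ler_wpM2l _ (dwgt_bin j kn)).
by rewrite !mulr_ge0 ?exprn_ge0 ?divr_ge0 ?(ltW Ca0) ?(ltW ga0) ?(ltW g0).
Qed.

Lemma leibniz_sum_le (a w : R -> R) (Ca ga B g : R) j n x : I01 x -> analytic_bd Ca ga a ->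
  0 < Ca -> 0 < ga -> 0 <= B -> 0 < g -> 2 * ga <= g ->
  (forall m, (m <= n)%N -> `|derive1n m w x| <= B * g ^+ m * dwgt (m + j)) ->
  `|leibniz_sum a w n x| <= 2 * Ca * B * g ^+ n * dwgt (n + j).
Proof.
move=> hx ha Ca0 ga0 B0 g0 gg hw.
apply: le_trans (ler_norm_sum _ _ _) _.
apply: (@le_trans _ _ (\sum_(k < n.+1) Ca * B * g ^+ n * dwgt (n + j) * (ga / g) ^+ k)).
  apply: ler_sum => k _; apply: leibniz_term_le => //; first by rewrite -ltnS.
  by apply: hw; rewrite leq_subr.
rewrite -mulr_sumr.
have h : \sum_(k < n.+1) (ga / g) ^+ k <= 2.
  apply: geometric_half_le2; first by rewrite divr_ge0 // ltW.
  by rewrite ler_pdivrMr //; lra.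
have -> : 2 * Ca * B * g ^+ n * dwgt (n + j) = Ca * B * g ^+ n * dwgt (n + j) * 2 by ring.
have T0 := dwgt_ge0 (n + j); rewrite ler_wpM2l //; pos.
Qed.

(** Without the top derivative of w the sum gains the factor ga / g, which is
    how this derivative is absorbed on the left-hand side for g large. *)
Lemma leibniz_tail_le (a w : R -> R) (Ca ga B g : R) j n x : I01 x -> analytic_bd Ca ga a ->
  0 < Ca -> 0 < ga -> 0 <= B -> 0 < g -> 2 * ga <= g ->
  (forall m, (m < n)%N -> `|derive1n m w x| <= B * g ^+ m * dwgt (m + j)) ->
  `|leibniz_sum a w n x - a x * derive1n n w x| <= 2 * (ga / g) * Ca * B * g ^+ n * dwgt (n + j).
Proof.
move=> hx ha Ca0 ga0 B0 g0 gg hw.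
rewrite /leibniz_sum big_ord_recl /= bin0 mul1r subn0 addrC addKr.
apply: le_trans (ler_norm_sum _ _ _) _.
apply: (@le_trans _ _ (\sum_(k < n) Ca * B * g ^+ n * dwgt (n + j) * (ga / g) * (ga / g) ^+ k)).
  apply: ler_sum => k _; rewrite -[X in _ <= X]mulrA -exprS.
  apply: leibniz_term_le => //; rewrite /bump /= add1n //.
  by apply: hw; have := ltn_ord k; lia.
rewrite -mulr_sumr.
have h : \sum_(k < n) (ga / g) ^+ k <= 2.
  apply: geometric_half_le2; first by rewrite divr_ge0 // ltW.
  by rewrite ler_pdivrMr //; lra.
have -> : 2 * (ga / g) * Ca * B * g ^+ n * dwgt (n + j) = Ca * B * g ^+ n * dwgt (n + j) * (ga / g) * 2 by ring.
by have T0 := dwgt_ge0 (n + j); rewrite ler_wpM2l //; pos.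
Qed.

(** Interpolation of v' between v and v'' with step h. The step h = mu / 4
    balances both terms when v'' is of size mu^-2. *)
Lemma landau_ineq (v : R -> R) (B0 B2 h : R) : continuous v -> smooth v -> 0 < h -> h < 1 / 2 ->
  (forall x, cI01 x -> `|v x| <= B0) -> (forall x, I01 x -> `|derive1n 2 v x| <= B2) ->
  forall x, I01 x -> `|derive1n 1 v x| <= 2 * B0 / h + h * B2.
Proof.
move=> cv sv h0 h1 b0 b2 x hx.
have d n y : I01 y -> is_derive y 1 (derive1n n v) (derive1n n.+1 v y) by exact: smooth_d.
have key a b : I01 a -> I01 b -> a < b -> b - a = h -> x = a \/ x = b ->
   `|derive1n 1 v x| <= 2 * B0 / h + h * B2.
  move=> ha hb ab bah hxab.
  have ii z : a <= z <= b -> I01 z.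
    move: ha hb => /I01E/andP[a0 _] /I01E/andP[_ b1] /andP[az zb]; apply/I01E.
    by rewrite (lt_le_trans a0 az) (le_lt_trans zb b1).
  have [c /andP[ac cb] e] := mean_value_thm ab (fun z hz => d 0%N z (ii z (let: conj p q := andP hz in introT andP (conj (ltW p) (ltW q))))) (fun z _ => cv z).
  rewrite !derive1n0 bah in e.
  have Ic : I01 c by apply: ii; rewrite !ltW.
  have e1 : `|derive1n 1 v c| <= 2 * B0 / h.
    have -> : derive1n 1 v c = (v b - v a) / h by rewrite e mulfK // gt_eqF.
    rewrite normrM normfV (gtr0_norm h0) ler_wpM2r ?invr_ge0 ?(ltW h0) //.
    apply: le_trans (ler_normB _ _) _; have := b0 _ (I01_cI01 ha); have := b0 _ (I01_cI01 hb); lra.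
  have B20 : 0 <= B2 by apply: le_trans (b2 c Ic).
  have e2 : `|derive1n 1 v x - derive1n 1 v c| <= B2 * h.
    apply: le_trans (lipschitz_I01 B20 (d 1%N) b2 hx Ic) _; rewrite ler_wpM2l // ler_norml.
    by case: hxab => ->; apply/andP; split; lra.
  have := ler_distD (derive1n 1 v c) (derive1n 1 v x) 0; rewrite !subr0; lra.
have /I01E/andP[x0 x1] := hx.
have [xh|xh] := leP x (1/2).
  by apply: (key x (x + h)); rewrite ?ltrDl //; [apply/I01E; apply/andP; split; lra|ring|left].
by apply: (key (x - h) x); rewrite ?ltrBlDr ?ltrDl //; [apply/I01E; apply/andP; split; lra|ring|right].
Qed.

End Weight.

(** * The smooth part of the expansion *)

Lemma quarter_lt (R : realFieldType) (m : R) : 0 < m -> m <= 1 -> 0 < m / 4 /\ m / 4 < 1 / 2.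
Proof. by move=> h1 h2; split; lra. Qed.

Lemma coupling_le_half (R : realFieldType) (Ca ga al g : R) : 4 * Ca * ga <= g * al ->
  2 * ga * Ca <= al / 2 * g.
Proof. by move=> h; lra. Qed.
Lemma absorb_half (R : realFieldType) (al Ku S t : R) : al * Ku = 2 * S + al -> 0 <= al ->
  t * Ku <= al / 2 * Ku -> S + t * Ku <= al * Ku.
Proof. by move=> h1 h2 h3; lra. Qed.

Section Stage.
Context {R : realType}.
Implicit Types (f u v w h : R -> R).
Variables (a11 a12 a21 a22 : R -> R) (Ca ga al2 : R).
Hypothesis Ca0 : 0 < Ca.
Hypothesis ga0 : 0 < ga.
Hypothesis al0 : 0 < al2.
Hypothesis A11 : analytic_bd Ca ga a11.
Hypothesis A12 : analytic_bd Ca ga a12.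
Hypothesis A21 : analytic_bd Ca ga a21.
Hypothesis A22 : analytic_bd Ca ga a22.
Hypothesis c11 : continuous a11.
Hypothesis c12 : continuous a12.
Hypothesis c21 : continuous a21.
Hypothesis c22 : continuous a22.
Hypothesis l11 : forall x, al2 <= a11 x.
Hypothesis ldet : forall x, I01 x -> al2 <= a22 x - a21 x * a12 x / a11 x.

(** Growth constants of the reduced problem, for v, for u and for mu^2 v''. *)
Definition K0 : R := (1 + Ca / al2) / al2 + 1.
Definition Ku : R := 2 * (1 + 2 * Ca * K0) / al2 + 1.
Definition Kq : R := 1 + 2 * Ca * Ku + 2 * Ca * K0.

(** How large the rate g has to be for the induction on the order of the
    derivative to close. *)
Definition rate_ok (g : R) := [/\ 2 * ga <= g, 4 * Ca * ga / al2 <= g & 8 + Kq <= g].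

Lemma K0_ge1 : 1 <= K0.
Proof. by rewrite /K0 lerDr; pos. Qed.
Lemma Ku_ge0 : 0 <= Ku.
Proof. by have K01 := le_trans ler01 K0_ge1; rewrite /Ku; pos. Qed.
Lemma Kq_ge0 : 0 <= Kq.
Proof. by have K01 := le_trans ler01 K0_ge1; have Ku1 := Ku_ge0; rewrite /Kq; pos. Qed.

Lemma analytic_bd0 f : analytic_bd Ca ga f -> forall x, I01 x -> `|f x| <= Ca.
Proof. by move=> [_ h] x hx; have := h 0%N x hx; rewrite expr0 !mulr1. Qed.

(** Every point of [0, 1] is a limit of points of I. *)
Lemma bd_closure f (B : R) : continuous f -> (forall x, I01 x -> `|f x| <= B) ->
  forall x, cI01 x -> `|f x| <= B.
Proof.
move=> cf h x hx; rewrite leNgt; apply/negP => Bx.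
have hc : `|f y| @[y --> x] --> `|f x| by apply: cvg_norm; exact: cf.
have /nbhs_ballP[e /= e0 he] : \forall y \near x, B < `|f y| by exact: (cvgr_gt _ hc).
have [y Iy yx] : exists2 y, I01 y & `|x - y| < e.
  move/cI01E: hx => /andP[x0 x1].
  pose d := Num.min (e / 2) (1 / 2).
  have d0 : 0 < d by rewrite lt_min; apply/andP; split; lra.
  have d1 : d <= e / 2 by rewrite ge_min lexx.
  have d2 : d <= 1 / 2 by rewrite ge_min lexx orbT.
  have [h1|h1] := leP x (1/2).
    exists (x + d / 2); first by apply/I01E; apply/andP; split; lra.
    by rewrite ltr_norml; apply/andP; split; lra.
  exists (x - d / 2); first by apply/I01E; apply/andP; split; lra.
  by rewrite ltr_norml; apply/andP; split; lra.
have := he y yx; have := h y Iy; lra.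
Qed.

Section mu.
Variable mu : R.
Hypothesis mu0 : 0 < mu.
Hypothesis mu1 : mu <= 1.
Notation dwgt := (dwgt mu).
Notation classM := (classM mu).

(** Induction on n. The differentiated second equation bounds v^(n+2) by lower
    derivatives, the case n = 1 is interpolated, and the differentiated first
    equation bounds a11 u^(n) up to lower order terms. *)
Lemma reduced_problem_bound (j : nat) (C g : R) (u v h1 h2 : R -> R) : rate_ok g -> 0 <= C ->
  continuous v -> smooth u -> smooth v -> classM j C g h1 -> classM j C g h2 ->
  (forall x, I01 x -> a11 x * u x + a12 x * v x = h1 x) ->
  (forall x, I01 x -> mu ^+ 2 * derive1n 2 v x = a21 x * u x + a22 x * v x - h2 x) ->
  (forall x, cI01 x -> `|v x| <= K0 * C * dwgt j) ->
  classM j (K0 * C) g v /\ classM j (Ku * C) g u.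
Proof.
move=> [g1 g2 g3] C0 cv su sv [sh1 b1] [sh2 b2] E1 E2 hv.
have K01 := K0_ge1; have K00 := le_trans ler01 K01; have Ku0 := Ku_ge0; have Kq0 := Kq_ge0.
have gp : 0 < g by lra.
have gg1 : 1 <= g by lra.
have K0C : 0 <= K0 * C by rewrite mulr_ge0.
have KuC : 0 <= Ku * C by rewrite mulr_ge0.
have s11 := A11.1; have s12 := A12.1; have s21 := A21.1; have s22 := A22.1.
have D1 n x : I01 x -> leibniz_sum a11 u n x + leibniz_sum a12 v n x = derive1n n h1 x.
  move=> hx; have [sm1 e1] := derive1n_mul s11 su; have [sm2 e2] := derive1n_mul s12 sv.
  have [_ e] := derive1n_add sm1 sm2.
  by rewrite -(derive1n_ext n E1 hx) e // e1 // e2.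
have D2 n x : I01 x -> mu ^+ 2 * derive1n n.+2 v x = leibniz_sum a21 u n x + leibniz_sum a22 v n x - derive1n n h2 x.
  move=> hx; have [sm1 e1] := derive1n_mul s21 su; have [sm2 e2] := derive1n_mul s22 sv.
  have [sv2 ev2] := smooth_deriv 2 sv.
  have [sz ez] := derive1n_scale (mu ^+ 2) sv2.
  have [sm3 e3] := derive1n_scale (-1) sh2.
  have [sm4 e4] := derive1n_add sm1 sm2; have [_ e5] := derive1n_add sm4 sm3.
  have -> : derive1n n.+2 v x = derive1n n (derive1n 2 v) x by rewrite ev2 // addn2.
  rewrite -ez //.
  rewrite (@derive1n_ext _ _ (fun x => a21 x * u x + a22 x * v x + -1 * h2 x)) //.
    by rewrite e5 // e4 // e1 // e2 // e3 // mulN1r.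
  by move=> y hy; rewrite mulN1r; exact: E2.
pose P n := forall x, I01 x -> `|derive1n n v x| <= K0 * C * g ^+ n * dwgt (n + j) /\
   `|derive1n n u x| <= Ku * C * g ^+ n * dwgt (n + j).
have Tp n : 0 <= dwgt n by exact: dwgt_ge0.
have V2 m x : P m -> (forall i, (i < m)%N -> P i) -> I01 x ->
   `|derive1n m.+2 v x| <= mu^-1 ^+ 2 * (Kq * C * g ^+ m * dwgt (m + j)).
  move=> Pm Pi hx.
  have Pall i : (i <= m)%N -> P i.
    by rewrite leq_eqVlt => /predU1P[->//|]; exact: Pi.
  have bu : `|leibniz_sum a21 u m x| <= 2 * Ca * (Ku * C) * g ^+ m * dwgt (m + j).
    apply: (leibniz_sum_le mu0 mu1 hx A21) => // i im; exact: (Pall i im x hx).2.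
  have bv : `|leibniz_sum a22 v m x| <= 2 * Ca * (K0 * C) * g ^+ m * dwgt (m + j).
    apply: (leibniz_sum_le mu0 mu1 hx A22) => // i im; exact: (Pall i im x hx).1.
  have bh := b2 m x hx.
  have -> : derive1n m.+2 v x = mu^-1 ^+ 2 * (mu ^+ 2 * derive1n m.+2 v x).
    by rewrite mulrA -exprMn mulVf ?gt_eqF // expr1n mul1r.
  rewrite D2 // normrM ger0_norm ?exprn_ge0 ?invr_ge0 ?(ltW mu0) //.
  rewrite ler_wpM2l ?exprn_ge0 ?invr_ge0 ?(ltW mu0) //.
  apply: le_trans (ler_normB _ _) _.
  have := ler_normD (leibniz_sum a21 u m x) (leibniz_sum a22 v m x).
  have -> : Kq * C * g ^+ m * dwgt (m + j) = C * g ^+ m * dwgt (m + j) +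
     2 * Ca * (Ku * C) * g ^+ m * dwgt (m + j) + 2 * Ca * (K0 * C) * g ^+ m * dwgt (m + j).
    by rewrite /Kq; ring.
  lra.
have PP n : P n.
  elim/ltn_ind: n => n IH.
  have bv x : I01 x -> `|derive1n n v x| <= K0 * C * g ^+ n * dwgt (n + j).
    move=> hx; case: n IH => [|[|m]] IH.
    - by rewrite expr0 mulr1 add0n; apply: hv; exact: I01_cI01.
    - have V20 y : I01 y -> `|derive1n 2 v y| <= mu^-1 ^+ 2 * (Kq * C * dwgt j).
        by move=> hy; have := V2 0%N y (IH 0%N isT) (fun i => ltac:(by [])) hy; rewrite expr0 mulr1 add0n.
      have [h0 h1'] := quarter_lt mu0 mu1.
      apply: le_trans (landau_ineq cv sv h0 h1' hv V20 hx) _.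
      have -> : 2 * (K0 * C * dwgt j) / (mu / 4) + mu / 4 * (mu^-1 ^+ 2 * (Kq * C * dwgt j)) =
        (8 * K0 + Kq / 4) * C * (mu^-1 ^+ 1 * dwgt j) by field; rewrite gt_eqF.
      have -> : K0 * C * g ^+ 1 * dwgt (1 + j) = K0 * g * C * dwgt (j + 1) by rewrite expr1 addnC; ring.
      apply: ler_pM; [by pos|by pos; rewrite ?invr_ge0 ltW| |exact: dwgt_mu].
      rewrite ler_wpM2r //.
      have : K0 * (8 + Kq) <= K0 * g by rewrite ler_wpM2l.
      have : Kq <= K0 * Kq by rewrite ler_peMl.
      by lra.
    - have Pm : P m by apply: IH.
      have Pi i : (i < m)%N -> P i by move=> im; apply: IH; exact: (ltn_trans im (leqnSn _)).
      apply: le_trans (V2 m x Pm Pi hx) _.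
      have -> : mu^-1 ^+ 2 * (Kq * C * g ^+ m * dwgt (m + j)) = (Kq * (C * g ^+ m)) * (mu^-1 ^+ 2 * dwgt (m + j)) by ring.
      have -> : K0 * C * g ^+ m.+2 * dwgt (m.+2 + j) = (K0 * g * g) * (C * g ^+ m) * dwgt (m + j + 2).
        have -> : (m.+2 + j = m + j + 2)%N by rewrite addn2.
        by rewrite !exprS; ring.
      apply: ler_pM; [by pos|by pos; rewrite ?invr_ge0 ltW| |exact: dwgt_mu].
      rewrite ler_wpM2r; [by []|by pos|].
      have : 1 * g <= K0 * g by rewrite ler_wpM2r // ltW.
      rewrite mul1r => hh; have : 1 * Kq <= g * (K0 * g) by apply: ler_pM => //; lra.
      lra.
  move=> x hx; split; first exact: bv.
  have bt : `|leibniz_sum a11 u n x - a11 x * derive1n n u x| <= 2 * (ga / g) * Ca * (Ku * C) * g ^+ n * dwgt (n + j).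
    by apply: (leibniz_tail_le mu0 mu1 hx A11) => // m mn; exact: (IH m mn x hx).2.
  have bvl : `|leibniz_sum a12 v n x| <= 2 * Ca * (K0 * C) * g ^+ n * dwgt (n + j).
    apply: (leibniz_sum_le mu0 mu1 hx A12) => // i; rewrite leq_eqVlt => /predU1P[->|im]; first exact: bv.
    exact: (IH i im x hx).1.
  have e : a11 x * derive1n n u x = derive1n n h1 x - leibniz_sum a12 v n x - (leibniz_sum a11 u n x - a11 x * derive1n n u x).
    by rewrite -D1 //; ring.
  have b : `|a11 x * derive1n n u x| <= al2 * Ku * (C * g ^+ n * dwgt (n + j)).
    rewrite e; apply: le_trans (ler_normB _ _) _.
    have := ler_normB (derive1n n h1 x) (leibniz_sum a12 v n x).
    have := b1 n x hx.
    have X0 : 0 <= C * g ^+ n * dwgt (n + j) by pos.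
    move: bvl bt; rewrite (_ : 2 * Ca * (K0 * C) * g ^+ n * dwgt (n + j) = (2 * Ca * K0) * (C * g ^+ n * dwgt (n + j))); last by ring.
    rewrite (_ : 2 * (ga / g) * Ca * (Ku * C) * g ^+ n * dwgt (n + j) = (2 * (ga / g) * Ca * Ku) * (C * g ^+ n * dwgt (n + j))); last by ring.
    move: X0; set X := C * g ^+ n * dwgt (n + j) => X0 i1 i2 i3 i4.
    suff : (1 + 2 * Ca * K0 + 2 * (ga / g) * Ca * Ku) * X <= al2 * Ku * X by lra.
    rewrite ler_wpM2r //.
    have k1 : al2 * Ku = 2 * (1 + 2 * Ca * K0) + al2 by rewrite /Ku mulrDr mulr1; congr (_ + _); field; rewrite gt_eqF.
    have k2 : 2 * (ga / g) * Ca <= al2 / 2.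
      move: g2; rewrite ler_pdivrMr // => g2'.
      have -> : 2 * (ga / g) * Ca = (2 * ga * Ca) / g by field; rewrite gt_eqF.
      by rewrite ler_pdivrMr //; exact: coupling_le_half.
    exact: (absorb_half k1 (ltW al0) (ler_wpM2r Ku0 k2)).
  move: b; rewrite normrM.
  have := ler_wpM2r (normr_ge0 (derive1n n u x)) (le_trans (l11 x) (ler_norm (a11 x))).
  move=> i1 i2; rewrite -(ler_pM2l al0); have := le_trans i1 i2; rewrite !mulrA; lra.
by split; split=> // n x hx; have [] := PP n x hx.
Qed.

Lemma continuous_a11_inv : continuous (fun x => (a11 x)^-1).
Proof.
move=> x; apply: continuousV; last exact: c11.
by rewrite gt_eqF // (lt_le_trans al0).
Qed.

(** Eliminating u turns the system into mu^2 v'' = d v - hh with d = det A /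
    a11 >= al2, which is solvable and obeys the maximum principle. *)
Lemma reduced_problem (j : nat) (C g y0 y1 : R) (h1 h2 : R -> R) : rate_ok g -> 0 <= C ->
  continuous h1 -> continuous h2 -> classM j C g h1 -> classM j C g h2 ->
  `|y0| <= C * dwgt j -> `|y1| <= C * dwgt j ->
  exists u v : R -> R, [/\ continuous u, continuous v,
    classM j ((Ku + K0) * C) g u /\ classM j ((Ku + K0) * C) g v,
    (forall x, a11 x * u x + a12 x * v x = h1 x) /\
    (forall x, I01 x -> mu ^+ 2 * derive1n 2 v x = a21 x * u x + a22 x * v x - h2 x)
    & v 0 = y0 /\ v 1 = y1].
Proof.
move=> gk C0 ch1 ch2 H1 H2 Y0 Y1.
have ip (x : R) : 0 < a11 x by apply: lt_le_trans al0 _.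
have nz x : a11 x != 0 by rewrite gt_eqF.
(* The Schur complement, and the right-hand side that elimination produces. *)
pose d x := a22 x - a21 x * a12 x * (a11 x)^-1.
pose hh x := h2 x - a21 x * h1 x * (a11 x)^-1.
have cd : continuous d by apply: cB => //; apply: cM; [exact: cM|exact: continuous_a11_inv].
have chh : continuous hh by apply: cB => //; apply: cM; [exact: cM|exact: continuous_a11_inv].
pose m2 := mu^-1 ^+ 2.
have m20 : 0 < m2 by rewrite exprn_gt0 // invr_gt0.
have ck : continuous (fun x => m2 * d x) by exact: cZ.
have ch : continuous (fun x => m2 * hh x) by exact: cZ.
have k0 x : I01 x -> 0 < m2 * d x.
  by move=> hx; rewrite mulr_gt0 //; apply: lt_le_trans al0 (ldet hx).
have [v [v1 [cv cv1 dv dv1 [v0 v1y]]]] := linear_bvp y0 y1 ck ch k0.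
have T0 := dwgt_ge0 mu0 mu1 j.
have K01 := K0_ge1; have K00 := le_trans ler01 K01; have Ku0 := Ku_ge0.
have CT0 : 0 <= C * dwgt j by rewrite mulr_ge0.
have CT : C * dwgt j <= K0 * C * dwgt j by rewrite -mulrA ler_peMl.
have bh f : classM j C g f -> forall x, I01 x -> `|f x| <= C * dwgt j.
  by move=> [_ h] x hx; have := h 0%N x hx; rewrite expr0 mulr1 add0n.
have bv x : cI01 x -> `|v x| <= K0 * C * dwgt j.
  apply: (max_principle_abs cv dv dv1 k0).
  - move=> y hy.
    rewrite normrM gtr0_norm // mulrCA ler_pM2l //.
    have hl := ldet hy; have := bh _ H1 y hy; have := bh _ H2 y hy => i2 i1.
    have e1 : `|hh y| <= (1 + Ca / al2) * (C * dwgt j).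
      apply: le_trans (ler_normB _ _) _; rewrite mulrDl mul1r lerD // !normrM normfV.
      have i3 : `|a21 y| * `|a11 y|^-1 <= Ca * al2^-1.
        apply: ler_pM; rewrite ?invr_ge0 //; first exact: (analytic_bd0 A21).
        by rewrite lef_pV2 ?posrE ?gtr0_norm.
      by rewrite mulrAC; apply: ler_pM; rewrite ?mulr_ge0 ?invr_ge0.
    apply: le_trans e1 _.
    apply: (@le_trans _ _ (K0 * C * dwgt j * al2)); last first.
      by rewrite ler_wpM2l //; pos.
    have -> : K0 * C * dwgt j * al2 = (1 + Ca / al2) * (C * dwgt j) + al2 * (C * dwgt j).
      by rewrite /K0; field; rewrite gt_eqF.
    by rewrite lerDl; pos.
  - by rewrite v0; apply: le_trans CT.
  - by rewrite v1y; apply: le_trans CT.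
pose u x := (h1 x - a12 x * v x) * (a11 x)^-1.
have cu : continuous u by apply: cM; [apply: cB => //; exact: cM|exact: continuous_a11_inv].
have s11 := A11.1; have s12 := A12.1; have s21 := A21.1; have s22 := A22.1.
have si : smooth (fun x => (a11 x)^-1) by apply: smooth_inv.
have sh1 := H1.1; have sh2 := H2.1.
have sv : smooth v.
  have sd := smooth_sub s22 (smooth_mul (smooth_mul s21 s12) si).
  have sh := smooth_sub sh2 (smooth_mul (smooth_mul s21 sh1) si).
  exact: (smooth_of_ode (smooth_scale (c := m2) sd) (smooth_scale (c := m2) sh) dv dv1).
have su : smooth u := smooth_mul (smooth_sub sh1 (smooth_mul s12 sv)) si.
have E1 x : a11 x * u x + a12 x * v x = h1 x.
  by rewrite /u; field.
have E2 x : I01 x -> mu ^+ 2 * derive1n 2 v x = a21 x * u x + a22 x * v x - h2 x.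
  move=> hx; have -> : derive1n 2 v x = m2 * d x * v x - m2 * hh x.
    rewrite derive1nS; apply: dE; apply: dI (dv1 x hx) => // y hy.
    by rewrite derive1n1 (dE (dv y hy)).
  rewrite /m2 /d /hh /u; field.
  by rewrite nz gt_eqF.
have [Bv Bu] := reduced_problem_bound gk C0 cv su sv H1 H2 (fun x _ => E1 x) E2 bv.
exists u, v; split=> //.
have w K K' f : K <= K' -> classM j (K * C) g f -> classM j (K' * C) g f.
  move=> KK [sf bf]; split=> // n x hx; apply: le_trans (bf n x hx) _.
  have g0 : 0 <= g by case: gk => g1 _ _; apply: le_trans g1; pos.
  by rewrite ler_wpM2r ?dwgt_ge0 // ler_wpM2r ?exprn_ge0 // ler_wpM2r.
by split; [apply: w Bu; rewrite lerDl|apply: w Bv; rewrite lerDr].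
Qed.

Section seq.
Variables (g CH Cfg th0 th1 : R) (F1 F2 : R -> R).
Hypothesis gk : rate_ok g.
Hypothesis CH0 : 0 <= CH.
Hypothesis Cfg0 : 0 <= Cfg.
Hypothesis hth0 : `|th0| <= CH.
Hypothesis hth1 : `|th1| <= CH.
Hypothesis cF1 : continuous F1.
Hypothesis cF2 : continuous F2.
Hypothesis bF1 : classM 0 Cfg g F1.
Hypothesis bF2 : classM 0 Cfg g F2.

(** KK bounds the solution of one reduced problem, K1 one step of the
    expansion: g^2 for the second derivative on the right-hand side, CH for
    the boundary values. *)
Definition KK : R := Ku + K0.
Definition K1 : R := KK * (g ^+ 2 + CH).

Lemma KK_ge0 : 0 <= KK.
Proof. by have K01 := le_trans ler01 K0_ge1; have Ku1 := Ku_ge0; rewrite /KK; pos. Qed.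

Lemma rate_ok_ge0 : 0 <= g.
Proof. by case: gk => g1 _ _; apply: le_trans g1; pos. Qed.

Lemma K1_ge0 : 0 <= K1.
Proof. by have := KK_ge0; have := rate_ok_ge0 => *; rewrite /K1; pos. Qed.

Lemma dependent_sequence (X : Type) (x0 : X) (G : nat -> X -> Prop) (S : nat -> X -> X -> Prop) :
  G 0%N x0 -> (forall i x, G i x -> exists y, G i.+1 y /\ S i x y) ->
  exists s : nat -> X, s 0%N = x0 /\ forall i, G i (s i) /\ S i (s i) (s i.+1).
Proof.
move=> h0 hS.
have /choice[F hF] : forall p : nat * X, exists y, G p.1 p.2 -> G p.1.+1 y /\ S p.1 p.2 y.
  move=> [i x] /=; case: (pselect (G i x)) => [/hS[y hy]|n]; first by exists y.
  by exists x => /n.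
pose s := fix s n := if n is n'.+1 then F (n', s n') else x0.
have hs i : G i (s i) by elim: i => [//|i IH]; exact: (hF (i, s i) IH).1.
by exists s; split=> // i; split=> //; exact: (hF (i, s i) (hs i)).2.
Qed.

(** The factor mu^-2 in the boundary values is harmless: it is dominated by
    the shift of the weight from 2 i to 2 i.+1. *)
Lemma smooth_terms : exists u v : nat -> R -> R,
  [/\ forall i, [/\ continuous (u i), continuous (v i),
        classM (2 * i) (KK * Cfg * K1 ^+ i) g (u i) & classM (2 * i) (KK * Cfg * K1 ^+ i) g (v i)],
    forall x, I01 x -> a11 x * u 0%N x + a12 x * v 0%N x = F1 x,
    forall x, I01 x -> mu ^+ 2 * derive1n 2 (v 0%N) x = a21 x * u 0%N x + a22 x * v 0%N x - F2 x,
    v 0%N 0 = 0 /\ v 0%N 1 = 0 &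
    forall i, [/\ forall x, I01 x -> a11 x * u i.+1 x + a12 x * v i.+1 x = derive1n 2 (u i) x,
      forall x, I01 x -> mu ^+ 2 * derive1n 2 (v i.+1) x = a21 x * u i.+1 x + a22 x * v i.+1 x,
      v i.+1 0 = mu^-1 ^+ 2 * th0 * u i 0 & v i.+1 1 = mu^-1 ^+ 2 * th1 * u i 1]].
Proof.
have KK0 := KK_ge0; have K10 := K1_ge0; have g0 := rate_ok_ge0.
have z0 : `|0 : R| <= Cfg * dwgt 0 by rewrite normr0 mulr_ge0 ?dwgt_ge0.
have [u0 [v0 [cu0 cv0 [bu0 bv0] [E10 E20] [v00 v01]]]] := reduced_problem gk Cfg0 cF1 cF2 bF1 bF2 z0 z0.
pose G i (p : (R -> R) * (R -> R)) := [/\ continuous p.1, continuous p.2,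
        classM (2 * i) (KK * Cfg * K1 ^+ i) g p.1 & classM (2 * i) (KK * Cfg * K1 ^+ i) g p.2].
pose S (i : nat) (p q : (R -> R) * (R -> R)) :=
   [/\ forall x, I01 x -> a11 x * q.1 x + a12 x * q.2 x = derive1n 2 p.1 x,
      forall x, I01 x -> mu ^+ 2 * derive1n 2 q.2 x = a21 x * q.1 x + a22 x * q.2 x,
      q.2 0 = mu^-1 ^+ 2 * th0 * p.1 0 & q.2 1 = mu^-1 ^+ 2 * th1 * p.1 1].
have [||s [s0 hs]] := @dependent_sequence _ (u0, v0) G S; last first.
- exists (fun i => (s i).1), (fun i => (s i).2); rewrite s0; split=> //.
  + by move=> i; have [] := hs i.
  + by move=> i; have [_ []] := hs i.
- move=> i [u v] [/= cu cv bu bv].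
  set C := KK * Cfg * K1 ^+ i in bu bv.
  have C0 : 0 <= C by rewrite /C; pos.
  have b3 x : I01 x -> `|derive1n 3 u x| <= C * g ^+ 3 * dwgt (3 + 2 * i) by exact: bu.2.
  have [h1 ch1 eh1] := derive1n_extension bu.1 b3.
  have [su2 eu2] := smooth_deriv 2 bu.1.
  pose C' := C * (g ^+ 2 + CH).
  have C'0 : 0 <= C' by rewrite /C'; pos.
  have e2 : (2 * i.+1 = 2 * i + 2)%N by rewrite mulnS addnC.
  have bh1 : classM (2 * i.+1) C' g h1.
    split; first by apply: smooth_ext su2 => y hy; rewrite eh1.
    move=> n x hx; rewrite (derive1n_ext n eh1 hx) eu2 //.
    apply: le_trans (bu.2 (n + 2)%N x hx) _.
    have -> : (n + 2 + 2 * i = n + 2 * i.+1)%N by rewrite e2 -addnA [(2 + _)%N]addnC.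
    rewrite ler_wpM2r ?dwgt_ge0 // exprD /C'.
    have -> : C * (g ^+ 2 + CH) * g ^+ n = C * (g ^+ n * g ^+ 2) + C * CH * g ^+ n by ring.
    by rewrite lerDl; pos.
  have bz : classM (2 * i.+1) C' g (fun=> 0).
    split; first exact: smooth_cst.
    move=> n x hx.
    rewrite derive1n_zero //.
    by have T0 := dwgt_ge0 mu0 mu1 (n + 2 * i.+1); rewrite normr0; pos.
  have be e th : cI01 e -> `|th| <= CH -> `|mu^-1 ^+ 2 * th * u e| <= C' * dwgt (2 * i.+1).
    move=> he hth.
    have bb x : I01 x -> `|u x| <= C * dwgt (2 * i).
      by move=> hx; have := bu.2 0%N x hx; rewrite expr0 mulr1 add0n.
    have b := bd_closure cu bb he.
    rewrite normrM (normrM _ th) (ger0_norm (_ : 0 <= mu^-1 ^+ 2)) ?exprn_ge0 ?invr_ge0 ?(ltW mu0) //.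
    apply: (@le_trans _ _ (mu^-1 ^+ 2 * CH * (C * dwgt (2 * i)))).
      have m0 : 0 <= mu^-1 ^+ 2 by rewrite exprn_ge0 // invr_ge0 ltW.
      by apply: ler_pM => //; [rewrite mulr_ge0|rewrite ler_wpM2l].
    have := dwgt_mu mu0 mu1 (2 * i) 2; rewrite -e2 => hT.
    have -> : mu^-1 ^+ 2 * CH * (C * dwgt (2 * i)) = C * CH * (mu^-1 ^+ 2 * dwgt (2 * i)) by ring.
    have T0 := dwgt_ge0 mu0 mu1 (2 * i.+1).
    apply: (@le_trans _ _ (C * CH * dwgt (2 * i.+1))); first by rewrite ler_wpM2l //; pos.
    rewrite ler_wpM2r // /C' mulrDr lerDr; by pos.
  have h00 : cI01 (0 : R) by apply/cI01E; rewrite lexx ler01.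
  have h11 : cI01 (1 : R) by apply/cI01E; rewrite lexx ler01.
  have [u' [v' [cu' cv' [bu' bv'] [E1' E2'] [v0' v1']]]] :=
    reduced_problem gk C'0 ch1 (@cC _ 0) bh1 bz (be 0 th0 h00 hth0) (be 1 th1 h11 hth1).
  have eC : KK * C' = KK * Cfg * K1 ^+ i.+1.
    rewrite (exprS K1) -[K1 * _]/(KK * (g ^+ 2 + CH) * K1 ^+ i) /C' /C.
    by move: (K1 ^+ i) => z; ring.
  rewrite eC in bu' bv'.
  have G1 : G i.+1 (u', v') by split.
  exists (u', v'); split; first exact: G1.
  split; [move=> x hx | move=> x hx | exact: v0' | exact: v1'].
  + by rewrite -[RHS](eh1 x hx); exact: E1'.
  + by have := E2' x hx; rewrite subr0.
- by split; rewrite //= expr0 mulr1 muln0.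
Qed.

(** The residual of the truncated sum is its last term alone, as the sums
    telescope. The second equation holds exactly, and the boundary relation up
    to its last term. *)
Lemma smooth_expansion (eps r : R) (m : nat) : 0 < eps -> eps * (2 * m.+1)%:R <= r -> eps / mu <= r ->
  r <= 1 -> K1 * expR 1 ^+ 2 * r ^+ 2 <= 1 / 2 ->
  exists w1 w2 : R -> R,
  [/\ continuous w1 /\ continuous w2,
    classM 0 (2 * (KK * Cfg)) (g * expR 1) w1 /\ classM 0 (2 * (KK * Cfg)) (g * expR 1) w2,
    forall x, I01 x -> `|- eps ^+ 2 * derive1n 2 w1 x + a11 x * w1 x + a12 x * w2 x - F1 x|
       <= KK * Cfg * g ^+ 2 * (1 / 2) ^+ m,
    forall x, I01 x -> - mu ^+ 2 * derive1n 2 w2 x + a21 x * w1 x + a22 x * w2 x = F2 x &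
    `|w2 0 - (eps / mu) ^+ 2 * th0 * w1 0| <= CH * (KK * Cfg) * (1 / 2) ^+ m /\
    `|w2 1 - (eps / mu) ^+ 2 * th1 * w1 1| <= CH * (KK * Cfg) * (1 / 2) ^+ m].
Proof.
move=> eps0 er1 er2 r1 hr.
have KK0 := KK_ge0; have K10 := K1_ge0; have g0 := rate_ok_ge0.
have r0 : 0 <= r by apply: le_trans er2; rewrite divr_ge0 ?ltW.
have [u [v [huv E10 E20 [v00 v01] step]]] := smooth_terms.
set C0 := KK * Cfg in huv *.
have C00 : 0 <= C0 by rewrite /C0 mulr_ge0.
(* The powers of eps beat the weights as long as eps * 2i stays below r. *)
have eT i : (i <= m.+1)%N -> eps ^+ (2 * i) * dwgt (2 * i) <= r ^+ (2 * i).
  move=> im; rewrite /dwgt -exprMn; apply: lerXn2r; rewrite ?nnegrE //.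
    by rewrite mulr_ge0 ?(ltW eps0) // (mx_ge0 mu0 mu1).
  rewrite maxr_pMr ?(ltW eps0) // ge_max er2 andbT.
  by apply: le_trans er1; rewrite ler_wpM2l ?(ltW eps0) // ler_nat leq_mul2l.
have E1 : 1 <= expR 1 :> R by rewrite -[X in X <= _]expR0 ler_expR.
have E0 := le_trans ler01 E1.
have r2h : K1 * r ^+ 2 <= 1 / 2.
  apply: le_trans hr; rewrite -mulrA ler_wpM2l // ler_peMl ?exprn_ge0 //.
  by rewrite exprn_ege1.
(* The weights are split by T(n + 2k) <= e^(n + 2k) T(n) T(2k), and the sum over k
   is geometric with ratio at most 1/2. *)
have wcls (w : nat -> R -> R) : (forall i, continuous (w i) /\ classM (2 * i) (C0 * K1 ^+ i) g (w i)) ->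
  continuous (fun x => \sum_(i < m.+1) eps ^+ (2 * i) * w i x) /\
  classM 0 (2 * C0) (g * expR 1) (fun x => \sum_(i < m.+1) eps ^+ (2 * i) * w i x).
  move=> hw; split.
    elim: (m.+1) => [|k IH].
      by under eq_fun do rewrite big_ord0; exact: cC.
    under eq_fun do rewrite big_ord_recr /=.
    by apply: cD => //; apply: cZ; exact: (hw k).1.
  have sF k : smooth (fun x => eps ^+ (2 * k) * w k x) by apply: smooth_scale; exact: (hw k).2.1.
  have [ssum esum] := @derive1n_sum R m.+1 (fun k x => eps ^+ (2 * k) * w k x) (fun k _ => sF k).
  split=> // n x hx; rewrite esum //.
  apply: le_trans (ler_norm_sum _ _ _) _.
  apply: (@le_trans _ _ (\sum_(k < m.+1) C0 * (g * expR 1) ^+ n * dwgt n * (K1 * expR 1 ^+ 2 * r ^+ 2) ^+ k)).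
    apply: ler_sum => k _.
    have [_ ->] := @derive1n_scale R (eps ^+ (2 * k)) _ (hw k).2.1; last by [].
    rewrite normrM (ger0_norm (exprn_ge0 _ (ltW eps0))).
    apply: (@le_trans _ _ (eps ^+ (2 * k) * (C0 * K1 ^+ k * g ^+ n * (expR 1 ^+ (n + 2 * k) * (dwgt n * dwgt (2 * k)))))).
      rewrite ler_wpM2l ?exprn_ge0 ?(ltW eps0) //; apply: le_trans ((hw k).2.2 n x hx) _.
      by rewrite ler_wpM2l; [by []|by pos|exact: dwgt_split].
    have -> : eps ^+ (2 * k) * (C0 * K1 ^+ k * g ^+ n * (expR 1 ^+ (n + 2 * k) * (dwgt n * dwgt (2 * k)))) =
      (C0 * (g * expR 1) ^+ n * dwgt n * (K1 * expR 1 ^+ 2) ^+ k) * (eps ^+ (2 * k) * dwgt (2 * k)).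
      have q1 := exprD (expR 1 : R) n (2 * k)%N.
      have q2 : (K1 * expR 1 ^+ 2) ^+ k = K1 ^+ k * expR 1 ^+ (2 * k) by rewrite exprMn -exprM.
      rewrite q1 q2 (exprMn n g).
      move: (dwgt (2 * k)%N) (dwgt n) (eps ^+ (2 * k)) (expR 1 ^+ (2 * k)) (expR 1 ^+ n) (K1 ^+ k) (g ^+ n) => *.
      by ring.
    have q3 : (K1 * expR 1 ^+ 2 * r ^+ 2) ^+ k = (K1 * expR 1 ^+ 2) ^+ k * r ^+ (2 * k).
      by rewrite exprMn -[r ^+ 2 ^+ k]exprM.
    rewrite q3 [X in _ <= X]mulrA.
    have Tn := dwgt_ge0 mu0 mu1 n.
    rewrite ler_wpM2l; [by []|by pos|]; apply: eT; exact: ltnW (ltn_ord k).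
  rewrite -mulr_sumr.
  have hs : \sum_(k < m.+1) (K1 * expR 1 ^+ 2 * r ^+ 2) ^+ k <= 2.
    by apply: geometric_half_le2 => //; pos.
  have Tn := dwgt_ge0 mu0 mu1 n.
  have -> : 2 * C0 * (g * expR 1) ^+ n * dwgt (n + 0) = C0 * (g * expR 1) ^+ n * dwgt n * 2.
    by rewrite addn0; ring.
  by rewrite ler_wpM2l //; pos.
have cu i : continuous (u i) /\ classM (2 * i) (C0 * K1 ^+ i) g (u i) by have [] := huv i.
have cv i : continuous (v i) /\ classM (2 * i) (C0 * K1 ^+ i) g (v i) by have [] := huv i.
have [cw1 bw1] := wcls u cu; have [cw2 bw2] := wcls v cv.
exists (fun x => \sum_(i < m.+1) eps ^+ (2 * i) * u i x), (fun x => \sum_(i < m.+1) eps ^+ (2 * i) * v i x).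
have d2 (w : nat -> R -> R) : (forall i, continuous (w i) /\ classM (2 * i) (C0 * K1 ^+ i) g (w i)) -> forall x, I01 x ->
    derive1n 2 (fun x => \sum_(i < m.+1) eps ^+ (2 * i) * w i x) x =
    \sum_(i < m.+1) eps ^+ (2 * i) * derive1n 2 (w i) x.
  move=> hw x hx.
  have sF k : smooth (fun x => eps ^+ (2 * k) * w k x) by apply: smooth_scale; exact: (hw k).2.1.
  have [ssum esum] := @derive1n_sum R m.+1 (fun k x => eps ^+ (2 * k) * w k x) (fun k _ => sF k).
  rewrite esum //; apply: eq_bigr => k _.
  by have [_ ->] := @derive1n_scale R (eps ^+ (2 * k)) _ (hw k).2.1.
have tail : K1 ^+ m * r ^+ (2 * m.+1) <= (1 / 2) ^+ m.
  rewrite mulnS exprD [r ^+ (2 * m)]exprM mulrCA -exprMn.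
  apply: (@le_trans _ _ (1 * (K1 * r ^+ 2) ^+ m)).
    by rewrite ler_wpM2r; [by []|by pos|exact: exprn_ile1].
  by rewrite mul1r; apply: lerXn2r; rewrite ?nnegrE //; pos.
split=> //.
- move=> x hx; rewrite d2 //.
  have -> : - eps ^+ 2 * (\sum_(i < m.+1) eps ^+ (2 * i) * derive1n 2 (u i) x) +
     a11 x * (\sum_(i < m.+1) eps ^+ (2 * i) * u i x) +
     a12 x * (\sum_(i < m.+1) eps ^+ (2 * i) * v i x) - F1 x =
     - (eps ^+ (2 * m.+1) * derive1n 2 (u m) x).
    rewrite !mulr_sumr.
    have -> : \sum_(i < m.+1) a11 x * (eps ^+ (2 * i) * u i x) =
       \sum_(i < m.+1) eps ^+ (2 * i) * (a11 x * u i x) by apply: eq_bigr => i _; ring.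
    have -> : \sum_(i < m.+1) a12 x * (eps ^+ (2 * i) * v i x) =
       \sum_(i < m.+1) eps ^+ (2 * i) * (a12 x * v i x) by apply: eq_bigr => i _; ring.
    have e : \sum_(i < m.+1) eps ^+ (2 * i) * (a11 x * u i x) + \sum_(i < m.+1) eps ^+ (2 * i) * (a12 x * v i x)
      = F1 x + \sum_(i < m) eps ^+ (2 * i.+1) * derive1n 2 (u i) x.
      rewrite -big_split /= big_ord_recl /= muln0 expr0 !mul1r E10 //; congr (_ + _).
      apply: eq_bigr => i _; rewrite /bump /= add1n -mulrDr.
      by have [-> //] := step i.
    have e' : \sum_(i < m.+1) - eps ^+ 2 * (eps ^+ (2 * i) * derive1n 2 (u i) x) =
      - \sum_(i < m) eps ^+ (2 * i.+1) * derive1n 2 (u i) x - eps ^+ (2 * m.+1) * derive1n 2 (u m) x.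
      rewrite big_ord_recr /= -sumrN; congr (_ + _); last by rewrite mulnS exprD; ring.
      by apply: eq_bigr => i _; rewrite mulnS exprD; ring.
    rewrite e' -addrA addrA -[X in X - F1 x]addrA e.
    by move: (\sum_(i < m) _) (eps ^+ (2 * m.+1) * _) (F1 x) => s1 s2 s3; ring.
  rewrite normrN normrM (ger0_norm (exprn_ge0 _ (ltW eps0))).
  have b := (cu m).2.2 2%N x hx; have e22 : (2 + 2 * m = 2 * m.+1)%N by rewrite mulnS.
  rewrite e22 in b.
  apply: (@le_trans _ _ (eps ^+ (2 * m.+1) * (C0 * K1 ^+ m * g ^+ 2 * dwgt (2 * m.+1)))).
    by rewrite ler_wpM2l // exprn_ge0 // ltW.
  have -> : eps ^+ (2 * m.+1) * (C0 * K1 ^+ m * g ^+ 2 * dwgt (2 * m.+1)) =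
    C0 * g ^+ 2 * (K1 ^+ m * (eps ^+ (2 * m.+1) * dwgt (2 * m.+1))) by ring.
  rewrite ler_wpM2l; [by []|by pos|].
  apply: le_trans tail; rewrite ler_wpM2l; [by []|by pos|exact: eT].
- move=> x hx; rewrite d2 // !mulr_sumr -!big_split /= big_ord_recl /= muln0 expr0 !mul1r.
  rewrite big1 => [|i _].
    by rewrite addr0 mulNr E20 //; ring.
  rewrite /bump /= add1n; have [_ e _ _] := step i.
  have := e x hx; set z := derive1n 2 _ x => ez.
  have -> : - mu ^+ 2 * (eps ^+ (2 * i.+1) * z) = - eps ^+ (2 * i.+1) * (mu ^+ 2 * z) by ring.
  by rewrite ez; ring.
have bdry e th : cI01 e -> `|th| <= CH -> v 0%N e = 0 ->
    (forall i, v i.+1 e = mu^-1 ^+ 2 * th * u i e) ->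
    `|(\sum_(i < m.+1) eps ^+ (2 * i) * v i e) - (eps / mu) ^+ 2 * th * (\sum_(i < m.+1) eps ^+ (2 * i) * u i e)|
      <= CH * C0 * (1 / 2) ^+ m.
  move=> he hth ve0 ves.
  have -> : \sum_(i < m.+1) eps ^+ (2 * i) * v i e = (eps / mu) ^+ 2 * th * (\sum_(i < m) eps ^+ (2 * i) * u i e).
    rewrite big_ord_recl /= ve0 mulr0 add0r mulr_sumr; apply: eq_bigr => i _.
    by rewrite /bump /= add1n ves mulnS exprD expr_div_n exprVn; ring.
  rewrite -mulrBr big_ord_recr /= opprD addrA subrr add0r mulrN normrN.
  have b := bd_closure (cu m).1 (fun x hx => (cu m).2.2 0%N x hx) he.
  rewrite expr0 mulr1 add0n in b.
  rewrite normrM (normrM _ th) (normrM (eps ^+ _)).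
  have q0 : 0 <= (eps / mu) ^+ 2 by rewrite exprn_ge0 // divr_ge0 // ltW.
  have p0 : 0 <= eps ^+ (2 * m) by rewrite exprn_ge0 // ltW.
  rewrite (ger0_norm q0) (ger0_norm p0).
  apply: (@le_trans _ _ ((eps / mu) ^+ 2 * CH * (eps ^+ (2 * m) * (C0 * K1 ^+ m * dwgt (2 * m))))).
    apply: ler_pM; [by pos|by pos| |]; by rewrite ler_wpM2l.
  have -> : (eps / mu) ^+ 2 * CH * (eps ^+ (2 * m) * (C0 * K1 ^+ m * dwgt (2 * m))) =
    CH * C0 * (K1 ^+ m * (eps ^+ (2 * m.+1) * (mu^-1 ^+ 2 * dwgt (2 * m)))).
    by rewrite mulnS exprD expr_div_n exprVn; ring.
  rewrite ler_wpM2l; [by []|by pos|].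
  apply: le_trans tail; rewrite ler_wpM2l; [by []|by pos|].
  apply: le_trans (eT m.+1 (leqnn _)).
  rewrite ler_wpM2l ?exprn_ge0 ?(ltW eps0) //.
  by have := dwgt_mu mu0 mu1 (2 * m) 2; rewrite addnC -mulnS.
have h00 : cI01 (0 : R) by apply/cI01E; rewrite lexx ler01.
have h11 : cI01 (1 : R) by apply/cI01E; rewrite lexx ler01.
split; first by apply: bdry => // i; have [] := step i.
by apply: bdry => // i; have [] := step i.
Qed.

End seq.
End mu.
End Stage.

(** * A weighted norm on polynomials *)

Lemma dpow {R : realType} (n : nat) (x : R) :
  is_derive x 1 (fun t : R => t ^+ n.+1) (n.+1%:R * x ^+ n).
Proof.
elim: n => [|n IH]; first by apply: (is_derive_eq (did x)); rewrite mulr1.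
have h := dM (did x) IH.
have -> : (fun t : R => t ^+ n.+2) = (fun t => t * t ^+ n.+1) by apply/funext => t; rewrite exprS.
by apply: (is_derive_eq h); rewrite -[in RHS]natr1 !exprS; ring.
Qed.

Lemma is_derive_taylor_term {R : realType} (k : nat) (x : R) : is_derive x 1 (fun t : R => t ^+ k.+1 / k.+1`!%:R) (x ^+ k / k`!%:R).
Proof.
have -> : (fun t : R => t ^+ k.+1 / k.+1`!%:R) = (fun t => k.+1`!%:R^-1 * t ^+ k.+1).
  by apply/funext => t; rewrite mulrC.
apply: (is_derive_eq (dZ (k.+1`!%:R^-1) (dpow k x))).
by rewrite factS natrM invfM mulrACA mulVf ?pnatr_eq0 // mul1r mulrC.
Qed.

(** One term of the exponential series, obtained by repeated integration. *)
Lemma expR_term {R : realType} (k : nat) (y : R) : 0 <= y -> y ^+ k / k`!%:R <= expR y.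
Proof.
move=> y0; elim: k y y0 => [|k IH] y y0.
  by rewrite expr0 fact0 divr1 -[X in X <= _]expR0 ler_expR.
have d (x : R) := is_derive_taylor_term k x.
have H1 : {within `[0, y], continuous (fun t : R => t ^+ k.+1 / k.+1`!%:R)}.
  by apply: contw => x; exact: dcont (d x).
have H2 : {within `[0, y], continuous (@expR R)} by apply: contw; exact: continuous_expR.
have := mean_value_ineq y0 H1 H2 (fun x _ => d x) (fun x _ => is_derive_expR x) _.
rewrite expr0n /= mul0r subr0 expR0 => /(_ _) h.
apply: le_trans (ler_norm _) _; apply: le_trans (h _) _; last by rewrite lerBlDr lerDl ler01.
move=> x /andP[x0 _]; rewrite ger0_norm ?divr_ge0 ?exprn_ge0 ?ler0n ?(ltW x0) //.
by apply: IH; exact: ltW.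
Qed.

Section Poly.
Context {R : realType}.
Variables (N : nat) (eta : R).
Hypothesis eta0 : 0 < eta.
Implicit Types (p q : {poly R}) (s : R).

(** With these weights differentiation has norm at most eta, and evaluation at
    s is bounded by e^(eta s). *)
Definition wt (k : nat) : R := k`!%:R / eta ^+ k.
Definition nrm p : R := \sum_(k < N.+1) `|p`_k| * wt k.

(** All polynomials are kept of degree at most N; products are truncated. *)
Definition sm p := (size p <= N.+1)%N.

Lemma wt_gt0 k : 0 < wt k.
Proof. by rewrite divr_gt0 ?exprn_gt0 // ltr0n fact_gt0. Qed.
Lemma wt_ge0 k : 0 <= wt k.
Proof. exact: ltW (wt_gt0 k). Qed.
Lemma wtS k : wt k.+1 = wt k * (k.+1%:R / eta).
Proof. by rewrite /wt factS natrM exprS; field; rewrite expf_neq0 ?gt_eqF. Qed.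

Lemma pwt_ge0 p k : 0 <= `|p`_k| * wt k.
Proof. by rewrite mulr_ge0 ?wt_ge0. Qed.
Lemma nrm_ge0 p : 0 <= nrm p.
Proof. by apply: sumr_ge0 => k _; rewrite mulr_ge0 ?wt_ge0. Qed.
Lemma nrmD p q : nrm (p + q) <= nrm p + nrm q.
Proof.
rewrite /nrm -big_split /=; apply: ler_sum => k _.
by rewrite coefD -mulrDl ler_wpM2r ?wt_ge0 // ler_normD.
Qed.
Lemma nrmZ (c : R) p : nrm (c *: p) = `|c| * nrm p.
Proof. by rewrite /nrm mulr_sumr; apply: eq_bigr => k _; rewrite coefZ normrM mulrA. Qed.
Lemma nrmB p q : nrm (p - q) <= nrm p + nrm q.
Proof. by apply: le_trans (nrmD _ _) _; rewrite -scaleN1r nrmZ normrN normr1 mul1r. Qed.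
Lemma nrm_sum m (F : nat -> {poly R}) : nrm (\sum_(i < m) F i) <= \sum_(i < m) nrm (F i).
Proof.
elim: m => [|m IH]; first by rewrite !big_ord0 /nrm big1 // => k _; rewrite coef0 normr0 mul0r.
by rewrite !big_ord_recr /=; apply: le_trans (nrmD _ _) _; rewrite lerD2r.
Qed.
Lemma nrm1 : nrm 1 = 1.
Proof.
rewrite /nrm big_ord_recl /= coef1 eqxx normr1 mul1r /wt fact0 expr0 divr1 big1 ?addr0 // => i _.
by rewrite coef1 /= normr0 mul0r.
Qed.

Lemma smD p q : sm p -> sm q -> sm (p + q).
Proof. by move=> hp hq; apply: leq_trans (size_polyD _ _) _; rewrite geq_max; apply/andP. Qed.
Lemma smZ (c : R) p : sm p -> sm (c *: p).
Proof. by move=> hp; apply: leq_trans (size_scale_leq _ _) _. Qed.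
Lemma smB p q : sm p -> sm q -> sm (p - q).
Proof. by move=> hp hq; rewrite -scaleN1r; apply: smD => //; exact: smZ. Qed.
Lemma sm_sum m (F : nat -> {poly R}) : (forall i, sm (F i)) -> sm (\sum_(i < m) F i).
Proof.
move=> h; elim: m => [|m IH]; first by rewrite big_ord0 /sm size_poly0.
by rewrite big_ord_recr /=; exact: smD.
Qed.
Lemma smC (c : R) : sm c%:P.
Proof. by rewrite /sm (leq_trans (size_polyC_leq1 _)). Qed.
Lemma sm_deriv p : sm p -> sm p^`().
Proof.
move=> h; have [->|p0] := eqVneq p 0; first by rewrite linear0 /sm size_poly0.
by apply: leq_trans (ltnW (lt_size_deriv p0)) _.
Qed.

Lemma nrm_deriv p : sm p -> nrm p^`() <= eta * nrm p.
Proof.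
move=> hp; rewrite /nrm.
have e : \sum_(k < N.+2) `|p`_k| * wt k = \sum_(k < N.+1) `|p`_k| * wt k.
  by rewrite big_ord_recr /= nth_default ?normr0 ?mul0r ?addr0.
rewrite -e [X in _ <= eta * X]big_ord_recl mulrDr mulr_sumr.
apply: (@le_trans _ _ (\sum_(i < N.+1) eta * (`|p`_(lift ord0 i)| * wt (lift ord0 i)))).
  apply: ler_sum => k _; rewrite coef_deriv lift0 wtS normrMn -mulr_natr.
  rewrite le_eqVlt; apply/orP; left; apply/eqP; field; exact: lt0r_neq0.
by rewrite lerDr mulr_ge0 ?(ltW eta0) // mulr_ge0 ?wt_ge0.
Qed.

Lemma horner_sm p s : sm p -> p.[s] = \sum_(k < N.+1) p`_k * s ^+ k.
Proof. by move=> h; rewrite (horner_coef_wide s h). Qed.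

Lemma pow_wt s k : s ^+ k = wt k * ((eta * s) ^+ k / k`!%:R).
Proof.
rewrite /wt exprMn; have f0 : (k`!%:R : R) != 0 by rewrite pnatr_eq0 -lt0n fact_gt0.
have e0 : eta ^+ k != 0 by rewrite expf_neq0 // gt_eqF.
by move: (k`!%:R) (eta ^+ k) (s ^+ k) f0 e0 => a b c a0 b0; field; rewrite a0 b0.
Qed.

Lemma horner_le_nrm p s : sm p -> 0 <= s -> `|p.[s]| <= nrm p * expR (eta * s).
Proof.
move=> hp s0; rewrite horner_sm // /nrm mulr_suml.
apply: le_trans (ler_norm_sum _ _ _) _; apply: ler_sum => k _.
rewrite normrM (ger0_norm (exprn_ge0 _ s0)) pow_wt -[X in _ <= X]mulrA.
rewrite ler_wpM2l // ler_wpM2l ?wt_ge0 //.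
by apply: expR_term; rewrite mulr_ge0 // ltW.
Qed.

(** Monomials of degree N are negligible: (eta s)^N / N! = 2^-N (2 eta s)^N /
    N!. All truncation errors are of this kind. *)
Lemma top_coef_le p s : 0 <= s -> `|p`_N| * s ^+ N <= nrm p * ((1 / 2) ^+ N * expR (2 * (eta * s))).
Proof.
move=> s0; have es0 : 0 <= eta * s by rewrite mulr_ge0 // ltW.
have h : `|p`_N| * wt N <= nrm p.
  by rewrite /nrm big_ord_recr /= lerDr sumr_ge0 // => k _; rewrite mulr_ge0 ?wt_ge0.
rewrite pow_wt [X in X <= _]mulrA; apply: ler_pM => //; rewrite ?mulr_ge0 ?wt_ge0 ?invr_ge0 ?exprn_ge0 ?ler0n ?(ltW eta0) //.
have -> : (eta * s) ^+ N / N`!%:R = (1 / 2) ^+ N * ((2 * (eta * s)) ^+ N / N`!%:R).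
  have e : eta * s = 1 / 2 * (2 * (eta * s)) by field.
  by rewrite {1}e (exprMn N (1 / 2) (2 * (eta * s))) -[LHS]mulrA.
rewrite ler_wpM2l ?exprn_ge0 ?divr_ge0 //.
by apply: expR_term; rewrite mulr_ge0.
Qed.

Section ops.
Variable eps : R.
Hypothesis eps0 : 0 < eps.
Variable rho : R.
Hypothesis rho1 : eps * N%:R / eta <= rho.

Lemma rho_ge0 : 0 <= rho.
Proof. by apply: le_trans rho1; rewrite divr_ge0 ?mulr_ge0 ?ler0n ?ltW. Qed.

(** Multiplication by eps times the variable, that is by x, with the monomial
    of degree N.+1 dropped. *)
Definition truncX p : {poly R} := \poly_(k < N.+1) (if k is k'.+1 then eps * p`_k' else 0).

(** Antiderivative vanishing at 0, truncated in the same way. *)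
Definition truncJ p : {poly R} := \poly_(k < N.+1) (if k is k'.+1 then p`_k' / k'.+1%:R else 0).

Lemma sm_truncX p : sm (truncX p).
Proof. exact: size_poly. Qed.
Lemma sm_truncJ p : sm (truncJ p).
Proof. exact: size_poly. Qed.

(** Raising the degree from k to k.+1 <= N multiplies the weight by k.+1 /
    eta, which eps compensates. *)
Lemma nrm_truncX p : nrm (truncX p) <= rho * nrm p.
Proof.
rewrite /nrm big_ord_recl /= coef_poly /= normr0 mul0r add0r.
rewrite big_ord_recr /= mulrDr.
apply: (@le_trans _ _ (rho * \sum_(i < N) `|p`_i| * wt i)); last first.
  by have r0 := rho_ge0; rewrite lerDl mulr_ge0 // pwt_ge0.
rewrite mulr_sumr; apply: ler_sum => k _.
rewrite coef_poly /bump /= add1n ltnS ltn_ord wtS normrM (gtr0_norm eps0).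
have -> : eps * `|p`_k| * (wt k * (k.+1%:R / eta)) = (eps * k.+1%:R / eta) * (`|p`_k| * wt k) by ring.
rewrite ler_wpM2r ?pwt_ge0 //; apply: le_trans rho1.
by rewrite ler_pM2r ?invr_gt0 // ler_pM2l // ler_nat.
Qed.

Lemma nrm_truncJ p : nrm (truncJ p) <= eta^-1 * nrm p.
Proof.
rewrite /nrm big_ord_recl /= coef_poly /= normr0 mul0r add0r.
rewrite big_ord_recr /= mulrDr.
apply: (@le_trans _ _ (eta^-1 * \sum_(i < N) `|p`_i| * wt i)); last first.
  by rewrite lerDl mulr_ge0 ?invr_ge0 ?(ltW eta0) // pwt_ge0.
rewrite mulr_sumr; apply: ler_sum => k _.
rewrite coef_poly /bump /= add1n ltnS ltn_ord wtS normrM normfV normr_nat.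
rewrite le_eqVlt; apply/orP; left; apply/eqP; field.
by rewrite gt_eqF //= -natr1 addrC natr1 pnatr_eq0.
Qed.

Lemma horner_truncX p s : sm p -> (truncX p).[s] = eps * s * p.[s] - eps * p`_N * s ^+ N.+1.
Proof.
move=> hp; rewrite (horner_sm s (sm_truncX p)) (horner_sm s hp) big_ord_recl /= coef_poly /= mul0r add0r.
rewrite [in RHS]big_ord_recr /= mulrDr exprS.
have -> : eps * s * (\sum_(i < N) p`_i * s ^+ i) = \sum_(i < N) (truncX p)`_(bump 0 i) * s ^+ bump 0 i.
  rewrite mulr_sumr; apply: eq_bigr => k _.
  by rewrite coef_poly /bump /= add1n ltnS ltn_ord exprS; ring.
by ring.
Qed.

Lemma horner0_truncJ p : (truncJ p).[0] = 0.
Proof. by rewrite horner_coef0 coef_poly. Qed.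

Lemma horner_deriv_truncJ p s : sm p -> (truncJ p)^`().[s] = p.[s] - p`_N * s ^+ N.
Proof.
move=> hp; rewrite (horner_sm s (sm_deriv (sm_truncJ p))) (horner_sm s hp).
rewrite !big_ord_recr /= addrK coef_deriv [(truncJ p)`_N.+1]nth_default ?mul0rn ?mul0r ?addr0; last exact: sm_truncJ.
apply: eq_bigr => k _; rewrite coef_deriv coef_poly ltnS ltn_ord /= -[_ / _ *+ _]mulr_natr divfK //.
Qed.

(** Multiplication by the power series with coefficients c in x = eps s,
    truncated. *)
Definition truncM (c : nat -> R) p : {poly R} := \sum_(i < N.+1) c i *: iter i truncX p.

Lemma sm_iter_truncX p i : sm p -> sm (iter i truncX p).
Proof. by case: i => [//|i] _; exact: sm_truncX. Qed.
Lemma sm_truncM c p : sm p -> sm (truncM c p).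
Proof. by move=> hp; apply: (@sm_sum _ (fun i => c i *: iter i truncX p)) => i; apply: smZ; exact: sm_iter_truncX. Qed.
Lemma nrm_iter_truncX p i : nrm (iter i truncX p) <= rho ^+ i * nrm p.
Proof.
elim: i => [|i IH]; first by rewrite mul1r.
by rewrite iterS exprS -mulrA (le_trans (nrm_truncX _)) // ler_wpM2l // rho_ge0.
Qed.

Variables (Ca ga : R).
Hypothesis Ca0 : 0 < Ca.
Hypothesis ga0 : 0 < ga.
Hypothesis gr : ga * rho <= 1 / 4.

Lemma gr0 : 0 <= ga * rho.
Proof. by rewrite mulr_ge0 ?rho_ge0 // ltW. Qed.

Lemma nrm_truncM c p : (forall i, `|c i| <= Ca * ga ^+ i) -> nrm (truncM c p) <= 2 * Ca * nrm p.
Proof.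
move=> hc; apply: le_trans (nrm_sum _ (fun i => c i *: iter i truncX p)) _.
apply: (@le_trans _ _ (\sum_(i < N.+1) Ca * nrm p * (ga * rho) ^+ i)).
  apply: ler_sum => i _; rewrite nrmZ exprMn.
  have -> : Ca * nrm p * (ga ^+ i * rho ^+ i) = (Ca * ga ^+ i) * (rho ^+ i * nrm p) by ring.
  by apply: ler_pM; rewrite ?nrm_ge0 ?hc ?nrm_iter_truncX.
rewrite -mulr_sumr.
have -> : 2 * Ca * nrm p = Ca * nrm p * 2 by ring.
apply: ler_wpM2l; first by rewrite mulr_ge0 ?nrm_ge0 // ltW.
by apply: geometric_half_le2; [exact: gr0|have := gr; lra].
Qed.

(** A series without constant term gains the small factor ga rho. *)
Lemma nrm_truncM_tail c p : (forall i, `|c i| <= Ca * ga ^+ i) -> c 0%N = 0 ->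
  nrm (truncM c p) <= 2 * Ca * (ga * rho) * nrm p.
Proof.
move=> hc c0; apply: le_trans (nrm_sum _ (fun i => c i *: iter i truncX p)) _.
rewrite big_ord_recl /= c0 nrmZ normr0 mul0r add0r.
apply: (@le_trans _ _ (\sum_(i < N) Ca * nrm p * (ga * rho) * (ga * rho) ^+ i)).
  apply: ler_sum => i _; rewrite nrmZ -[X in _ <= X]mulrA -exprS exprMn.
  have -> : Ca * nrm p * (ga ^+ i.+1 * rho ^+ i.+1) = (Ca * ga ^+ i.+1) * (rho ^+ i.+1 * nrm p) by ring.
  by rewrite /bump /= add1n; apply: ler_pM; rewrite ?nrm_ge0 ?hc // -[truncX _]/(iter i.+1 truncX p) nrm_iter_truncX.
rewrite -mulr_sumr.
have -> : 2 * Ca * (ga * rho) * nrm p = Ca * nrm p * (ga * rho) * 2 by ring.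
apply: ler_wpM2l; last by apply: geometric_half_le2; [exact: gr0|have := gr; lra].
by rewrite mulr_ge0 ?gr0 // mulr_ge0 ?nrm_ge0 // ltW.
Qed.

Definition trunc_err s : R := (1 / 2) ^+ N * expR (2 * (eta * s)).
Lemma trunc_err_ge0 s : 0 <= trunc_err s.
Proof. by rewrite mulr_ge0 ?expR_ge0 // exprn_ge0 // divr_ge0. Qed.

(** Each application of truncX discards one monomial of degree N.+1, and the
    errors add up. *)
Lemma horner_iter_truncX p s i : sm p -> 0 <= s -> eps * s <= rho ->
  `|(iter i truncX p).[s] - (eps * s) ^+ i * p.[s]| <= i%:R * rho ^+ i * (nrm p * trunc_err s).
Proof.
move=> hp s0 xr; have es0 : 0 <= eps * s by rewrite mulr_ge0 // ltW.
have E0 : 0 <= nrm p * trunc_err s by rewrite mulr_ge0 ?nrm_ge0 ?trunc_err_ge0.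
have r0 := rho_ge0.
elim: i => [|i IH]; first by rewrite /= expr0 mul1r subrr normr0 !mul0r.
rewrite iterS horner_truncX ?sm_iter_truncX //.
set q := iter i truncX p in IH *.
have -> : eps * s * q.[s] - eps * q`_N * s ^+ N.+1 - (eps * s) ^+ i.+1 * p.[s] =
  (eps * s) * (q.[s] - (eps * s) ^+ i * p.[s]) - (eps * s) * (q`_N * s ^+ N).
  by rewrite !exprS; ring.
apply: le_trans (ler_normB _ _) _.
rewrite !normrM (ger0_norm s0) (gtr0_norm eps0) (ger0_norm (exprn_ge0 _ s0)).
have h1 : eps * s * `|q.[s] - (eps * s) ^+ i * p.[s]| <= rho * (i%:R * rho ^+ i * (nrm p * trunc_err s)).
  by apply: ler_pM.
have h2 : eps * s * (`|q`_N| * s ^+ N) <= rho * (rho ^+ i * (nrm p * trunc_err s)).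
  apply: ler_pM => //; first by rewrite mulr_ge0 // exprn_ge0.
  apply: le_trans (top_coef_le q s0) _; rewrite -/(trunc_err s) [X in _ <= X]mulrA ler_wpM2r ?trunc_err_ge0 //.
  exact: nrm_iter_truncX.
rewrite -natr1 exprS; apply: le_trans (lerD h1 h2) _.
by rewrite le_eqVlt; apply/orP; left; apply/eqP; ring.
Qed.

(** The error has two sources: the discarded monomials and the Taylor
    remainder of a, which is of order (ga x)^N.+1 <= 4^-N. *)
Lemma horner_truncM c (a : R -> R) p s : (forall i, `|c i| <= Ca * ga ^+ i) ->
  (forall x, 0 <= x <= 1 -> `|a x - \sum_(i < N.+1) c i * x ^+ i| <= Ca * (ga * x) ^+ N.+1) ->
  sm p -> 0 <= s -> eps * s <= rho -> eps * s <= 1 ->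
  `|(truncM c p).[s] - a (eps * s) * p.[s]| <= 3 * Ca * (nrm p * trunc_err s).
Proof.
move=> hc ha hp s0 xr x1; have es0 : 0 <= eps * s by rewrite mulr_ge0 // ltW.
have E0 : 0 <= nrm p * trunc_err s by rewrite mulr_ge0 ?nrm_ge0 ?trunc_err_ge0.
have r0 := rho_ge0; have g0 := gr0.
set x := eps * s in xr x1 es0 *.
have e1 : (truncM c p).[s] - a x * p.[s] = \sum_(i < N.+1) c i * ((iter i truncX p).[s] - x ^+ i * p.[s])
   - (a x - \sum_(i < N.+1) c i * x ^+ i) * p.[s].
  rewrite /truncM horner_sum mulrBl opprB mulr_suml.
  rewrite addrA -big_split /=; congr (_ - _); apply: eq_bigr => i _.
  by rewrite hornerZ; ring.
rewrite e1; apply: le_trans (ler_normB _ _) _.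
have b1 : `|\sum_(i < N.+1) c i * ((iter i truncX p).[s] - x ^+ i * p.[s])| <= 2 * Ca * (nrm p * trunc_err s).
  apply: le_trans (ler_norm_sum _ _ _) _.
  apply: (@le_trans _ _ (\sum_(i < N.+1) Ca * (nrm p * trunc_err s) * (1 / 2) ^+ i)).
    apply: ler_sum => i _; rewrite normrM.
    apply: (@le_trans _ _ ((Ca * ga ^+ i) * (i%:R * rho ^+ i * (nrm p * trunc_err s)))).
      by apply: ler_pM => //; exact: horner_iter_truncX.
    have -> : Ca * ga ^+ i * (i%:R * rho ^+ i * (nrm p * trunc_err s)) = Ca * (nrm p * trunc_err s) * (i%:R * (ga * rho) ^+ i).
      by rewrite exprMn; ring.
    apply: ler_wpM2l; first by rewrite mulr_ge0 // ltW.
    apply: (@le_trans _ _ (2 ^+ i * (1 / 4) ^+ i)).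
      apply: ler_pM; rewrite ?ler0n ?exprn_ge0 //.
        by rewrite -natrX ler_nat ltnW // ltn_expl.
      by apply: lerXn2r; rewrite ?nnegrE // divr_ge0.
    by rewrite -exprMn le_eqVlt; apply/orP; left; apply/eqP; congr (_ ^+ _); field.
  rewrite -mulr_sumr; have -> : 2 * Ca * (nrm p * trunc_err s) = Ca * (nrm p * trunc_err s) * 2 by ring.
  apply: ler_wpM2l; first by rewrite mulr_ge0 // ltW.
  by apply: geometric_half_le2 => //; rewrite divr_ge0.
have b2 : `|(a x - \sum_(i < N.+1) c i * x ^+ i) * p.[s]| <= Ca * (nrm p * trunc_err s).
  rewrite normrM; apply: (@le_trans _ _ (Ca * (ga * x) ^+ N.+1 * (nrm p * expR (eta * s)))).
    by apply: ler_pM => //; [apply: ha; rewrite es0 x1|exact: horner_le_nrm].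
  rewrite -!mulrA; apply: ler_wpM2l; first exact: ltW.
  rewrite mulrCA; apply: ler_wpM2l; first exact: nrm_ge0.
  have gx0 : 0 <= ga * x by rewrite mulr_ge0 // ltW.
  have gx : ga * x <= 1 / 4 by apply: le_trans gr; rewrite ler_wpM2l // ltW.
  rewrite /trunc_err; apply: ler_pM; [exact: exprn_ge0|exact: expR_ge0| |].
    rewrite exprS; apply: (@le_trans _ _ (1 * (1/2) ^+ N)); last by rewrite mul1r.
    apply: ler_pM; [by []|exact: exprn_ge0|by lra|].
    by apply: lerXn2r; rewrite ?nnegrE ?divr_ge0 //; lra.
  have ets : 0 <= eta * s by rewrite mulr_ge0 // ltW.
  by rewrite ler_expR; lra.
lra.
Qed.

End ops.
End Poly.

(** * Exponential polynomials *)

Section Entire.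
Context {R : realType}.
Implicit Types (w : R -> R) (p : {poly R}).

Lemma entire_ext w1 w2 : w1 =1 w2 -> entire w1 -> entire w2.
Proof. by move=> e [a h]; exists a => x; rewrite -e. Qed.

Lemma entire_add w1 w2 : entire w1 -> entire w2 -> entire (fun x => w1 x + w2 x).
Proof.
move=> [a ha] [b hb]; exists (fun k => a k + b k) => x.
have -> : pseries (fun k => a k + b k) x = (fun n => pseries a x n + pseries b x n).
  apply/funext => n; rewrite /pseries /series /= -big_split /=.
  by apply: eq_bigr => k _; rewrite mulrDl.
by apply: cvgD; [exact: ha|exact: hb].
Qed.

Lemma entire_scale c w : entire w -> entire (fun x => c * w x).
Proof.
move=> [a ha]; exists (fun k => c * a k) => x.
have -> : pseries (fun k => c * a k) x = (fun n => c * pseries a x n).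
  apply/funext => n; rewrite /pseries /series /= mulr_sumr.
  by apply: eq_bigr => k _; rewrite mulrA.
by apply: cvgM; [exact: cvg_cst|exact: ha].
Qed.

(** The shift of the coefficients. With this, exponential polynomials are
    entire by induction on the polynomial. *)
Lemma entire_mulX w : entire w -> entire (fun x => x * w x).
Proof.
move=> [a ha]; exists (fun k => if k is k'.+1 then a k' else 0) => x.
rewrite -cvg_shiftS.
have -> : [sequence pseries (fun k => if k is k'.+1 then a k' else 0) x n.+1]_n = (fun n => x * pseries a x n).
  apply/funext => n; rewrite /pseries /series /= big_nat_recl // mul0r add0r mulr_sumr.
  by apply: eq_bigr => k _; rewrite exprS mulrCA.
by apply: cvgM; [exact: cvg_cst|exact: ha].
Qed.

Lemma entire_expR (l : R) : entire (fun x => expR (l * x)).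
Proof.
exists (fun k => l ^+ k / k`!%:R) => x.
have -> : pseries (fun k => l ^+ k / k`!%:R) x = series (exp_coeff (l * x)).
  apply/funext => n; rewrite /pseries /series /=; apply: eq_bigr => k _.
  by rewrite /exp_coeff /= exprMn mulrAC.
exact: is_cvg_series_exp_coeff.
Qed.

Lemma entire_exp_poly (l : R) p : entire (fun x => expR (l * x) * p.[x]).
Proof.
elim/poly_ind: p => [|p c IH].
  by apply: entire_ext (entire_scale 0 (entire_expR l)) => x; rewrite horner0 mulr0 mul0r.
apply: entire_ext (entire_add (entire_mulX IH) (entire_scale c (entire_expR l))) => x.
by rewrite hornerMXaddC; ring.
Qed.

End Entire.

Section ExpPoly.
Context {R : realType}.
Variables (N : nat) (eta beta eps : R).
Hypothesis eta0 : 0 < eta.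
Hypothesis beta0 : 0 < beta.
Hypothesis eps0 : 0 < eps.
Implicit Types (p : {poly R}).
Notation nrm := (nrm N eta).
Notation sm := (sm N).

(** A layer function in the stretched variable s = x / eps. *)
Definition exp_profile p (x : R) : R := expR (- (beta / eps) * x) * p.[x / eps].

(** The operator that d/ds induces on the polynomial factor of e^(- beta s)
    p(s). *)
Definition profile_deriv p : {poly R} := p^`() - beta *: p.

Lemma entire_exp_profile p : entire (exp_profile p).
Proof.
apply: entire_ext (entire_exp_poly (- (beta / eps)) (p \Po (eps^-1 *: 'X))) => x.
by rewrite /exp_profile horner_comp hornerZ hornerX [x / eps]mulrC.
Qed.

Lemma entire_exp_profile_refl p : entire (fun x => exp_profile p (1 - x)).
Proof.
have h := entire_scale (expR (- (beta / eps))) (entire_exp_poly (beta / eps) (p \Po (eps^-1 *: (1 - 'X)))).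
apply: entire_ext h => x.
rewrite /exp_profile horner_comp hornerZ hornerD hornerN hornerX hornerC mulrA -expRD.
by congr (expR _ * p.[_]); ring.
Qed.

Lemma is_derive_exp_profile p (x : R) : is_derive x 1 (exp_profile p) (eps^-1 * exp_profile (profile_deriv p) x).
Proof.
have h1 := dexp (- (beta / eps)) x.
have h2 : is_derive x 1 (fun t : R => t / eps) eps^-1.
  have -> : (fun t : R => t / eps) = (fun t => eps^-1 * t) by apply/funext => t; rewrite mulrC.
  by apply: (is_derive_eq (dZ eps^-1 (did x))); rewrite mulr1.
have h3 := @dcomp R (horner p) (fun t => t / eps) x _ _ (dpoly p (x / eps)) h2.
apply: (is_derive_eq (dM h1 h3)); rewrite /exp_profile /profile_deriv hornerD hornerN hornerZ; ring.
Qed.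

Lemma derive1n_exp_profile p n : derive1n n (exp_profile p) = fun x => eps^-1 ^+ n * exp_profile (iter n profile_deriv p) x.
Proof.
elim: n => [|n IH]; first by apply/funext => x; rewrite mul1r.
rewrite derive1nS IH; apply/funext => x.
rewrite (dE (dZ (eps^-1 ^+ n) (is_derive_exp_profile (iter n profile_deriv p) x))) iterS exprS; ring.
Qed.

Lemma is_derive_derive1n_exp_profile p n (x : R) : is_derive x 1 (derive1n n (exp_profile p)) (derive1n n.+1 (exp_profile p) x).
Proof.
rewrite derive1nS derive1n_exp_profile; apply: derivd.
by have := dZ (eps^-1 ^+ n) (is_derive_exp_profile (iter n profile_deriv p) x) => -[].
Qed.

Lemma sm_profile_deriv p : sm p -> sm (profile_deriv p).
Proof. by move=> h; apply: smB; [exact: sm_deriv|exact: smZ]. Qed.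
Lemma nrm_profile_deriv p : sm p -> nrm (profile_deriv p) <= (beta + eta) * nrm p.
Proof.
move=> h; apply: le_trans (nrmB _ eta0 _ _) _; rewrite nrmZ (gtr0_norm beta0) mulrDl addrC lerD2l.
exact: nrm_deriv.
Qed.
Lemma sm_iter_profile_deriv p n : sm p -> sm (iter n profile_deriv p).
Proof. by move=> h; elim: n => [//|n IH]; exact: sm_profile_deriv. Qed.
Lemma nrm_iter_profile_deriv p n : sm p -> nrm (iter n profile_deriv p) <= (beta + eta) ^+ n * nrm p.
Proof.
move=> h; elim: n => [|n IH]; first by rewrite mul1r.
rewrite iterS exprS -mulrA; apply: le_trans (nrm_profile_deriv (sm_iter_profile_deriv n h)) _.
by rewrite ler_wpM2l // ltW // addr_gt0.
Qed.

Lemma exp_profile_le p x : sm p -> 0 <= x -> `|exp_profile p x| <= nrm p * expR (- ((beta - eta) * (x / eps))).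
Proof.
move=> h x0; have s0 : 0 <= x / eps by rewrite divr_ge0 // ltW.
rewrite /exp_profile normrM (ger0_norm (expR_ge0 _)).
apply: (@le_trans _ _ (expR (- (beta / eps) * x) * (nrm p * expR (eta * (x / eps))))).
  by rewrite ler_wpM2l ?expR_ge0 //; exact: horner_le_nrm.
rewrite mulrCA -expRD le_eqVlt; apply/orP; left; apply/eqP; congr (_ * expR _); ring.
Qed.

(** n derivatives cost (beta + eta)^n, and the growth e^(eta s) of the
    polynomial is paid for by the decay rate beta - eta. *)
Lemma derive1n_exp_profile_le p n x : sm p -> 0 <= x ->
  `|derive1n n (exp_profile p) x| <= nrm p * ((beta + eta) / eps) ^+ n * expR (- ((beta - eta) * (x / eps))).
Proof.
move=> h x0; rewrite derive1n_exp_profile normrM ger0_norm ?exprn_ge0 ?invr_ge0 ?(ltW eps0) //.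
have h1 := exp_profile_le (sm_iter_profile_deriv n h) x0; have h2 := nrm_iter_profile_deriv n h.
apply: (@le_trans _ _ (eps^-1 ^+ n * ((beta + eta) ^+ n * nrm p * expR (- ((beta - eta) * (x / eps)))))).
  rewrite ler_wpM2l ?exprn_ge0 ?invr_ge0 ?(ltW eps0) //; apply: le_trans h1 _.
  by rewrite ler_wpM2r ?expR_ge0.
by rewrite exprMn le_eqVlt; apply/orP; left; apply/eqP; ring.
Qed.

(** The term - beta^2 p will cancel the value at 0 of the zeroth order
    coefficient. *)
Lemma derive2_exp_profile p (x : R) : - eps ^+ 2 * derive1n 2 (exp_profile p) x =
  expR (- (beta / eps) * x) * (- p^`()^`().[x / eps] + 2 * beta * p^`().[x / eps] - beta ^+ 2 * p.[x / eps]).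
Proof.
rewrite derive1n_exp_profile /= /exp_profile /profile_deriv derivB derivZ !(hornerD, hornerN, hornerZ).
by field; rewrite gt_eqF.
Qed.

End ExpPoly.

(** * Boundary layers *)

Section Layer.
Context {R : realType}.
Variables (b11 b12 b21 b22 : R -> R) (t11 t12 t21 t22 : nat -> R) (Ca ga beta : R).
Hypothesis Ca0 : 0 < Ca.
Hypothesis ga0 : 0 < ga.
Hypothesis beta0 : 0 < beta.
Hypothesis t11b : t11 0%N = beta ^+ 2.

(** Coefficients and all remainders of the Taylor series at 0; this is how
    analyticity of the coefficients enters the layers. *)
Definition taylor_bounded (b : R -> R) (t : nat -> R) := (forall i, `|t i| <= Ca * ga ^+ i) /\
  forall N x, 0 <= x <= 1 -> `|b x - \sum_(i < N) t i * x ^+ i| <= Ca * (ga * x) ^+ N.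
Hypothesis T11 : taylor_bounded b11 t11.
Hypothesis T12 : taylor_bounded b12 t12.
Hypothesis T21 : taylor_bounded b21 t21.
Hypothesis T22 : taylor_bounded b22 t22.

Let t11' i := if i is 0%N then 0 else t11 i.
Let b11' x := b11 x - beta ^+ 2.

Lemma taylor_bd b t x : taylor_bounded b t -> 0 <= x <= 1 -> `|b x| <= Ca.
Proof. by move=> [_ h] hx; have := h 0%N x hx; rewrite big_ord0 subr0 expr0 mulr1. Qed.

Lemma t11'_bd i : `|t11' i| <= Ca * ga ^+ i.
Proof. by case: i => [|i]; [rewrite normr0 expr0 mulr1 ltW|exact: T11.1]. Qed.

Lemma b11'_taylor N x : 0 <= x <= 1 ->
  `|b11' x - \sum_(i < N.+1) t11' i * x ^+ i| <= Ca * (ga * x) ^+ N.+1.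
Proof.
move=> hx; have := T11.2 N.+1 x hx; rewrite !big_ord_recl /= t11b expr0 mulr1 mul0r add0r.
by rewrite opprD addrA.
Qed.

Lemma b11'_bd x : 0 <= x <= 1 -> `|b11' x| <= 2 * Ca.
Proof.
move=> hx; apply: le_trans (ler_normB _ _) _; rewrite -t11b.
have := taylor_bd T11 hx; have := T11.1 0%N; rewrite expr0 mulr1; lra.
Qed.

Lemma beta2_le : beta ^+ 2 <= Ca.
Proof. by rewrite -t11b; apply: le_trans (ler_norm _) _; have := T11.1 0%N; rewrite expr0 mulr1. Qed.

Section fix_eps.
Variables (eta rho theta eps tau : R) (N : nat).
Hypothesis eta_def : eta = beta / 16.
Hypothesis theta_def : theta = beta ^+ 2 / (16 * Ca).
Hypothesis rho0 : 0 < rho.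
Hypothesis rho1 : rho <= 1.
Hypothesis gr : ga * rho <= 1 / 4.
Hypothesis gr2 : 2 * Ca * (ga * rho) <= beta * eta / 2.
Hypothesis eps0 : 0 < eps.
Hypothesis tau0 : 0 <= tau.
Hypothesis tau1 : tau <= 1.
Hypothesis tau2 : tau * (Ca / (beta * eta) + 2 * Ca * theta / beta ^+ 2) <= theta / 4.
Hypothesis epsN : eps * N%:R / eta <= rho.
Notation nrm := (nrm N eta).
Notation sm := (sm N).
Notation truncM := (truncM N eps).
Notation truncJ := (truncJ N).
Implicit Types y : {poly R} * {poly R}.

Lemma eta_gt0 : 0 < eta.
Proof. by rewrite eta_def divr_gt0. Qed.
Lemma theta_gt0 : 0 < theta.
Proof. by rewrite theta_def divr_gt0 ?exprn_gt0 ?mulr_gt0. Qed.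

(** The terms of the first layer equation which are small: b11 - beta^2
    vanishes at 0, and b12 comes with tau. *)
Definition layer_coupling y := truncM t11' y.1 + tau *: truncM t12 y.2.

(** With e = e^(- beta s) p the layer equations are 2 beta G' - G'' + (b11 -
    beta^2) G + tau b12 H = 0 and 2 beta H' - H'' - beta^2 H + b21 G + tau b22
    H = 0. The step solves the first for the leading term 2 beta G', with
    value 0 at s = 0, and the second for beta^2 H. *)
Definition layer_step1 y : {poly R} := (2 * beta)^-1 *: (y.1^`() - (y.1^`()`_0)%:P - truncJ (layer_coupling y)).
Definition layer_step2 y : {poly R} := (beta ^+ 2)^-1 *:
  ((2 * beta) *: y.2^`() - y.2^`()^`() + truncM t21 y.1 + tau *: truncM t22 y.2).
Definition layer_step y := (layer_step1 y, layer_step2 y).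

(** The small weight theta makes the coupling b21 from G to H small; the
    reverse coupling is small because of tau. *)
Definition pair_nrm y : R := nrm y.1 + theta * nrm y.2.
Definition sm2 y := sm y.1 /\ sm y.2.

Lemma sm_layer_coupling y : sm2 y -> sm (layer_coupling y).
Proof. by move=> [h1 h2]; apply: smD; [exact: sm_truncM|apply: smZ; exact: sm_truncM]. Qed.

Lemma sm_layer_step y : sm2 y -> sm2 (layer_step y).
Proof.
move=> h; have [h1 h2] := h; split.
  apply: smZ; apply: smB; last exact: sm_truncJ.
  by apply: smB; [exact: sm_deriv|exact: smC].
apply: smZ; apply: smD; last by apply: smZ; exact: sm_truncM.
apply: smD; last exact: sm_truncM.
apply: smB; first by apply: smZ; exact: sm_deriv.
by apply: sm_deriv; exact: sm_deriv.
Qed.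

Lemma nrm_layer_coupling y : sm2 y -> nrm (layer_coupling y) <= 2 * Ca * (ga * rho) * nrm y.1 + tau * (2 * Ca * nrm y.2).
Proof.
move=> [h1 h2]; have e0 := eta_gt0; apply: le_trans (nrmD _ e0 _ _) _.
apply: lerD; first by apply: (nrm_truncM_tail e0 eps0 epsN Ca0 ga0 gr) => //; exact: t11'_bd.
rewrite nrmZ ger0_norm // ler_wpM2l //.
by apply: (nrm_truncM e0 eps0 epsN Ca0 ga0 gr); exact: T12.1.
Qed.

Lemma nrm_dtail (p : {poly R}) : nrm (p - (p`_0)%:P) <= nrm p.
Proof.
have e0 := eta_gt0.
apply: ler_sum => k _; rewrite coefB coefC; case: eqP => [->|_]; last by rewrite subr0.
by rewrite subrr normr0 mul0r pwt_ge0.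
Qed.

(** The numerical content of the contraction: with eta = beta / 16 and theta =
    beta^2 / (16 Ca) the coefficients of g add up to 1/32 + 1/4 + 1/8 < 1/2,
    and those of h to less than theta / 2. *)
Lemma contraction_ineq (g h q1 d1 m : R) : 0 <= g -> 0 <= h ->
   q1 <= 2 * Ca * (ga * rho) * g + tau * (2 * Ca * h) ->
   d1 <= eta * g -> m <= (2 * beta) * (eta * h) + eta * (eta * h) + 2 * Ca * g + tau * (2 * Ca * h) ->
   (2 * beta)^-1 * (d1 + eta^-1 * q1) + theta * ((beta ^+ 2)^-1 * m) <= 1 / 2 * (g + theta * h).
Proof.
move=> g0 h0 hq hd hm.
have e0 := eta_gt0; have th0 := theta_gt0.
have i1 : (2 * beta)^-1 * (d1 + eta^-1 * q1) <= (2 * beta)^-1 * (eta * g + eta^-1 * ((beta * eta / 2) * g + tau * (2 * Ca * h))).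
  rewrite ler_wpM2l ?invr_ge0 ?mulr_ge0 ?(ltW beta0) //; apply: lerD => //.
  rewrite ler_wpM2l ?invr_ge0 ?(ltW e0) //; apply: le_trans hq _; rewrite lerD2r.
  by rewrite ler_wpM2r.
have i2 : theta * ((beta ^+ 2)^-1 * m) <= theta * ((beta ^+ 2)^-1 * ((2 * beta) * (eta * h) + eta * (eta * h) + 2 * Ca * g + tau * (2 * Ca * h))).
  by rewrite ler_wpM2l ?(ltW th0) // ler_wpM2l // invr_ge0 exprn_ge0 // ltW.
apply: le_trans (lerD i1 i2) _.
have bn : beta != 0 by rewrite gt_eqF.
have en : eta != 0 by rewrite gt_eqF.
have Cn : Ca != 0 by rewrite gt_eqF.
have -> : (2 * beta)^-1 * (eta * g + eta^-1 * (beta * eta / 2 * g + tau * (2 * Ca * h))) +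
   theta * ((beta ^+ 2)^-1 * (2 * beta * (eta * h) + eta * (eta * h) + 2 * Ca * g + tau * (2 * Ca * h))) =
   (eta / (2 * beta) + 1 / 4 + theta * 2 * Ca / beta ^+ 2) * g +
   (tau * (Ca / (beta * eta) + 2 * Ca * theta / beta ^+ 2) + theta * (2 * (eta / beta) + (eta / beta) ^+ 2)) * h.
  by field; rewrite bn en.
have -> : eta / (2 * beta) = 1 / 32 by rewrite eta_def; field.
have -> : eta / beta = 1 / 16 by rewrite eta_def; field.
have -> : theta * 2 * Ca / beta ^+ 2 = 1 / 8 by rewrite theta_def; field; rewrite bn Cn.
have thh : 0 <= theta * h by rewrite mulr_ge0 // ltW.
have := ler_wpM2r h0 tau2; move: (tau * _) => z hz.
rewrite mulrDl; lra.
Qed.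

Lemma pair_nrm_step y : sm2 y -> pair_nrm (layer_step y) <= 1 / 2 * pair_nrm y.
Proof.
move=> h; have [h1 h2] := h; have e0 := eta_gt0.
have b0 : 0 <= (2 * beta)^-1 by rewrite invr_ge0 mulr_ge0 // ltW.
have bb0 : 0 <= (beta ^+ 2)^-1 by rewrite invr_ge0 exprn_ge0 // ltW.
rewrite /pair_nrm /layer_step /= /layer_step1 /layer_step2 !nrmZ (ger0_norm b0) (ger0_norm bb0).
have K := contraction_ineq (nrm_ge0 N e0 y.1) (nrm_ge0 N e0 y.2) (nrm_layer_coupling h) (nrm_deriv e0 h1) (lexx _).
apply: le_trans K.
apply: lerD.
  rewrite ler_wpM2l //; apply: le_trans (nrmB _ e0 _ _) _.
  by apply: lerD; [exact: nrm_dtail|exact: nrm_truncJ].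
rewrite ler_wpM2l ?(ltW theta_gt0) // ler_wpM2l //.
apply: le_trans (nrmD _ e0 _ _) _; apply: lerD; last first.
  rewrite nrmZ ger0_norm // ler_wpM2l //.
  by apply: (nrm_truncM e0 eps0 epsN Ca0 ga0 gr); exact: T22.1.
apply: le_trans (nrmD _ e0 _ _) _; apply: lerD; last first.
  by apply: (nrm_truncM e0 eps0 epsN Ca0 ga0 gr); exact: T21.1.
apply: le_trans (nrmB _ e0 _ _) _; apply: lerD.
  by rewrite nrmZ ger0_norm ?mulr_ge0 ?(ltW beta0) // ler_wpM2l ?mulr_ge0 ?(ltW beta0) //; exact: nrm_deriv.
apply: le_trans (nrm_deriv e0 (sm_deriv h2)) _.
by rewrite ler_wpM2l ?(ltW e0) //; exact: nrm_deriv.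
Qed.

(** The terms of the Neumann series; the first one is the constant profile. *)
Definition layer_iter i := iter i layer_step (1, 0).

Lemma sm_layer_iter i : sm2 (layer_iter i).
Proof.
elim: i => [|i IH]; last exact: sm_layer_step.
by split; rewrite /sm ?size_poly0 // size_poly1.
Qed.
Lemma pair_nrm_iter i : pair_nrm (layer_iter i) <= (1 / 2) ^+ i.
Proof.
have e0 := eta_gt0.
elim: i => [|i IH].
  rewrite /pair_nrm /= nrm1 // /nrm big1 ?mulr0 ?addr0 // => k _.
  by rewrite coef0 normr0 mul0r.
rewrite exprS; apply: le_trans (pair_nrm_step (sm_layer_iter i)) _.
by rewrite ler_wpM2l // divr_ge0.
Qed.
Lemma layer_iter_le i : nrm (layer_iter i).1 <= (1 / 2) ^+ i /\ nrm (layer_iter i).2 <= theta^-1 * (1 / 2) ^+ i.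
Proof.
have e0 := eta_gt0; have th0 := theta_gt0; have := pair_nrm_iter i; rewrite /pair_nrm.
have := nrm_ge0 N e0 (layer_iter i).1; have := nrm_ge0 N e0 (layer_iter i).2 => h2 h1 h.
have h3 : 0 <= theta * nrm (layer_iter i).2 by rewrite mulr_ge0 // ltW.
split; first by lra.
by rewrite mulrC ler_pdivlMr // mulrC; lra.
Qed.

(** The layer equations applied to y, without their leading terms. *)
Definition layer_op1 y s := - y.1^`()^`().[s] + b11' (eps * s) * y.1.[s] + tau * b12 (eps * s) * y.2.[s].
Definition layer_op2 y s := 2 * beta * y.2^`().[s] - y.2^`()^`().[s] + b21 (eps * s) * y.1.[s] + tau * b22 (eps * s) * y.2.[s].
Notation trunc_err := (trunc_err N eta).

(** The step solves its equation up to truncation errors only. *)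
Lemma layer_step1_residual y s : sm2 y -> 0 <= s -> eps * s <= rho ->
  `|2 * beta * (layer_step1 y)^`().[s] + layer_op1 y s| <= 5 * Ca * (nrm y.1 + nrm y.2) * trunc_err s.
Proof.
move=> h s0 sr; have [h1 h2] := h; have e0 := eta_gt0.
have s1 : eps * s <= 1 by apply: le_trans rho1.
have x0 : 0 <= eps * s by rewrite mulr_ge0 // ltW.
have -> : 2 * beta * (layer_step1 y)^`().[s] + layer_op1 y s =
   (layer_coupling y)`_N * s ^+ N - ((truncM t11' y.1).[s] - b11' (eps * s) * y.1.[s])
     - tau * ((truncM t12 y.2).[s] - b12 (eps * s) * y.2.[s]).
  rewrite /layer_step1 derivZ hornerZ mulrA mulfV ?mul1r ?mulf_neq0 ?gt_eqF //.
  rewrite !derivB derivC subr0 hornerD hornerN (horner_deriv_truncJ _ (sm_layer_coupling h)) /layer_op1.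
  by rewrite {1}/layer_coupling hornerD hornerZ; ring.
have n1 := nrm_ge0 N e0 y.1; have n2 := nrm_ge0 N e0 y.2; have E0 := trunc_err_ge0 N eta s.
have k1 : `|(layer_coupling y)`_N * s ^+ N| <= 2 * Ca * (nrm y.1 + nrm y.2) * trunc_err s.
  rewrite normrM (ger0_norm (exprn_ge0 _ s0)).
  apply: le_trans (top_coef_le N e0 (layer_coupling y) s0) _; rewrite -/(trunc_err s) ler_wpM2r //.
  apply: le_trans (nrm_layer_coupling h) _; rewrite mulrDr; apply: lerD.
    rewrite ler_wpM2r // -[X in _ <= X]mulr1 ler_wpM2l ?mulr_ge0 ?(ltW Ca0) //; apply: le_trans gr _; lra.
  by rewrite ler_piMl // ?mulr_ge0 ?(ltW Ca0).
have k2 : `|(truncM t11' y.1).[s] - b11' (eps * s) * y.1.[s]| <= 3 * Ca * (nrm y.1 * trunc_err s).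
  by apply: (horner_truncM e0 eps0 epsN Ca0 ga0 gr t11'_bd _ h1 s0 sr s1) => x; exact: b11'_taylor.
have k3 : `|tau * ((truncM t12 y.2).[s] - b12 (eps * s) * y.2.[s])| <= 3 * Ca * (nrm y.2 * trunc_err s).
  rewrite normrM (ger0_norm tau0); apply: le_trans (ler_piMl _ _) _ => //.
  by apply: (horner_truncM e0 eps0 epsN Ca0 ga0 gr T12.1 (T12.2 N.+1) h2 s0 sr s1).
apply: le_trans (ler_normB _ _) _.
apply: le_trans (lerD (ler_normB _ _) (lexx _)) _.
lra.
Qed.

Lemma layer_step2_residual y s : sm2 y -> 0 <= s -> eps * s <= rho ->
  `|layer_op2 y s - beta ^+ 2 * (layer_step2 y).[s]| <= 5 * Ca * (nrm y.1 + nrm y.2) * trunc_err s.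
Proof.
move=> h s0 sr; have [h1 h2] := h; have e0 := eta_gt0.
have s1 : eps * s <= 1 by apply: le_trans rho1.
have -> : layer_op2 y s - beta ^+ 2 * (layer_step2 y).[s] =
   - ((truncM t21 y.1).[s] - b21 (eps * s) * y.1.[s])
     - tau * ((truncM t22 y.2).[s] - b22 (eps * s) * y.2.[s]).
  rewrite /layer_step2 hornerZ mulrA mulfV ?mul1r ?expf_neq0 ?gt_eqF //.
  by rewrite !(hornerD, hornerN, hornerZ) /layer_op2; ring.
have n1 := nrm_ge0 N e0 y.1; have n2 := nrm_ge0 N e0 y.2; have E0 := trunc_err_ge0 N eta s.
have k2 : `|(truncM t21 y.1).[s] - b21 (eps * s) * y.1.[s]| <= 3 * Ca * (nrm y.1 * trunc_err s).
  by apply: (horner_truncM e0 eps0 epsN Ca0 ga0 gr T21.1 (T21.2 N.+1) h1 s0 sr s1).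
have k3 : `|tau * ((truncM t22 y.2).[s] - b22 (eps * s) * y.2.[s])| <= 3 * Ca * (nrm y.2 * trunc_err s).
  rewrite normrM (ger0_norm tau0); apply: le_trans (ler_piMl _ _) _ => //.
  by apply: (horner_truncM e0 eps0 epsN Ca0 ga0 gr T22.1 (T22.2 N.+1) h2 s0 sr s1).
apply: le_trans (ler_normB _ _) _; rewrite normrN.
have q1 : 0 <= 2 * Ca * (nrm y.1 * trunc_err s) by rewrite !mulr_ge0 // ltW.
have q2 : 0 <= 2 * Ca * (nrm y.2 * trunc_err s) by rewrite !mulr_ge0 // ltW.
lra.
Qed.

Definition C4 : R := 2 * beta * eta + eta ^+ 2 + 3 * Ca.

Lemma C4_ge0 : 0 <= C4.
Proof. by have := eta_gt0; rewrite /C4 => /ltW e0; rewrite !addr_ge0 ?mulr_ge0 ?exprn_ge0 ?(ltW beta0) ?(ltW Ca0). Qed.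

(** Crude bounds without any cancellation. They serve for the last term of the
    Neumann series, and away from the endpoint, where e^(- beta s) is already
    exponentially small. *)
Lemma layer_residual_tail y s : sm2 y -> 0 <= s -> eps * s <= 1 ->
  [/\ `|layer_op1 y s| <= C4 * (nrm y.1 + nrm y.2) * expR (eta * s),
      `|layer_op2 y s| <= C4 * (nrm y.1 + nrm y.2) * expR (eta * s),
      `|2 * beta * y.1^`().[s] + layer_op1 y s| <= C4 * (nrm y.1 + nrm y.2) * expR (eta * s) &
      `|layer_op2 y s - beta ^+ 2 * y.2.[s]| <= C4 * (nrm y.1 + nrm y.2) * expR (eta * s)].
Proof.
move=> [h1 h2] s0 s1; have e0 := eta_gt0.
have x01 : 0 <= eps * s <= 1 by rewrite s1 mulr_ge0 // ltW.
set X := expR (eta * s).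
have X0 : 0 <= X by exact: expR_ge0.
have n1 := nrm_ge0 N e0 y.1; have n2 := nrm_ge0 N e0 y.2.
set g := nrm y.1 in n1 *; set k := nrm y.2 in n2 *.
have g0 : `|y.1.[s]| <= g * X by exact: horner_le_nrm.
have k0 : `|y.2.[s]| <= k * X by exact: horner_le_nrm.
have g1 : `|y.1^`().[s]| <= eta * g * X.
  by apply: le_trans (horner_le_nrm e0 (sm_deriv h1) s0) _; rewrite ler_wpM2r //; exact: nrm_deriv.
have k1 : `|y.2^`().[s]| <= eta * k * X.
  by apply: le_trans (horner_le_nrm e0 (sm_deriv h2) s0) _; rewrite ler_wpM2r //; exact: nrm_deriv.
have dd p : sm p -> `|p^`()^`().[s]| <= eta ^+ 2 * nrm p * X.
  move=> hp; apply: le_trans (horner_le_nrm e0 (sm_deriv (sm_deriv hp)) s0) _; rewrite ler_wpM2r //.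
  apply: le_trans (nrm_deriv e0 (sm_deriv hp)) _; rewrite expr2 -mulrA ler_wpM2l ?(ltW e0) //.
  exact: nrm_deriv.
have g2 := dd _ h1; have k2 := dd _ h2.
have c11 : `|b11' (eps * s) * y.1.[s]| <= 2 * Ca * g * X.
  by rewrite normrM -mulrA; apply: ler_pM => //; exact: b11'_bd.
have cc b t p c : taylor_bounded b t -> `|p.[s]| <= c * X -> `|b (eps * s) * p.[s]| <= Ca * c * X.
  by move=> hb hp; rewrite normrM -mulrA; apply: ler_pM => //; exact: (taylor_bd hb).
have tt (z B : R) : `|z| <= B -> `|tau * z| <= B.
  by move=> hz; rewrite normrM (ger0_norm tau0); apply: le_trans hz; rewrite ler_piMl.
have c12 := tt _ _ (cc _ _ _ _ T12 k0); have c21 := cc _ _ _ _ T21 g0.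
have c22 := tt _ _ (cc _ _ _ _ T22 k0).
have bg : `|2 * beta * y.1^`().[s]| <= 2 * beta * eta * g * X.
  rewrite normrM (ger0_norm (_ : 0 <= 2 * beta)) ?mulr_ge0 ?(ltW beta0) //.
  by rewrite -!mulrA ler_wpM2l // ler_wpM2l ?(ltW beta0) // mulrA.
have bk : `|2 * beta * y.2^`().[s]| <= 2 * beta * eta * k * X.
  rewrite normrM (ger0_norm (_ : 0 <= 2 * beta)) ?mulr_ge0 ?(ltW beta0) //.
  by rewrite -!mulrA ler_wpM2l // ler_wpM2l ?(ltW beta0) // mulrA.
have b2k : `|beta ^+ 2 * y.2.[s]| <= Ca * k * X.
  rewrite normrM -mulrA; apply: ler_pM => //.
  by rewrite ger0_norm ?exprn_ge0 ?(ltW beta0) //; exact: beta2_le.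
have p1 : 0 <= g * X by rewrite mulr_ge0.
have p2 : 0 <= k * X by rewrite mulr_ge0.
have p3 : 0 <= Ca * g * X by pos.
have p4 : 0 <= Ca * k * X by pos.
have p5 : 0 <= eta ^+ 2 * g * X by pos.
have p6 : 0 <= eta ^+ 2 * k * X by pos.
have p7 : 0 <= 2 * beta * eta * g * X by pos.
have p8 : 0 <= 2 * beta * eta * k * X by pos.
have eC : C4 * (g + k) * X = 2 * beta * eta * g * X + 2 * beta * eta * k * X
   + eta ^+ 2 * g * X + eta ^+ 2 * k * X + 3 * (Ca * g * X) + 3 * (Ca * k * X).
  by rewrite /C4; ring.
rewrite /layer_op1 /layer_op2 -!(mulrA tau).
have tri3 (a b c : R) : `|a + b + c| <= `|a| + `|b| + `|c|.
  by apply: le_trans (ler_normD _ _) _; rewrite lerD2r ler_normD.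
rewrite -/g in g2; rewrite -/k in k2.
split.
- by apply: le_trans (tri3 _ _ _) _; rewrite normrN eC; lra.
- apply: le_trans (tri3 _ _ _) _; rewrite eC.
  by apply: le_trans (lerD (lerD (ler_normB _ _) (lexx _)) (lexx _)) _; lra.
- apply: le_trans (ler_normD _ _) _; apply: le_trans (lerD (lexx _) (tri3 _ _ _)) _; rewrite normrN eC; lra.
- apply: le_trans (ler_normB _ _) _; apply: le_trans (lerD (tri3 _ _ _) (lexx _)) _; rewrite eC.
  by apply: le_trans (lerD (lerD (lerD (ler_normB _ _) (lexx _)) (lexx _)) (lexx _)) _; lra.
Qed.

(** The profiles G and H, partial sums of the Neumann series. *)
Definition profile1 : {poly R} := \sum_(i < N.+1) (layer_iter i).1.
Definition profile2 : {poly R} := \sum_(i < N.+1) (layer_iter i).2.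

Lemma sm_profiles : sm2 (profile1, profile2).
Proof.
split => /=; first by apply: (@sm_sum _ _ _ (fun i => (layer_iter i).1)) => i; have [] := sm_layer_iter i.
by apply: (@sm_sum _ _ _ (fun i => (layer_iter i).2)) => i; have [] := sm_layer_iter i.
Qed.

Lemma nrm_profile1 : nrm profile1 <= 2.
Proof.
have e0 := eta_gt0.
apply: le_trans (nrm_sum _ e0 _ (fun i => (layer_iter i).1)) _.
apply: le_trans (geometric_half_le2 N.+1 _ (lexx (1 / 2))); last by rewrite divr_ge0.
by apply: ler_sum => i _; have [] := layer_iter_le i.
Qed.
Lemma nrm_profile2 : nrm profile2 <= 2 / theta.
Proof.
have e0 := eta_gt0; have th0 := theta_gt0.
apply: le_trans (nrm_sum _ e0 _ (fun i => (layer_iter i).2)) _.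
rewrite mulrC; apply: (@le_trans _ _ (theta^-1 * \sum_(i < N.+1) (1 / 2) ^+ i)).
  by rewrite mulr_sumr; apply: ler_sum => i _; have [] := layer_iter_le i.
by rewrite ler_wpM2l ?invr_ge0 ?(ltW th0) //; apply: geometric_half_le2 => //; rewrite divr_ge0.
Qed.

(** Every step vanishes at 0, so only the initial profile contributes. *)
Lemma profile1_at0 : profile1.[0] = 1.
Proof.
rewrite /profile1 big_ord_recl /= hornerD hornerC horner_sum big1 ?addr0 // => i _.
rewrite /layer_step1 hornerZ !(hornerD, hornerN) hornerC horner0_truncJ horner_coef0 subrr subr0 mulr0 //.
Qed.

Lemma sum_shift_first m (a c : nat -> R) : a 0%N = 0 ->
  \sum_(i < m.+1) (a i + c i) = \sum_(i < m) (a i.+1 + c i) + c m.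
Proof.
move=> a0; rewrite !big_split /= big_ord_recl a0 add0r [X in _ + X]big_ord_recr /= addrA.
by congr (_ + _ + _); apply: eq_bigr => i _.
Qed.

Lemma profile_additive (F : {poly R} * {poly R} -> R) :
  (forall y z, F (y.1 + z.1, y.2 + z.2) = F y + F z) -> F (0, 0) = 0 ->
  F (profile1, profile2) = \sum_(i < N.+1) F (layer_iter i).
Proof.
move=> hF F0; rewrite /profile1 /profile2; elim: (N.+1) => [|m IH]; first by rewrite !big_ord0.
by rewrite !big_ord_recr /= -IH -hF.
Qed.

Definition C5 : R := (10 * Ca + C4) * (1 + theta^-1).

(** The residual telescopes: the leading term of one iterate cancels the
    remaining terms of the previous one, up to truncation errors and the last
    iterate, which is of order 2^-N. *)
Lemma layer_residual s : 0 <= s -> eps * s <= rho ->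
  `|2 * beta * profile1^`().[s] + layer_op1 (profile1, profile2) s| <= C5 * trunc_err s /\
  `|layer_op2 (profile1, profile2) s - beta ^+ 2 * profile2.[s]| <= C5 * trunc_err s.
Proof.
move=> s0 sr; have e0 := eta_gt0; have th0 := theta_gt0.
have s1 : eps * s <= 1 by apply: le_trans rho1.
have E0 := trunc_err_ge0 N eta s.
have th1 : 0 <= 1 + theta^-1 by rewrite addr_ge0 ?invr_ge0 // ltW.
have hb i : nrm (layer_iter i).1 + nrm (layer_iter i).2 <= (1 + theta^-1) * (1 / 2) ^+ i.
  by have [h1 h2] := layer_iter_le i; rewrite mulrDl mul1r lerD.
have last_ (z : R) : `|z| <= C4 * (nrm (layer_iter N).1 + nrm (layer_iter N).2) * expR (eta * s) ->
    `|z| <= C4 * (1 + theta^-1) * trunc_err s.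
  move=> hz; apply: le_trans hz _.
  have -> : C4 * (1 + theta^-1) * trunc_err s = C4 * ((1 + theta^-1) * (1 / 2) ^+ N * expR (2 * (eta * s))).
    by rewrite /trunc_err; ring.
  rewrite -[X in X <= _]mulrA; apply: ler_wpM2l; first exact: C4_ge0.
  have ets : 0 <= eta * s by rewrite mulr_ge0 // ltW.
  apply: ler_pM; [by rewrite addr_ge0 ?nrm_ge0|exact: expR_ge0|exact: hb|].
  by rewrite ler_expR; lra.
have sum_ (F : nat -> R) : (forall i, `|F i| <= 5 * Ca * (nrm (layer_iter i).1 + nrm (layer_iter i).2) * trunc_err s) ->
    `|\sum_(i < N) F i| <= 10 * Ca * (1 + theta^-1) * trunc_err s.
  move=> hF; apply: le_trans (ler_norm_sum _ _ _) _.
  apply: (@le_trans _ _ (\sum_(i < N) 5 * Ca * (1 + theta^-1) * trunc_err s * (1 / 2) ^+ i)).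
    apply: ler_sum => i _; apply: le_trans (hF i) _.
    have -> : 5 * Ca * (1 + theta^-1) * trunc_err s * (1 / 2) ^+ i = 5 * Ca * ((1 + theta^-1) * (1 / 2) ^+ i) * trunc_err s by ring.
    by rewrite ler_wpM2r // ler_wpM2l // mulr_ge0 // ltW.
  rewrite -mulr_sumr.
  have -> : 10 * Ca * (1 + theta^-1) * trunc_err s = 5 * Ca * (1 + theta^-1) * trunc_err s * 2 by ring.
  rewrite ler_wpM2l //; first by rewrite !mulr_ge0 // ltW.
  by apply: geometric_half_le2 => //; rewrite divr_ge0.
have e5 : C5 * trunc_err s = 10 * Ca * (1 + theta^-1) * trunc_err s + C4 * (1 + theta^-1) * trunc_err s by rewrite /C5; ring.
rewrite e5.
have [q1 q2 _ _] := layer_residual_tail (sm_layer_iter N) s0 s1.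
split.
  have -> : 2 * beta * profile1^`().[s] + layer_op1 (profile1, profile2) s =
     \sum_(i < N) (2 * beta * (layer_iter i.+1).1^`().[s] + layer_op1 (layer_iter i) s) + layer_op1 (layer_iter N) s.
    have := @profile_additive (fun y => 2 * beta * y.1^`().[s] + layer_op1 y s); move=> /(_ _ _)/= ->.
    - by rewrite (@sum_shift_first _ (fun i => 2 * beta * (layer_iter i).1^`().[s]) (fun i => layer_op1 (layer_iter i) s)) //= derivC horner0 mulr0.
    - by move=> y z; rewrite /layer_op1 /= !derivD !hornerD; ring.
    - by rewrite /layer_op1 /= !linear0 !horner0 !mulr0 oppr0 !addr0.
  apply: le_trans (ler_normD _ _) _; apply: lerD; last exact: last_.
  by apply: (sum_ (fun i => 2 * beta * (layer_iter i.+1).1^`().[s] + layer_op1 (layer_iter i) s)) => i; exact: layer_step1_residual (sm_layer_iter i) s0 sr.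
have -> : layer_op2 (profile1, profile2) s - beta ^+ 2 * profile2.[s] =
     \sum_(i < N) (layer_op2 (layer_iter i) s - beta ^+ 2 * (layer_iter i.+1).2.[s]) + layer_op2 (layer_iter N) s.
  have := @profile_additive (fun y => layer_op2 y s - beta ^+ 2 * y.2.[s]); move=> /(_ _ _)/= ->.
  - under eq_bigr do rewrite addrC.
    rewrite (@sum_shift_first _ (fun i => - (beta ^+ 2 * (layer_iter i).2.[s])) (fun i => layer_op2 (layer_iter i) s)); last by rewrite /= horner0 mulr0 oppr0.
    by congr (_ + _); apply: eq_bigr => i _; rewrite addrC.
  - by move=> y z; rewrite /layer_op2 /= !derivD !hornerD; ring.
  - by rewrite /layer_op2 /= !linear0 !horner0 !mulr0 !subr0 !addr0.
apply: le_trans (ler_normD _ _) _; apply: lerD; last exact: last_.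
by apply: (sum_ (fun i => layer_op2 (layer_iter i) s - beta ^+ 2 * (layer_iter i.+1).2.[s])) => i; exact: layer_step2_residual (sm_layer_iter i) s0 sr.
Qed.

End fix_eps.
Lemma degree_ex (X : R) : 0 <= X -> exists N : nat, N%:R <= X /\ X - 1 <= N%:R.
Proof.
move=> X0; exists (Num.truncn X); have /andP[h1 h2] := truncn_itv X0.
by split=> //; move: h2; rewrite -natr1; lra.
Qed.

(** rho is the size of x up to which the Taylor series are used. *)
Lemma radius_ex (eta : R) : 0 < eta -> exists rho : R, [/\ 0 < rho, rho <= 1, ga * rho <= 1 / 4 &
  2 * Ca * (ga * rho) <= beta * eta / 2].
Proof.
move=> e0.
pose m := Num.min (1 / 4) (beta * eta / 2 / (2 * Ca)).
have m0 : 0 < m.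
  by rewrite lt_min divr_gt0 // !divr_gt0 // ?mulr_gt0.
have m1 : m <= 1 / 4 by rewrite ge_min lexx.
have m2 : m <= beta * eta / 2 / (2 * Ca) by rewrite ge_min lexx orbT.
exists (Num.min 1 (m / ga)).
have k1 : ga * Num.min 1 (m / ga) <= m.
  by rewrite -ler_pdivlMl // mulrC ge_min lexx orbT.
split.
- by rewrite lt_min ltr01 divr_gt0.
- by rewrite ge_min lexx.
- exact: le_trans k1 m1.
- have C2 : 0 < 2 * Ca by rewrite mulr_gt0.
  by rewrite -ler_pdivlMl // [_^-1 * _]mulrC; apply: le_trans k1 m2.
Qed.

(** The degree N is the integer part of eta rho / eps. For x <= rho the
    residual is of order 2^-N; for x >= rho the profile itself is
    exponentially small. *)
Theorem layer_approx : exists q CL gL b : R, [/\ 0 < q, 0 < CL, 0 < gL & 0 < b] /\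
  forall eps tau : R, 0 < eps -> 0 <= tau -> tau <= q ->
  exists p1 p2 : {poly R}, [/\ exp_profile beta eps p1 0 = 1,
    forall n x, 0 <= x ->
      `|derive1n n (exp_profile beta eps p1) x| <= CL * (gL / eps) ^+ n * expR (- (beta / 2 * (x / eps))) /\
      `|derive1n n (exp_profile beta eps p2) x| <= CL * (gL / eps) ^+ n * expR (- (beta / 2 * (x / eps))) &
    forall x, 0 <= x <= 1 ->
      `|- eps ^+ 2 * derive1n 2 (exp_profile beta eps p1) x + b11 x * exp_profile beta eps p1 x + tau * b12 x * exp_profile beta eps p2 x|
        <= CL * expR (- (b / eps)) /\
      `|- eps ^+ 2 * derive1n 2 (exp_profile beta eps p2) x + b21 x * exp_profile beta eps p1 x + tau * b22 x * exp_profile beta eps p2 x|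
        <= CL * expR (- (b / eps))].
Proof.
pose eta := beta / 16; pose theta := beta ^+ 2 / (16 * Ca).
have e0 : 0 < eta by rewrite divr_gt0.
have th0 : 0 < theta by rewrite divr_gt0 ?exprn_gt0 ?mulr_gt0.
have [rho [rho0 rho1 gr gr2]] := radius_ex e0.
pose Z := Ca / (beta * eta) + 2 * Ca * theta / beta ^+ 2.
have Z0 : 0 < Z.
  apply: addr_gt0; apply: divr_gt0; rewrite ?exprn_gt0 //; first by rewrite mulr_gt0.
  by rewrite mulr_gt0 // mulr_gt0.
pose q := Num.min 1 (theta / 4 / Z).
have C40 : 0 <= C4 eta by apply: C4_ge0.
have C50 : 0 <= C5 eta theta.
  by rewrite /C5; have := ltW th0; have := ltW Ca0 => *; pos.
pose CL := 2 + 2 / theta + 2 * C5 eta theta + C4 eta * (2 + 2 / theta).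
have t20 : 0 <= 2 / theta by rewrite divr_ge0 // ltW.
have C4t : 0 <= C4 eta * (2 + 2 / theta) by rewrite mulr_ge0 // addr_ge0.
have CL0 : 0 < CL by rewrite /CL; lra.
exists q, CL, (2 * beta), (eta * rho / 2); split.
  split=> //; first by rewrite lt_min ltr01 /= divr_gt0 // divr_gt0.
    by rewrite mulr_gt0.
  by rewrite divr_gt0 // mulr_gt0.
move=> eps tau eps0 tau0 tauq.
have tau1 : tau <= 1 by apply: le_trans tauq _; rewrite ge_min lexx.
have tau2 : tau * Z <= theta / 4.
  by rewrite -ler_pdivlMr //; apply: le_trans tauq _; rewrite ge_min lexx orbT.
have [N [N1 N2]] : exists N : nat, N%:R <= eta * rho / eps /\ eta * rho / eps - 1 <= N%:R.
  by apply: degree_ex; rewrite divr_ge0 ?mulr_ge0 // ltW.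
have epsN : eps * N%:R / eta <= rho.
  rewrite ler_pdivrMr // mulrC -ler_pdivlMr // [rho * eta]mulrC //.
have hp := half_pow_le_exp N2.
pose G := profile1 eps tau N; pose H := profile2 eps tau N.
have [sG sH] : sm2 N (G, H) by apply: sm_profiles.
have nG : nrm N eta G <= 2 by apply: (@nrm_profile1 eta rho theta).
have nH : nrm N eta H <= 2 / theta by apply: (@nrm_profile2 eta rho theta).
exists G, H; split.
- by rewrite /exp_profile mulr0 expR0 mul1r mul0r; apply: profile1_at0.
- move=> n x x0.
  have key p : sm N p -> nrm N eta p <= CL ->
     `|derive1n n (exp_profile beta eps p) x| <= CL * (2 * beta / eps) ^+ n * expR (- (beta / 2 * (x / eps))).
    move=> sp np; apply: le_trans (derive1n_exp_profile_le e0 beta0 eps0 n sp x0) _.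
    have be0 : 0 <= (beta + eta) / eps by rewrite divr_ge0 ?addr_ge0 // ltW.
    apply: ler_pM; [by rewrite mulr_ge0 ?nrm_ge0 ?exprn_ge0|exact: expR_ge0| |].
      apply: ler_pM; [exact: nrm_ge0|exact: exprn_ge0|by []|].
      apply: lerXn2r; rewrite ?nnegrE //; first by rewrite divr_ge0 ?mulr_ge0 // ltW.
      by rewrite ler_pM2r ?invr_gt0 // /eta; have := ltW beta0; move: beta => z; lra.
    rewrite ler_expR lerN2; apply: ler_wpM2r; first by rewrite divr_ge0 // ltW.
    by rewrite /eta; have := ltW beta0; move: beta => z; lra.
  split; apply: key => //.
    by apply: le_trans nG _; rewrite /CL; lra.
  by apply: le_trans nH _; rewrite /CL; lra.
- move=> x /andP[x0 x1].
  pose s := x / eps.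
  have s0 : 0 <= s by rewrite divr_ge0 // ltW.
  have es : eps * s = x by rewrite /s; field; rewrite gt_eqF.
  have -> : - eps ^+ 2 * derive1n 2 (exp_profile beta eps G) x + b11 x * exp_profile beta eps G x + tau * b12 x * exp_profile beta eps H x =
    expR (- (beta / eps) * x) * (2 * beta * G^`().[s] + layer_op1 eps tau (G, H) s).
    by rewrite derive2_exp_profile // /exp_profile /layer_op1 /= es /b11' -/s; ring.
  have -> : - eps ^+ 2 * derive1n 2 (exp_profile beta eps H) x + b21 x * exp_profile beta eps G x + tau * b22 x * exp_profile beta eps H x =
    expR (- (beta / eps) * x) * (layer_op2 eps tau (G, H) s - beta ^+ 2 * H.[s]).
    by rewrite derive2_exp_profile // /exp_profile /layer_op2 /= es -/s; ring.
  have ex : expR (- (beta / eps) * x) = expR (- (beta * s)) by congr expR; rewrite /s; ring.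
  rewrite !normrM (ger0_norm (expR_ge0 _)) ex.
  have bs : 0 <= beta * s by rewrite mulr_ge0 // ltW.
  have [xr|/ltW xr] := leP x rho.
    have key (z : R) : `|z| <= C5 eta theta * trunc_err N eta s -> expR (- (beta * s)) * `|z| <= CL * expR (- (eta * rho / 2 / eps)).
      move=> hz; apply: (@le_trans _ _ (expR (- (beta * s)) * (C5 eta theta * trunc_err N eta s))).
        by rewrite ler_wpM2l ?expR_ge0.
      rewrite /trunc_err.
      have -> : expR (- (beta * s)) * (C5 eta theta * ((1 / 2) ^+ N * expR (2 * (eta * s)))) =
        C5 eta theta * (1 / 2) ^+ N * expR (- (beta * s) + 2 * (eta * s)) by rewrite expRD; ring.
      apply: (@le_trans _ _ (C5 eta theta * (1 / 2) ^+ N * 1)).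
        have hN : 0 <= (1 / 2 : R) ^+ N by rewrite exprn_ge0 // divr_ge0.
        apply: (ler_wpM2l (mulr_ge0 C50 hN)).
        rewrite -[X in _ <= X]expR0 ler_expR.
        have -> : - (beta * s) + 2 * (eta * s) = - (7 / 8 * (beta * s)) by rewrite /eta; field.
        by rewrite oppr_le0 mulr_ge0 ?divr_ge0.
      rewrite mulr1; apply: (@le_trans _ _ (C5 eta theta * (2 * expR (- (eta * rho / eps / 2))))).
        by rewrite ler_wpM2l.
      have -> : eta * rho / eps / 2 = eta * rho / 2 / eps by rewrite mulrAC.
      rewrite mulrA ler_wpM2r ?expR_ge0 // /CL; lra.
    have [f1 f2] : `|2 * beta * G^`().[s] + layer_op1 eps tau (G, H) s| <= C5 eta theta * trunc_err N eta s /\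
      `|layer_op2 eps tau (G, H) s - beta ^+ 2 * H.[s]| <= C5 eta theta * trunc_err N eta s.
      by apply: (@layer_residual eta rho theta) => //; rewrite es.
    by split; apply: key.
  have key (z : R) : `|z| <= C4 eta * (nrm N eta G + nrm N eta H) * expR (eta * s) ->
     expR (- (beta * s)) * `|z| <= CL * expR (- (eta * rho / 2 / eps)).
    move=> hz; apply: (@le_trans _ _ (expR (- (beta * s)) * (C4 eta * (2 + 2 / theta) * expR (eta * s)))).
      rewrite ler_wpM2l ?expR_ge0 //; apply: le_trans hz _; rewrite ler_wpM2r ?expR_ge0 //.
      by rewrite ler_wpM2l // lerD.
    rewrite mulrCA -expRD; apply: ler_pM; rewrite ?expR_ge0 //; first by rewrite /CL; lra.
    rewrite ler_expR.
    have -> : - (beta * s) + eta * s = - (15 * (eta * s)) by rewrite /eta; field.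
    rewrite lerN2.
    have h1 : eta * (rho / eps) <= eta * s by rewrite ler_wpM2l ?(ltW e0) // /s ler_pM2r ?invr_gt0.
    have h2 : 0 <= eta * (rho / eps) by rewrite mulr_ge0 ?divr_ge0 // ltW.
    have -> : eta * rho / 2 / eps = (eta * (rho / eps)) / 2 by rewrite mulrAC mulrA.
    lra.
  have [_ _ f1 f2] := @layer_residual_tail eta eps tau N erefl eps0 tau0 tau1 (G, H) s (conj sG sH) s0 (ltac:(by rewrite es)).
  by split; apply: key.
Qed.

End Layer.

(** * Taylor coefficients and reflection *)

Section Taylor.
Context {R : realType}.
Implicit Types (f g : R -> R).

Lemma eq_on_closure f g : continuous f -> continuous g -> (forall x, I01 x -> f x = g x) ->
  forall x, cI01 x -> f x = g x.
Proof.
move=> cf cg h x hx; apply/eqP; rewrite -subr_eq0 -normr_le0.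
apply: (bd_closure (cB cf cg)) hx => y hy; by rewrite h // subrr normr0.
Qed.

(** The derivatives are extended continuously to 0 first; the remainder
    estimate is then proved for all of them simultaneously, integrating once
    per step. *)
Lemma taylor_of_analytic_bd f (Ca ga : R) : 0 < Ca -> 0 < ga -> continuous f -> analytic_bd Ca ga f ->
  exists t : nat -> R, taylor_bounded Ca ga f t /\ t 0%N = f 0.
Proof.
move=> Ca0 ga0 cf [sf bf].
have ext k : exists F : R -> R, continuous F /\ forall x, I01 x -> F x = derive1n k f x.
  have [F cF eF] := derive1n_extension sf (bf k.+1).
  by exists F.
have /choice[F hF] := ext.
have cF k : continuous (F k) by have [] := hF k.
have eF k x : I01 x -> F k x = derive1n k f x by have [_] := hF k; apply.
have dF k x : I01 x -> is_derive x 1 (F k) (F k.+1 x).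
  move=> hx; rewrite (eF k.+1 x hx); apply: dI (smooth_d k sf hx) => // y hy.
  by rewrite eF.
have bF k x : cI01 x -> `|F k x| <= Ca * ga ^+ k * k`!%:R.
  by apply: bd_closure => // y hy; rewrite eF //; exact: bf.
have F0 : forall x, cI01 x -> F 0%N x = f x := eq_on_closure (cF 0%N) cf (eF 0%N).
have h00 : cI01 (0 : R) by apply/cI01E; rewrite lexx ler01.
exists (fun i => F i 0 / i`!%:R); split; last by rewrite (_ : 0`! = 1%N) // divr1; exact: F0.
have fp i : (0 : R) < i`!%:R by rewrite ltr0n fact_gt0.
split=> [i|].
  rewrite normrM normfV normr_nat ler_pdivrMr //; exact: bF.
have key N : forall j x, cI01 x ->
   `|F j x - \sum_(i < N) F (j + i)%N 0 * (x ^+ i / i`!%:R)| <= Ca * ga ^+ (j + N) * (j + N)`!%:R * (x ^+ N / N`!%:R).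
  elim: N => [|N IH] j x hx.
    by rewrite big_ord0 subr0 expr0 fact0 divr1 mulr1 addn0; exact: bF.
  pose D t := F j t - (F j 0 + \sum_(i < N) F (j.+1 + i)%N 0 * (t ^+ i.+1 / i.+1`!%:R)).
  pose D' t := F j.+1 t - \sum_(i < N) F (j.+1 + i)%N 0 * (t ^+ i / i`!%:R).
  pose K := Ca * ga ^+ (j + N.+1) * (j + N.+1)`!%:R.
  have dS (t : R) : is_derive t 1 (fun t => F j 0 + \sum_(i < N) F (j.+1 + i)%N 0 * (t ^+ i.+1 / i.+1`!%:R))
      (\sum_(i < N) F (j.+1 + i)%N 0 * (t ^+ i / i`!%:R)).
    have h := dD (dcst (F j 0) t) (@dsum R N (fun i t => F (j.+1 + i)%N 0 * (t ^+ i.+1 / i.+1`!%:R))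
      (fun i => F (j.+1 + i)%N 0 * (t ^+ i / i`!%:R)) t (fun i _ => dZ (F (j.+1 + i)%N 0) (is_derive_taylor_term i t))).
    by apply: (is_derive_eq h); rewrite add0r.
  have dDt t : I01 t -> is_derive t 1 D (D' t) by move=> ht; exact: dB (dF j t ht) (dS t).
  have cD' : continuous D by apply: cB => // t; exact: dcont (dS t).
  have dK (t : R) : is_derive t 1 (fun t => K * (t ^+ N.+1 / N.+1`!%:R)) (K * (t ^+ N / N`!%:R)) := dZ K (is_derive_taylor_term N t).
  have cK : continuous (fun t : R => K * (t ^+ N.+1 / N.+1`!%:R)) by move=> t; exact: dcont (dK t).
  have D0 : D 0 = 0.
    rewrite /D big1 ?addr0 ?subrr // => i _; by rewrite expr0n /= mul0r mulr0.
  have := mean_value_ineq0 hx cD' cK dDt (fun t _ => dK t) _.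
  rewrite D0 subr0 expr0n /= mul0r mulr0 subr0 => /(_ _) hh.
  have -> : F j x - \sum_(i < N.+1) F (j + i)%N 0 * (x ^+ i / i`!%:R) = D x.
    rewrite /D big_ord_recl /= addn0 expr0 fact0 divr1 mulr1; congr (_ - (_ + _)).
    by apply: eq_bigr => i _; rewrite /bump /= add1n addSnnS.
  apply: hh => t ht; rewrite /K -addSnnS; apply: IH; exact: I01_cI01.
move=> N x /cI01E hx; have := key N 0%N x hx; rewrite !add0n F0 //.
have -> : Ca * ga ^+ N * N`!%:R * (x ^+ N / N`!%:R) = Ca * (ga * x) ^+ N.
  have := fp N; move: (N`!%:R : R) => z z0; rewrite exprMn; field; by rewrite gt_eqF.
by under eq_bigr do rewrite mulrA mulrAC.
Qed.

Lemma refl_I01 (x : R) : I01 x -> I01 (1 - x).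
Proof. by move=> /I01E /andP[h1 h2]; apply/I01E; apply/andP; split; lra. Qed.
Lemma refl_cI01 (x : R) : cI01 x -> cI01 (1 - x).
Proof. by move=> /cI01E /andP[h1 h2]; apply/cI01E; apply/andP; split; lra. Qed.

Lemma drefl f (x a : R) : is_derive (1 - x) 1 f a -> is_derive x 1 (fun t => f (1 - t)) (- a).
Proof.
move=> h; have h2 := dB (dcst 1 x) (did x).
by apply: (is_derive_eq (@dcomp _ f (fun t => 1 - t) x _ _ h h2)); rewrite sub0r mulrN1.
Qed.

Lemma cont_refl f : continuous f -> continuous (fun x : R => f (1 - x)).
Proof.
move=> cf x; apply: (@continuous_comp _ _ _ (fun x : R => 1 - x) f); last exact: cf.
by apply: cB; [exact: cC|exact: cX].
Qed.

Lemma smooth_refl f : smooth f -> smooth (fun x => f (1 - x)) /\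
  forall n x, I01 x -> derive1n n (fun x => f (1 - x)) x = (-1) ^+ n * derive1n n f (1 - x).
Proof.
move=> sf; apply: (@smooth_jet _ (fun n x => (-1) ^+ n * derive1n n f (1 - x))) => [x hx|n x hx].
  by rewrite mul1r.
have h := dZ ((-1) ^+ n) (drefl (smooth_d n sf (refl_I01 hx))).
by apply: (is_derive_eq h); rewrite exprS; ring.
Qed.

Lemma analytic_bd_refl f Ca ga : analytic_bd Ca ga f -> analytic_bd Ca ga (fun x => f (1 - x)).
Proof.
move=> [sf bf]; have [s e] := smooth_refl sf; split=> // n x hx.
rewrite e // normrM normrX normrN normr1 expr1n mul1r; apply: bf; exact: refl_I01.
Qed.

End Taylor.

(** * Essential suprema and pointwise bounds *)

Section Sup.
Context {R : realType}.
Implicit Types (f : R -> R).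
Notation mu := (@lebesgue_measure R).

Lemma muT_gt0 : (0 < mu [set: R])%E.
Proof.
apply: (@lt_le_trans _ _ (mu `[0, 1])).
  by rewrite lebesgue_measure_itv /= lte_fin ltr01 -EFinB lte_fin subr0.
by apply: le_measure; rewrite ?inE.
Qed.

Lemma LpI_oo_le f (B : R) : 0 <= B -> (forall x, I01 x -> `|f x| <= B) -> (LpI +oo f <= B%:E)%E.
Proof.
move=> B0 h; rewrite /LpI unlock /= muT_gt0.
apply/ess_supP; apply: aeW => x /=.
rewrite patchE; case: ifPn => [|_]; last by rewrite normr0 lee_fin.
by rewrite inE lee_fin => /h.
Qed.

(** A continuous function that exceeds B at a point of I does so on an
    interval, which has positive measure. *)
Lemma LpI_oo_ge f (B : R) : (forall x, I01 x -> {for x, continuous f}) -> (LpI +oo f <= B%:E)%E ->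
  forall x, I01 x -> `|f x| <= B.
Proof.
move=> cf; rewrite /LpI unlock /= muT_gt0 => /ess_supP h x hx.
rewrite leNgt; apply/negP => Bx.
have hc : `|f y| @[y --> x] --> `|f x| by apply: cvg_norm; exact: cf.
have /nbhs_ballP[e /= e0 he] : \forall y \near x, I01 y /\ B < `|f y|.
  near=> y; split; first by near: y; exact: near_I01.
  by near: y; exact: (cvgr_gt _ hc).
move: h => [N [mN N0 sub]].
have : (mu `](x - e)%R, (x + e)%R[%classic <= mu N)%E.
  apply: le_measure; rewrite ?inE //.
  move=> y /=; rewrite in_itv /= => /andP[y1 y2]; apply: sub => /=.
  have [Iy By] : I01 y /\ B < `|f y|.
    by apply: he; rewrite /ball /= ltr_norml; apply/andP; split; lra.
  rewrite patchE mem_set // lee_fin => hle; move: By; by rewrite ltNge hle.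
rewrite N0 lebesgue_measure_itv /= lte_fin; have -> : x - e < x + e by lra.
by rewrite -EFinB lee_fin; lra.
Unshelve. all: by end_near. Qed.

Lemma analyticI_pointwise f C g : analyticI C g f -> analytic_bd C g f.
Proof.
move=> [[_ sf] b]; have sf' : smooth f by move=> n x hx; exact: sf.
split=> // n x hx; apply: LpI_oo_ge (b n) x hx => y hy.
exact: dcont (smooth_d n sf' hy).
Qed.

End Sup.

(** * Classical regularity of the weak solution *)

Section Weak.
Context {R : realType}.
Implicit Types (f g u : R -> R).
Notation mu := (@lebesgue_measure R).

Lemma clamp_in (x : R) : cI01 (clamp x).
Proof.
apply/cI01E; rewrite /clamp le_max lexx /= ge_max ler01 /=.
by rewrite ge_min lexx.
Qed.

(** Reduces functions continuous on [0, 1] to functions continuous on R. *)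
Lemma clamp_comp f : {within cI01, continuous f} -> continuous (fun x : R => f (clamp x)).
Proof.
move=> /subspace_continuousP cf x.
have h := cf _ (clamp_in x).
apply: cvg_comp h => A /= hA.
have h1 : \forall y \near x, cI01 (clamp y) -> A (clamp y) := @clamp_cont R x _ hA.
by apply: filterS h1 => y; apply; exact: clamp_in.
Qed.

Lemma mI01 : measurable (@I01 R).
Proof. exact: measurable_itv. Qed.
Lemma mucI01 (x : R) : cI01 x -> mu `[0, x] = x%:E.
Proof.
move=> /cI01E /andP[x0 _]; rewrite lebesgue_measure_itv /= lte_fin.
case: ltgtP x0 => // [h _|<- _]; first by rewrite -EFinB subr0.
by [].
Qed.
Lemma muI01 : mu (@I01 R) = 1%E.
Proof. by rewrite /I01 lebesgue_measure_itv /= lte_fin ltr01 -EFinB subr0. Qed.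

Lemma bounded_integrable f B : measurable_fun (@I01 R) f -> (forall x, I01 x -> `|f x| <= B) ->
  mu.-integrable (@I01 R) (EFin \o f).
Proof.
move=> mf bf; apply: measurable_bounded_integrable => //; first exact: mI01.
  by move: (muI01) => e; apply: le_lt_trans (ltry 1%R); rewrite le_eqVlt; apply/orP; left; apply/eqP; exact: e.
exists B; split; first exact: num_real.
by move=> M BM x hx; apply: le_trans (bf x hx) (ltW BM).
Qed.

Lemma cont_integrable f : continuous f -> mu.-integrable (@I01 R) (EFin \o f).
Proof.
move=> cf; have [B _ hB] := cont_bounded cf.
apply: (@bounded_integrable f B) => [|x hx]; last by apply: hB; exact: I01_cI01.
by apply: subspace_continuous_measurable_fun; [exact: mI01|exact: contw].
Qed.

Lemma LpI2_sqr f : ((LpI 2%:E f) `^ 2 = \int[mu]_(x in I01) ((f x) ^+ 2)%:E)%E.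
Proof.
rewrite /LpI poweR_Lnorm // [RHS]integral_mkcond; apply: eq_integral => x _.
rewrite /= !patchE; case: ifP => _ /=; last by rewrite normr0 powR0.
by rewrite powR_mulrn // real_normK // num_real.
Qed.

Lemma LpI_ge0 p f : (0 <= LpI p f)%E.
Proof. exact: Lnorm_ge0. Qed.

(** |du| <= 1 + du^2 on an interval of finite length. *)
Lemma L2_integrable du : measurable_fun (@I01 R) du -> (LpI 2%:E du < +oo)%E ->
  mu.-integrable (@I01 R) (EFin \o du).
Proof.
move=> mdu ldu.
have fin : (\int[mu]_(x in I01) ((du x) ^+ 2)%:E < +oo)%E.
  rewrite -LpI2_sqr; have := LpI_ge0 2%:E du; move: ldu; case: (LpI 2%:E du) => [r| |] //= _ _.
  by rewrite ltry.
have i2 : mu.-integrable (@I01 R) (EFin \o (fun x => du x ^+ 2)).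
  apply/integrableP; split.
    by apply/measurable_EFinP; apply: measurable_funX.
  apply: le_lt_trans fin; rewrite le_eqVlt; apply/orP; left; apply/eqP.
  by apply: eq_integral => x _ /=; rewrite ger0_norm // sqr_ge0.
have i1 := cont_integrable (@cC R 1).
have i3 : mu.-integrable (@I01 R) ((EFin \o (fun=> 1%R)) \+ (EFin \o (fun x => (du x ^+ 2)%R)))%E.
  by apply: integrableD => //; exact: mI01.
apply: le_integrable i3; first exact: mI01.
  by apply/measurable_EFinP.
move=> x hx /=; rewrite lee_fin [X in _ <= X]ger0_norm; last by rewrite addr_ge0 // sqr_ge0.
rewrite -[du x ^+ 2]real_normK ?num_real //.
have := normr_ge0 (du x); set a := `|du x|; have := sqr_ge0 (a - 1); rewrite expr2; nra.
Qed.

Lemma integrable_cc f : mu.-integrable (@I01 R) (EFin \o f) -> mu.-integrable `[0, 1] (EFin \o f).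
Proof.
move=> /integrableP[mf fi]; have mf' : measurable_fun (`]0, 1[ : set R) f by apply/measurable_EFinP.
have mco : measurable_fun (`]0, 1] : set R) f by apply/measurable_fun_itv_bndo_bndcP.
have mcc : measurable_fun (`[0, 1] : set R) f by apply/measurable_fun_itv_obnd_cbndP.
apply/integrableP; split; first exact/measurable_EFinP.
have ma : measurable_fun (`]0, 1] : set R) (abse \o (EFin \o f)).
  by apply: measurableT_comp => //; exact/measurable_EFinP.
have ma' : measurable_fun (`]0, 1[ : set R) (abse \o (EFin \o f)).
  by apply: measurableT_comp => //; exact/measurable_EFinP.
rewrite -(integral_itv_obnd_cbnd ma).
by rewrite -(integral_itv_bndo_bndc ma').
Qed.

Lemma Rint_I f : mu.-integrable (@I01 R) (EFin \o f) ->
  \int[mu]_(x in I01) f x = \int[mu]_(x in `[0, 1]) f x.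
Proof.
move=> fi; rewrite /I01 Rintegral_itv_bndo_bndc // Rintegral_itv_obnd_cbnd //.
by apply: integrableS (integrable_cc fi) => //; apply: subset_itv; rewrite bnd_simp.
Qed.

Lemma Rintegral_primitive f : continuous f -> \int[mu]_(x in I01) f x = primitive f 1.
Proof.
move=> cf; rewrite /primitive clamp_id; last by apply/cI01E; rewrite lexx ler01.
rewrite Rintegral_itvB ?bnd_simp //.
- by rewrite /I01 Rintegral_itv_bndo_bndc //; exact: cont_integrable.
- by apply: continuous_compact_integrable; [exact: segment_compact|exact: contw].
Qed.

Section tent.
Variable x0 : R.
Hypothesis Ix0 : I01 x0.

Let A : set R := `[0, x0].
Definition dtent (t : R) : R := \1_A t - x0.

(** Green's function at x0 of - u'' with homogeneous boundary conditions;
    dtent is its weak derivative. *)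
Definition tent (t : R) : R := Num.min t x0 - x0 * t.

Lemma dtent_bd t : `|dtent t| <= 2.
Proof.
move/I01E: Ix0 => /andP[h0 h1]; rewrite /dtent indicE ler_norml.
by case: (t \in A) => /=; apply/andP; split; lra.
Qed.

Lemma tent_cont : continuous tent.
Proof.
apply: cB; last by apply: cZ; exact: cX.
apply: (@lipschitz_continuous _ _ 1) => x y; rewrite mul1r ler_norml.
have := ler_norm (x - y); have := ler_norm (y - x); rewrite [`|y - x|]distrC.
have := normr_ge0 (x - y); set n := `|_|.
by rewrite /Num.min; do !case: ifP; move=> *; apply/andP; split; lra.
Qed.

Lemma dtent_meas : measurable_fun (@I01 R) dtent.
Proof.
apply: measurable_funB; last exact: measurable_cst.
by apply: measurable_indic; exact: measurable_itv.
Qed.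

Lemma tent_prim t : cI01 t -> tent t = \int[mu]_(s in `[0, t]) dtent s.
Proof.
move=> ht; move/I01E: Ix0 => /andP[h0 h1]; have /cI01E/andP[t0 t1] := ht.
have i1 : mu.-integrable `[0, t] (EFin \o \1_A).
  apply: measurable_bounded_integrable => //.
  - by apply: le_lt_trans (ltry t); rewrite le_eqVlt; apply/orP; left; apply/eqP; exact: (mucI01 ht).
  - by apply: measurable_indic; exact: measurable_itv.
  - exists 1; split; first exact: num_real.
    move=> M M1 s _; rewrite /= indicE ger0_norm ?ler0n //.
    by apply: le_trans (ltW M1); case: (s \in A).
have i2 : mu.-integrable `[0, t] (EFin \o (fun=> x0)).
  by apply: continuous_compact_integrable; [exact: segment_compact|apply: contw; exact: cC].
rewrite /dtent RintegralB //.
rewrite Rintegral_cst //.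
have -> : \int[mu]_(s in `[0, t]) \1_A s = Num.min t x0.
  have -> : \int[mu]_(s in `[0, t]) \1_A s = \int[mu]_(s in `[0, t]) (((fun=> 1) : R -> R) \_ A) s.
    by apply: eq_Rintegral => s _; rewrite patchE indicE; case: (s \in A).
  rewrite -Rintegral_mkcondr.
  have -> : `[0, t] `&` A = `[0, Num.min t x0].
    apply/seteqP; split => s /=; rewrite /A /= !in_itv /= le_min.
      by move=> [/andP[a b] /andP[_ d]]; rewrite a b d.
    by move=> /andP[a /andP[b d]]; rewrite a b d.
  rewrite Rintegral_cst // mul1r.
  have hm : cI01 (Num.min t x0).
    by apply/cI01E; rewrite le_min t0 (ltW h0) /= ge_min t1.
  exact: (congr1 fine (mucI01 hm)).
rewrite /tent; congr (_ - _ * _); exact: (esym (congr1 fine (mucI01 ht))).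
Qed.

Lemma tent_H10 : H10 tent dtent.
Proof.
split.
- exact: dtent_meas.
- rewrite ltey; apply/negP => /eqP e.
  have := LpI2_sqr dtent; rewrite e => e2.
  have fi : mu.-integrable (@I01 R) (EFin \o (fun x => dtent x ^+ 2)).
    apply: (@bounded_integrable _ 4); first by apply: measurable_funX; exact: dtent_meas.
    move=> x _; rewrite normrX; have := dtent_bd x; have := normr_ge0 (dtent x).
    by set a := `|_|; rewrite expr2; nra.
  have /integrableP[_] := fi.
  have -> : (\int[mu]_(x in I01) `|(EFin \o (fun x => (dtent x ^+ 2)%R)) x| = \int[mu]_(x in I01) (dtent x ^+ 2)%:E)%E.
    by apply: eq_integral => x _ /=; rewrite ger0_norm // sqr_ge0.
  by rewrite -e2 poweRyr ?pnatr_eq0 // ltxx.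
- exact: tent_prim.
- by rewrite /tent min_r ?mulr1 ?subrr //; move/I01E: Ix0 => /andP[_ /ltW].
Qed.

(** Pairing du with the derivative of Green's function evaluates u at x0. *)
Lemma tent_du u du : H10 u du -> mu.-integrable (@I01 R) (EFin \o (fun t => du t * dtent t)) /\
  \int[mu]_(t in I01) (du t * dtent t) = u x0.
Proof.
move=> [mdu ldu hu u1]; have idu := L2_integrable mdu ldu.
move/I01E: Ix0 => /andP[h0 h1].
have iA : mu.-integrable (@I01 R) (EFin \o (du \_ A)).
  rewrite -restrict_EFin.
  apply/integrable_restrict; [exact: measurable_itv|exact: measurable_itv|].
  apply: integrableS idu; [exact: measurable_itv|by apply: measurableI; exact: measurable_itv|].
  by move=> x [].
have i2 : mu.-integrable (@I01 R) (EFin \o (fun t => x0 * du t)).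
  have h : mu.-integrable (@I01 R) (fun t => x0%:E * (EFin \o du) t)%E.
    by apply: integrableZl => //; exact: measurable_itv.
  exact: h.
have e t : du t * dtent t = (du \_ A) t - x0 * du t.
  rewrite /dtent indicE patchE; case: (t \in A) => /=; first by rewrite mulr1n; ring.
  by transitivity (0 - x0 * du t); first by rewrite mulr0n; ring.
split.
  have h : mu.-integrable (@I01 R) ((EFin \o (du \_ A)) \- (EFin \o (fun t => x0 * du t)%R))%E.
    by apply: integrableB => //; exact: measurable_itv.
  by apply: (eq_integrable _ _ _ _ h); [exact: measurable_itv|move=> t _ /=; rewrite e EFinB].
under eq_Rintegral do rewrite e.
rewrite RintegralB //; last exact: measurable_itv.
rewrite RintegralZl //; last exact: measurable_itv.
rewrite (Rint_I idu) -hu ?u1 ?mulr0 ?subr0; last by apply/cI01E; rewrite lexx ler01.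
rewrite -Rintegral_mkcondr.
have -> : I01 `&` A = `]0, x0].
  apply/seteqP; split => s /=; rewrite /I01 /A /= !in_itv /=.
    by move=> [/andP[-> _] /andP[_ ->]].
  by move=> /andP[s0 sx]; rewrite s0 sx (ltW s0) (le_lt_trans sx h1).
rewrite Rintegral_itv_obnd_cbnd.
  by rewrite -hu //; exact: I01_cI01.
apply: integrableS idu; [exact: measurable_itv|exact: measurable_itv|].
by move=> s /=; rewrite /I01 /= !in_itv /= => /andP[-> sx]; rewrite (le_lt_trans sx h1).
Qed.

(** Two integrations by parts, on each side of the kink at x0, carried out by
    comparing the primitive with explicit antiderivatives Fa and Fb. *)
Lemma tent_green (Q : R -> R) : continuous Q ->
  \int[mu]_(t in I01) (Q t * tent t) = x0 * primitive (primitive Q) 1 - primitive (primitive Q) x0.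
Proof.
move=> cQ; have ct := cM cQ tent_cont; rewrite (Rintegral_primitive ct).
set z1 := primitive Q; set z := primitive z1.
have cz1 : continuous z1 by exact: continuous_primitive.
have cz : continuous z by exact: continuous_primitive.
have dz1 x : I01 x -> is_derive x 1 z1 (Q x) by move=> hx; exact: is_derive_primitive.
have dz x : I01 x -> is_derive x 1 z (z1 x) by move=> hx; exact: is_derive_primitive.
have dp x : I01 x -> is_derive x 1 (primitive (fun t => Q t * tent t)) (Q x * tent x) by move=> hx; exact: is_derive_primitive.
have cp := continuous_primitive ct.
have /andP[h0 h1] := (I01E x0).1 Ix0.
pose Fa t := (1 - x0) * (t * z1 t - z t).
pose Fb t := x0 * ((1 - t) * z1 t + z t).
have cFa : continuous Fa by apply: cZ; apply: cB => //; apply: cM => //; exact: cX.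
have cFb : continuous Fb.
  by apply: cZ; apply: cD => //; apply: cM => //; apply: cB; [exact: cC|exact: cX].
have dFa x : I01 x -> is_derive x 1 Fa ((1 - x0) * x * Q x).
  move=> hx; apply: (is_derive_eq (dZ (1 - x0) (dB (dM (did x) (dz1 x hx)) (dz x hx)))); ring.
have dFb x : I01 x -> is_derive x 1 Fb (x0 * (1 - x) * Q x).
  move=> hx; apply: (is_derive_eq (dZ x0 (dD (dM (dB (dcst 1 x) (did x)) (dz1 x hx)) (dz x hx)))); ring.
have cst0 (f f' : R -> R) (a b : R) : 0 <= a -> a <= b -> b <= 1 -> continuous f ->
   (forall x, a < x < b -> is_derive x 1 f (f' x)) -> (forall x, a < x < b -> f' x = 0) -> f b = f a.
  move=> a0 ab b1 cf df f0; apply/eqP; rewrite -subr_eq0 -normr_le0.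
  have := mean_value_ineq ab (contw (A := `[a, b]) cf) (contw (A := `[a, b]) (@cC _ 0)) df (fun x _ => dcst 0 x) _.
  rewrite subrr; apply => x hx; by rewrite f0 // normr0.
have in1 x : 0 < x < x0 -> I01 x by move=> /andP[a b]; apply/I01E; rewrite a (lt_trans b).
have in2 x : x0 < x < 1 -> I01 x by move=> /andP[a b]; apply/I01E; rewrite b (lt_trans h0).
have e1 : primitive (fun t => Q t * tent t) x0 - Fa x0 = primitive (fun t => Q t * tent t) 0 - Fa 0.
  apply: (cst0 _ (fun x => Q x * tent x - (1 - x0) * x * Q x) _ _ (lexx 0) (ltW h0) (ltW h1) (cB cp cFa)).
  - by move=> x /in1 hx; apply: dB; [exact: dp|exact: dFa].
  - by move=> x /andP[_ xx]; rewrite /tent min_l ?(ltW xx) //; ring.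
have e2 : primitive (fun t => Q t * tent t) 1 - Fb 1 = primitive (fun t => Q t * tent t) x0 - Fb x0.
  apply: (cst0 _ (fun x => Q x * tent x - x0 * (1 - x) * Q x) _ _ (ltW h0) (ltW h1) (lexx 1) (cB cp cFb)).
  - by move=> x /in2 hx; apply: dB; [exact: dp|exact: dFb].
  - by move=> x /andP[xx _]; rewrite /tent min_r ?(ltW xx) //; ring.
have z0 : z 0 = 0 by exact: primitive0.
have z10 : z1 0 = 0 by exact: primitive0.
move: e1 e2; rewrite primitive0 /Fa /Fb z0 z10.
set p1 := primitive _ 1; set p0 := primitive _ x0 => e1 e2.
have -> : p1 = p1 - x0 * ((1 - 1) * z1 1 + z 1) + x0 * z 1 by ring.
rewrite e2; have -> : p0 = p0 - (1 - x0) * (x0 * z1 x0 - z x0) + (1 - x0) * (x0 * z1 x0 - z x0) by ring.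
rewrite e1; ring.
Qed.

End tent.

(** Testing with Green's function expresses u as the double primitive of F - P
    corrected to vanish at 1, which is twice differentiable because P and F
    are continuous. *)
Lemma weak_classical (c : R) u du (P F : R -> R) : 0 < c -> H10 u du -> continuous P -> continuous F ->
  (forall phi dphi, H10 phi dphi ->
    \int[mu]_(x in I01) (c * du x * dphi x + P x * phi x) = \int[mu]_(x in I01) (F x * phi x)) ->
  exists y y1 : R -> R, [/\ continuous y, continuous y1, forall x, I01 x -> is_derive x 1 y (y1 x),
    forall x, I01 x -> is_derive x 1 y1 (c^-1 * (P x - F x)) & forall x, cI01 x -> u x = y x].
Proof.
move=> c0 hu cP cF weak.
pose Q x := F x - P x.
have cQ : continuous Q by apply: cB.
pose z1 := primitive Q; pose z := primitive z1.
have cz1 : continuous z1 by exact: continuous_primitive.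
have cz : continuous z by exact: continuous_primitive.
have key x0 : I01 x0 -> u x0 = c^-1 * (x0 * z 1 - z x0).
  move=> hx; have [idu edu] := tent_du hx hu; have ct := @tent_cont x0.
  have := weak _ _ (tent_H10 hx).
  have i1 : mu.-integrable (@I01 R) (EFin \o (fun x => c * (du x * dtent x0 x))).
    have h : mu.-integrable (@I01 R) (fun t => c%:E * (EFin \o (fun x => (du x * dtent x0 x)%R)) t)%E.
      by apply: integrableZl => //; exact: measurable_itv.
    exact: h.
  have i2 : mu.-integrable (@I01 R) (EFin \o (fun x => P x * tent x0 x)) by apply: cont_integrable; exact: cM.
  have i3 : mu.-integrable (@I01 R) (EFin \o (fun x => F x * tent x0 x)) by apply: cont_integrable; exact: cM.
  under eq_Rintegral do rewrite -mulrA.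
  rewrite RintegralD //; last exact: measurable_itv.
  rewrite RintegralZl //; last exact: measurable_itv.
  rewrite edu => e.
  have e2 := tent_green hx cQ.
  have e3 : \int[mu]_(t in I01) (Q t * tent x0 t) = \int[mu]_(t in I01) (F t * tent x0 t) - \int[mu]_(t in I01) (P t * tent x0 t).
    under eq_Rintegral do rewrite /Q mulrBl.
    by rewrite RintegralB //; exact: measurable_itv.
  rewrite -/z1 -/z e3 -e addrK in e2.
  by rewrite -e2 mulrA mulVf ?mul1r // gt_eqF.
have z0 : z 0 = 0 by exact: primitive0.
have cy1 : continuous (fun x : R => c^-1 * (z 1 - z1 x)) := @cZ R c^-1 _ (cB (@cC R (z 1)) cz1).
have cy : continuous (fun x : R => c^-1 * (x * z 1 - z x)) := @cZ R c^-1 _ (cB (cM (@cX R) (@cC R (z 1))) cz).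
exists (fun x : R => c^-1 * (x * z 1 - z x)), (fun x : R => c^-1 * (z 1 - z1 x)).
split; [exact: cy|exact: cy1| | |].
- move=> x hx; apply: (is_derive_eq (dZ c^-1 (dB (dM (did x) (dcst (z 1) x)) (is_derive_primitive cz1 hx)))).
  by rewrite -/z1; ring.
- move=> x hx; apply: (is_derive_eq (dZ c^-1 (dB (dcst (z 1) x) (is_derive_primitive cQ hx)))).
  by rewrite /Q; ring.
- move=> x /cI01E; rewrite !le_eqVlt => /andP[/predU1P[<-|x0] /predU1P[x1|x1]].
  + by move: x1 => /eqP; rewrite eq_sym oner_eq0.
  + have [_ _ h _] := hu; rewrite h; last by apply/cI01E; rewrite lexx ler01.
    by rewrite set_itv1 Rintegral_set1 mul0r z0 subrr mulr0.
  + by have [_ _ _ u1] := hu; rewrite x1 u1 mul1r subrr mulr0.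
  + by apply: key; apply/I01E; rewrite x0 x1.
Qed.

(** The weak solution is a primitive, hence continuous; this makes the lower
    order terms of the equations continuous functions. *)
Lemma H10_cont u du : H10 u du -> continuous (fun x => u (clamp x)).
Proof.
move=> [mdu ldu hu u1]; have idu := integrable_cc (L2_integrable mdu ldu).
have h := parameterized_integral_continuous ler01 idu.
have := clamp_comp h; rewrite (_ : (fun x : R => parameterized_integral mu 0 (clamp x) du) = (fun x => u (clamp x))) //.
by apply/funext => x; rewrite hu //; exact: clamp_in.
Qed.

Lemma H10_zero : @H10 R (fun=> 0) (fun=> 0).
Proof.
split; [| | |by []].
- exact: measurable_cst.
- rewrite /LpI (_ : EFin \o _ = cst 0%E).
    by rewrite Lnorm0 ?ltry // eqe.
  by apply/funext => x /=; rewrite patchE; case: ifP.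
- by move=> x hx; rewrite Rintegral_cst // mul0r.
Qed.

End Weak.

(** * The energy estimate *)

Section Energy.
Context {R : realType}.
Implicit Types (f g u : R -> R).
Notation leb := (@lebesgue_measure R).

Lemma LpI2_cont f D : continuous D -> (forall x, I01 x -> f x = D x) ->
  (LpI 2%:E f ^+ 2 = (primitive (fun x => D x ^+ 2) 1)%:E)%E.
Proof.
move=> cD e.
have cD2 : continuous (fun x => D x ^+ 2).
  rewrite (_ : (fun x => D x ^+ 2) = (fun x => D x * D x)); first exact: cM.
  by apply/funext => x; rewrite expr2.
have h : (LpI 2%:E f `^ 2 = (primitive (fun x => D x ^+ 2) 1)%:E)%E.
  rewrite LpI2_sqr.
  transitivity (\int[leb]_(x in I01) (EFin \o (fun x => D x ^+ 2)%R) x)%E.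
    by apply: eq_integral => x /set_mem hx; rewrite /= e.
  rewrite -(Rintegral_primitive cD2) /Rintegral fineK //.
  by apply: integrable_fin_num; [exact: mI01|exact: cont_integrable].
rewrite -h; have := LpI_ge0 2%:E f; case: (LpI 2%:E f) => [r| |] // r0.
- by rewrite -EFin_expe poweR_EFin powR_mulrn // -lee_fin.
- by rewrite poweRyr ?pnatr_eq0 // expeS.
Qed.

(** Pointwise form of the energy identity. With J = eps^2 r1 r1' + mu^2 r2
    r2', coercivity and Young's inequality bound the energy density by 2 J' +
    (S / al)^2, and J vanishes at both endpoints. *)
Lemma energy_estimate (a11 a12 a21 a22 r1 r2 D1 D2 E1 E2 : R -> R) (eps mu al S : R) :
  0 < al -> 0 <= S ->
  (forall x s t, I01 x -> al ^+ 2 * (s ^+ 2 + t ^+ 2) <=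
     s * (a11 x * s + a12 x * t) + t * (a21 x * s + a22 x * t)) ->
  continuous r1 -> continuous r2 -> continuous D1 -> continuous D2 ->
  r1 0 = 0 -> r1 1 = 0 -> r2 0 = 0 -> r2 1 = 0 ->
  (forall x, I01 x -> is_derive x 1 r1 (D1 x)) ->
  (forall x, I01 x -> is_derive x 1 r2 (D2 x)) ->
  (forall x, I01 x -> is_derive x 1 D1 (E1 x)) ->
  (forall x, I01 x -> is_derive x 1 D2 (E2 x)) ->
  (forall x, I01 x -> (- eps ^+ 2 * E1 x + a11 x * r1 x + a12 x * r2 x) ^+ 2 +
     (- mu ^+ 2 * E2 x + a21 x * r1 x + a22 x * r2 x) ^+ 2 <= S ^+ 2) ->
  eps ^+ 2 * primitive (fun x => D1 x ^+ 2) 1 + mu ^+ 2 * primitive (fun x => D2 x ^+ 2) 1 +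
  al ^+ 2 * (primitive (fun x => r1 x ^+ 2) 1 + primitive (fun x => r2 x ^+ 2) 1) <= (S / al) ^+ 2.
Proof.
move=> al0 S0 co cr1 cr2 cD1 cD2 r10 r11 r20 r21 dr1 dr2 dD1 dD2 hS.
have csq f : continuous f -> continuous (fun x => f x ^+ 2).
  move=> cf; rewrite (_ : (fun x => f x ^+ 2) = (fun x => f x * f x)); first exact: cM.
  by apply/funext => x; rewrite expr2.
pose G x := eps ^+ 2 * primitive (fun x => D1 x ^+ 2) x + mu ^+ 2 * primitive (fun x => D2 x ^+ 2) x +
  al ^+ 2 * (primitive (fun x => r1 x ^+ 2) x + primitive (fun x => r2 x ^+ 2) x).
pose K x := 2 * (eps ^+ 2 * (r1 x * D1 x) + mu ^+ 2 * (r2 x * D2 x)) + (S / al) ^+ 2 * x.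
pose G' x := eps ^+ 2 * D1 x ^+ 2 + mu ^+ 2 * D2 x ^+ 2 + al ^+ 2 * (r1 x ^+ 2 + r2 x ^+ 2).
pose K' x := 2 * (eps ^+ 2 * (D1 x * D1 x + r1 x * E1 x) + mu ^+ 2 * (D2 x * D2 x + r2 x * E2 x))
  + (S / al) ^+ 2 * 1.
have cp f : continuous f -> continuous (primitive (fun x => f x ^+ 2)) by move=> cf; apply: continuous_primitive; exact: csq.
have cG : continuous G := cD (cD (cZ (cp _ cD1)) (cZ (cp _ cD2))) (cZ (cD (cp _ cr1) (cp _ cr2))).
have cK : continuous K := cD (cZ (cD (cZ (cM cr1 cD1)) (cZ (cM cr2 cD2)))) (cZ cX).
have dp f x : continuous f -> I01 x -> is_derive x 1 (primitive (fun x => f x ^+ 2)) (f x ^+ 2).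
  by move=> cf hx; apply: is_derive_primitive => //; exact: csq.
have dG x : I01 x -> is_derive x 1 G (G' x).
  move=> hx; exact: (dD (dD (dZ _ (dp _ x cD1 hx)) (dZ _ (dp _ x cD2 hx)))
    (dZ _ (dD (dp _ x cr1 hx) (dp _ x cr2 hx)))).
have dK x : I01 x -> is_derive x 1 K (K' x).
  move=> hx; exact: (dD (dZ _ (dD (dZ _ (dM (dr1 x hx) (dD1 x hx))) (dZ _ (dM (dr2 x hx) (dD2 x hx)))))
    (dZ _ (did x))).
have h1 : cI01 (1 : R) by apply/cI01E; rewrite lexx ler01.
have := mean_value_ineq0 h1 cG cK dG dK _.
rewrite /G /K !primitive0 r10 r20 r11 r21 !(mul0r, mulr0, addr0, subr0, add0r, mulr1).
move=> h; apply: le_trans (ler_norm _) (h _) => x hx.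
have G'0 : 0 <= G' x by rewrite /G'; rewrite !addr_ge0 // mulr_ge0 ?sqr_ge0 // addr_ge0 // sqr_ge0.
rewrite ger0_norm // /G' /K'.
have := hS x hx; have := co x (r1 x) (r2 x) hx.
set l1 := - _ * E1 x + _ + _; set l2 := - _ * E2 x + _ + _.
set X := r1 x; set Y := r2 x => hco hl.
have e1 : eps ^+ 2 * E1 x = a11 x * X + a12 x * Y - l1 by rewrite /l1 -/X -/Y; ring.
have e2 : mu ^+ 2 * E2 x = a21 x * X + a22 x * Y - l2 by rewrite /l2 -/X -/Y; ring.
have -> : 2 * (eps ^+ 2 * (D1 x * D1 x + X * E1 x) + mu ^+ 2 * (D2 x * D2 x + Y * E2 x)) + (S / al) ^+ 2 * 1 =
  2 * (eps ^+ 2 * D1 x ^+ 2 + mu ^+ 2 * D2 x ^+ 2) + 2 * (X * (eps ^+ 2 * E1 x) + Y * (mu ^+ 2 * E2 x)) + (S / al) ^+ 2.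
  ring.
rewrite e1 e2.
have d1 : 0 <= eps ^+ 2 * D1 x ^+ 2 by rewrite mulr_ge0 // sqr_ge0.
have d2 : 0 <= mu ^+ 2 * D2 x ^+ 2 by rewrite mulr_ge0 // sqr_ge0.
(* Young: 2 r.l <= al^2 |r|^2 + |l|^2 / al^2. *)
have hl' : (l1 ^+ 2 + l2 ^+ 2) / al ^+ 2 <= (S / al) ^+ 2.
  by rewrite expr_div_n ler_wpM2r // invr_ge0 sqr_ge0.
have y1 := sqr_ge0 (al * X - l1 / al); have y2 := sqr_ge0 (al * Y - l2 / al).
have z1 : (al * X - l1 / al) ^+ 2 = al ^+ 2 * X ^+ 2 - 2 * (X * l1) + l1 ^+ 2 / al ^+ 2.
  by field; rewrite gt_eqF.
have z2 : (al * Y - l2 / al) ^+ 2 = al ^+ 2 * Y ^+ 2 - 2 * (Y * l2) + l2 ^+ 2 / al ^+ 2.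
  by field; rewrite gt_eqF.
rewrite z1 in y1; rewrite z2 in y2; rewrite mulrDl in hl'.
move: d1 d2 y1 y2 hl' hco; rewrite !mulrBr !mulrDr.
lra.
Qed.

Lemma energy_norm_le (a11 a12 a21 a22 r1 r2 D1 D2 E1 E2 : R -> R) (eps mu al S : R) :
  0 < al -> 0 <= S ->
  (forall x s t, I01 x -> al ^+ 2 * (s ^+ 2 + t ^+ 2) <=
     s * (a11 x * s + a12 x * t) + t * (a21 x * s + a22 x * t)) ->
  continuous r1 -> continuous r2 -> continuous D1 -> continuous D2 ->
  r1 0 = 0 -> r1 1 = 0 -> r2 0 = 0 -> r2 1 = 0 ->
  (forall x, I01 x -> is_derive x 1 r1 (D1 x)) ->
  (forall x, I01 x -> is_derive x 1 r2 (D2 x)) ->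
  (forall x, I01 x -> is_derive x 1 D1 (E1 x)) ->
  (forall x, I01 x -> is_derive x 1 D2 (E2 x)) ->
  (forall x, I01 x -> (- eps ^+ 2 * E1 x + a11 x * r1 x + a12 x * r2 x) ^+ 2 +
     (- mu ^+ 2 * E2 x + a21 x * r1 x + a22 x * r2 x) ^+ 2 <= S ^+ 2) ->
  (energy_norm eps mu al r1 r2 <= (S / al)%:E)%E.
Proof.
move=> al0 S0 co cr1 cr2 cD1 cD2 r10 r11 r20 r21 dr1 dr2 dD1 dD2 hS.
have est := energy_estimate al0 S0 co cr1 cr2 cD1 cD2 r10 r11 r20 r21 dr1 dr2 dD1 dD2 hS.
rewrite /energy_norm (LpI2_cont cD1 (fun x hx => dE (dr1 x hx))) (LpI2_cont cD2 (fun x hx => dE (dr2 x hx))).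
rewrite (LpI2_cont cr1 (fun x _ => erefl)) (LpI2_cont cr2 (fun x _ => erefl)).
rewrite -!(EFinM, EFinD) poweR_EFin lee_fin.
have Sa0 : 0 <= S / al by rewrite divr_ge0 // ltW.
have -> : S / al = ((S / al) ^+ 2) `^ 2^-1.
  by rewrite -powR_mulrn // -powRrM mulfV ?pnatr_eq0 // powRr1.
have p0 f : continuous f -> 0 <= primitive (fun x => f x ^+ 2) 1.
  move=> cf; rewrite -Rintegral_primitive; first by apply: Rintegral_ge0 => x _; exact: sqr_ge0.
  rewrite (_ : (fun x => f x ^+ 2) = (fun x => f x * f x)); first exact: cM.
  by apply/funext => x; rewrite expr2.
apply: (@ge0_ler_powR R 2^-1 _ _ _ _ _ est); rewrite ?nnegrE ?invr_ge0 ?ler0n ?sqr_ge0 //.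
by rewrite !addr_ge0 // mulr_ge0 ?sqr_ge0 ?p0 // addr_ge0 // p0.
Qed.
End Energy.

(** * The asymptotic approximation *)

Section Pieces.
Context {R : realType}.
Implicit Types (f g u e : R -> R).

(** Repackages the layers as functions with the uniform decay rate al / 2,
    since al <= beta by coercivity. *)
Lemma layer_functions (b11 b12 b21 b22 : R -> R) (Ca ga al : R) : 0 < Ca -> 0 < ga -> 0 < al ->
  continuous b11 -> continuous b12 -> continuous b21 -> continuous b22 ->
  analytic_bd Ca ga b11 -> analytic_bd Ca ga b12 -> analytic_bd Ca ga b21 -> analytic_bd Ca ga b22 ->
  al ^+ 2 <= b11 0 ->
  exists q CL gL b : R, [/\ 0 < q, 0 < CL, 0 < gL & 0 < b] /\
  forall eps tau : R, 0 < eps -> 0 <= tau -> tau <= q ->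
  exists e1 e2 : R -> R, [/\
    [/\ entire e1, entire e2, entire (fun x => e1 (1 - x)) & entire (fun x => e2 (1 - x))],
    [/\ smooth e1, smooth e2, continuous e1 & continuous e2], e1 0 = 1,
    forall n x, 0 <= x ->
      `|derive1n n e1 x| <= CL * (gL / eps) ^+ n * expR (- (al / 2 * (x / eps))) /\
      `|derive1n n e2 x| <= CL * (gL / eps) ^+ n * expR (- (al / 2 * (x / eps))) &
    forall x, cI01 x ->
      `|- eps ^+ 2 * derive1n 2 e1 x + b11 x * e1 x + tau * b12 x * e2 x| <= CL * expR (- (b / eps)) /\
      `|- eps ^+ 2 * derive1n 2 e2 x + b21 x * e1 x + tau * b22 x * e2 x| <= CL * expR (- (b / eps))].
Proof.
move=> Ca0 ga0 al0 k11 k12 k21 k22 A11 A12 A21 A22 hal.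
have [t11 [T11 e11]] := taylor_of_analytic_bd Ca0 ga0 k11 A11.
have [t12 [T12 _]] := taylor_of_analytic_bd Ca0 ga0 k12 A12.
have [t21 [T21 _]] := taylor_of_analytic_bd Ca0 ga0 k21 A21.
have [t22 [T22 _]] := taylor_of_analytic_bd Ca0 ga0 k22 A22.
have b110 : 0 <= b11 0 by apply: le_trans hal; exact: sqr_ge0.
pose beta := Num.sqrt (b11 0).
have albeta : al <= beta by rewrite -[al]gtr0_norm // -sqrtr_sqr ler_sqrt.
have beta0 : 0 < beta := lt_le_trans al0 albeta.
have tb : t11 0%N = beta ^+ 2 by rewrite e11 sqr_sqrtr.
have [q [CL [gL [b [[q0 CL0 gL0 b0] H]]]]] := layer_approx Ca0 ga0 beta0 tb T11 T12 T21 T22.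
exists q, CL, gL, b; split=> // eps tau eps0 tau0 tauq.
have [p1 [p2 [E0 Ebd Er]]] := H eps tau eps0 tau0 tauq.
exists (exp_profile beta eps p1), (exp_profile beta eps p2); split; [| |exact: E0| |].
- by split; [exact: entire_exp_profile|exact: entire_exp_profile|exact: entire_exp_profile_refl|exact: entire_exp_profile_refl].
- split; [| |by move=> x; apply: dcont (is_derive_exp_profile _ _ _ _)|by move=> x; apply: dcont (is_derive_exp_profile _ _ _ _)].
    by move=> n x _; have [] := is_derive_derive1n_exp_profile beta eps p1 n x.
  by move=> n x _; have [] := is_derive_derive1n_exp_profile beta eps p2 n x.
- move=> n x x0; have [h1 h2] := Ebd n x x0.
  have hexp : expR (- (beta / 2 * (x / eps))) <= expR (- (al / 2 * (x / eps))).
    rewrite ler_expR lerN2 ler_wpM2r ?divr_ge0 ?(ltW eps0) //.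
    by rewrite ler_wpM2r // invr_ge0.
  have c0 : 0 <= CL * (gL / eps) ^+ n.
    by rewrite mulr_ge0 ?(ltW CL0) // exprn_ge0 // divr_ge0 ?ltW.
  split; [apply: le_trans h1 _|apply: le_trans h2 _]; exact: ler_wpM2l.
- by move=> x /cI01E; exact: Er.
Qed.

Lemma dist_bd_le (x : R) : I01 x -> dist_bd x <= x /\ dist_bd x <= 1 - x.
Proof.
move=> /I01E /andP[x0 x1]; rewrite /dist_bd subr0 gtr0_norm // distrC gtr0_norm ?subr_gt0 //.
by rewrite !ge_min !lexx orbT.
Qed.

Lemma derive1n_layers (eL eR : R -> R) (c0 c1 : R) : smooth eL -> smooth eR ->
  smooth (fun x => c0 * eL x + c1 * eR (1 - x)) /\
  forall n x, I01 x -> derive1n n (fun x => c0 * eL x + c1 * eR (1 - x)) x =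
    c0 * derive1n n eL x + c1 * ((-1) ^+ n * derive1n n eR (1 - x)).
Proof.
move=> sL sR; have [sr er] := smooth_refl sR.
have [s1 e1] := derive1n_scale c0 sL; have [s2 e2] := derive1n_scale c1 sr.
have [s e] := derive1n_add s1 s2; split=> // n x hx.
by rewrite e // e1 // e2 // er.
Qed.

(** Left and right layers together decay with the distance to the boundary.
    The scale 2 / al * eps is the reciprocal of the decay rate al / (2 eps).
    *)
Lemma classBL_layers (eL eR : R -> R) (c0 c1 K CL CR gL gR al eps : R) :
  0 < al -> 0 < eps -> 0 <= CL -> 0 <= CR -> 0 <= gL -> 0 <= gR ->
  `|c0| <= K -> `|c1| <= K ->
  entire eL -> entire (fun x => eR (1 - x)) -> smooth eL -> smooth eR ->
  (forall n x, 0 <= x -> `|derive1n n eL x| <= CL * (gL / eps) ^+ n * expR (- (al / 2 * (x / eps)))) ->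
  (forall n x, 0 <= x -> `|derive1n n eR x| <= CR * (gR / eps) ^+ n * expR (- (al / 2 * (x / eps)))) ->
  classBL (2 / al * eps) (K * (CL + CR)) ((gL + gR) * (2 / al)) (fun x => c0 * eL x + c1 * eR (1 - x)).
Proof.
move=> al0 eps0 CL0 CR0 gL0 gR0 hc0 hc1 EL ER sL sR bL bR.
have K0 : 0 <= K := le_trans (normr_ge0 _) hc0.
split; first by apply: entire_add; apply: entire_scale.
move=> n x hx; have [_ ->] // := derive1n_layers c0 c1 sL sR.
have [d1 d2] := dist_bd_le hx; have /I01E/andP[x0 x1] := hx.
set E := expR (- (dist_bd x / _)).
have -> : K * (CL + CR) * ((gL + gR) * (2 / al)) ^+ n * (2 / al * eps) ^- n * E =
   K * (CL * ((gL + gR) / eps) ^+ n * E) + K * (CR * ((gL + gR) / eps) ^+ n * E).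
  rewrite -mulrDr; rewrite -!mulrDl -!mulrA; congr (_ * (_ * _)); rewrite mulrA; congr (_ * _).
  by rewrite -exprVn -exprMn; congr (_ ^+ _); field; rewrite !gt_eqF.
have bnd (C g1 y : R) : 0 <= C -> 0 <= g1 -> g1 <= gL + gR -> dist_bd x <= y ->
  C * (g1 / eps) ^+ n * expR (- (al / 2 * (y / eps))) <= C * ((gL + gR) / eps) ^+ n * E.
  move=> C0 g10 gg dy; rewrite -[X in X <= _]mulrA -[X in _ <= X]mulrA; apply: ler_wpM2l => //; apply: ler_pM; rewrite ?expR_ge0 //.
  - by rewrite exprn_ge0 // divr_ge0 // ltW.
  - by apply: lerXn2r; rewrite ?nnegrE ?divr_ge0 ?addr_ge0 ?(ltW eps0) // ler_wpM2r // invr_ge0 ltW.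
  - rewrite ler_expR lerN2.
    have -> : dist_bd x / (2 / al * eps) = al / 2 * (dist_bd x / eps) by field; rewrite !gt_eqF.
    by rewrite ler_wpM2l ?divr_ge0 ?(ltW al0) // ler_wpM2r // invr_ge0 ltW.
apply: le_trans (ler_normD _ _) _; rewrite !normrM normrX normrN normr1 expr1n mul1r.
apply: lerD; apply: ler_pM; rewrite ?normr_ge0 //.
  apply: le_trans (bL n x (ltW x0)) _; apply: bnd => //; by rewrite lerDl.
have x1' : 0 <= 1 - x by rewrite subr_ge0 ltW.
apply: le_trans (bR n (1 - x) x1') _; apply: bnd => //; by rewrite lerDr.
Qed.

Lemma derive1n_affine (c d : R) : smooth (fun x => c + d * x) /\
  forall n x, I01 x -> derive1n n (fun x => c + d * x) x =
    if n is n'.+1 then if n' is 0%N then d else 0 else c + d * x.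
Proof.
apply: (@smooth_jet _ (fun n x => if n is n'.+1 then if n' is 0%N then d else 0 else c + d * x)) => // n x hx.
case: n => [|n]; last by case: n => [|n]; exact: dcst.
have h := dD (dcst c x) (dZ d (did x)).
by apply: (is_derive_eq h); rewrite add0r mulr1.
Qed.

(** The number of terms of the smooth expansion: m.+1 is the integer part of
    kappa / eps, which is at least 1. *)
Lemma number_of_terms (eps kappa : R) : 0 < eps -> eps <= kappa ->
  exists m : nat, eps * (2 * m.+1)%:R <= 2 * kappa /\ (1 / 2) ^+ m <= 4 * expR (- (kappa / 2 / eps)).
Proof.
move=> eps0 ek; have k0 : 0 <= kappa / eps by rewrite divr_ge0 ?(ltW eps0) // (le_trans (ltW eps0)).
have /andP[h1 h2] := truncn_itv k0; set M := Num.truncn _ in h1 h2.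
have M0 : (0 < M)%N.
  by rewrite lt0n; apply/eqP => e; move: h2; rewrite e ltNge ler_pdivlMr // mul1r ek.
exists M.-1; rewrite prednK //; split.
  rewrite natrM mulrCA ler_wpM2l // mulrC -ler_pdivlMr //.
have h3 : kappa / eps - 1 <= M%:R by rewrite -natr1 in h2; lra.
have := half_pow_le_exp h3; rewrite -{1}(prednK M0) exprS => h4.
have -> : kappa / 2 / eps = kappa / eps / 2 by ring.
lra.
Qed.

End Pieces.

Section Approx.
Context {R : realType}.
Implicit Types (f g u e : R -> R).

Lemma analytic_bd_mono f (C C' g g' : R) : 0 <= C -> 0 <= g -> C <= C' -> g <= g' -> analytic_bd C g f -> analytic_bd C' g' f.
Proof.
move=> C0 g0 CC gg [sf h]; split=> // n x hx; apply: le_trans (h n x hx) _.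
rewrite ler_wpM2r // ler_pM ?exprn_ge0 //.
by apply: lerXn2r; rewrite ?nnegrE // (le_trans g0).
Qed.

(** Test vector (- b / a, 1): the first component of the product vanishes, and
    the second is the Schur complement. *)
Lemma coercive_det (al a b c d : R) : 0 < al ->
  (forall s t, al ^+ 2 * (s ^+ 2 + t ^+ 2) <= s * (a * s + b * t) + t * (c * s + d * t)) ->
  al ^+ 2 <= a /\ al ^+ 2 <= d - c * b / a.
Proof.
move=> al0 h; have ha := h 1 0.
have al2 : 0 < al ^+ 2 by rewrite exprn_gt0.
have a0 : al ^+ 2 <= a by move: ha; rewrite expr1n expr0n /= => ?; lra.
split=> //; have := h (- b / a) 1.
have a1 : 0 < a := lt_le_trans al2 a0.
have -> : - b / a * (a * (- b / a) + b * 1) + 1 * (c * (- b / a) + d * 1) = d - c * b / a.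
  by field; rewrite gt_eqF.
apply: le_trans; rewrite expr1n mulrDr mulr1 lerDr mulr_ge0 ?sqr_ge0 //.
Qed.

(** The correction of the boundary values; its derivatives are bounded by its
    boundary values. *)
Lemma affine_lift (s0 s1 D : R) : `|s0| <= D -> `|s1| <= D ->
  exists l : R -> R, [/\ [/\ continuous l, smooth l, l 0 = - s0 & l 1 = - s1],
    forall x, I01 x -> derive1n 2 l x = 0, forall n x, I01 x -> `|derive1n n l x| <= 2 * D &
    forall x, I01 x -> `|l x| <= D].
Proof.
move=> h0 h1; exists (fun x => - s0 + (s0 - s1) * x).
have [sl el] := derive1n_affine (- s0) (s0 - s1).
have D0 : 0 <= D := le_trans (normr_ge0 _) h0.
have bl x : I01 x -> `|- s0 + (s0 - s1) * x| <= D.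
  move=> /I01E /andP[x0 x1].
  have -> : - s0 + (s0 - s1) * x = - (s0 * (1 - x) + s1 * x) by ring.
  rewrite normrN; apply: le_trans (ler_normD _ _) _; rewrite !normrM (gtr0_norm x0) (@gtr0_norm _ (1 - x)) ?subr_gt0 //.
  have -> : D = D * (1 - x) + D * x by ring.
  by apply: lerD; rewrite ler_wpM2r // ?subr_ge0 ltW.
split; [|by move=> x hx; rewrite el| |exact: bl].
  split; [|exact: sl|ring|ring].
  exact: cD (@cC R _) (cZ (@cX R)).
move=> n x hx; rewrite el //; case: n => [|[|n]].
- by apply: le_trans (bl x hx) _; lra.
- by apply: le_trans (ler_normB _ _) _; lra.
- by rewrite normr0 mulr_ge0.
Qed.

Lemma ler_norm_sum4 (a b c d A B C D : R) : `|a| <= A -> `|b| <= B -> `|c| <= C -> `|d| <= D ->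
  `|a + b + c + d| <= A + B + C + D.
Proof.
move=> ha hb hc hd; do 3 (apply: le_trans (ler_normD _ _) _; apply: lerD => //).
Qed.

Lemma ler_norm_prod (a b A B : R) : `|a| <= A -> `|b| <= B -> `|a * b| <= A * B.
Proof. by move=> ha hb; rewrite normrM ler_pM. Qed.

Variables (a11 a12 a21 a22 F1 F2 : R -> R) (Ca ga al Cf gf : R).
Hypothesis Ca0 : 0 < Ca.
Hypothesis ga0 : 0 < ga.
Hypothesis al0 : 0 < al.
Hypothesis Cf0 : 0 < Cf.
Hypothesis gf0 : 0 < gf.
Hypothesis A11 : analytic_bd Ca ga a11.
Hypothesis A12 : analytic_bd Ca ga a12.
Hypothesis A21 : analytic_bd Ca ga a21.
Hypothesis A22 : analytic_bd Ca ga a22.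
Hypothesis AF1 : analytic_bd Cf gf F1.
Hypothesis AF2 : analytic_bd Cf gf F2.
Hypothesis c11 : continuous a11.
Hypothesis c12 : continuous a12.
Hypothesis c21 : continuous a21.
Hypothesis c22 : continuous a22.
Hypothesis cF1 : continuous F1.
Hypothesis cF2 : continuous F2.
Hypothesis coer : forall x s t, al ^+ 2 * (s ^+ 2 + t ^+ 2) <=
     s * (a11 x * s + a12 x * t) + t * (a21 x * s + a22 x * t).

Let refl f := fun x => f (1 - x).

(** The amplitude of each layer is minus the boundary value of w1, and the
    second components carry the factor tau, because mu^2 tau = eps^2 turns the
    second equation into the layer equation. *)
Lemma asymptotic_approx : exists CW gW CBL gBL b q C : R,
  [/\ [/\ 0 < CW, 0 < gW, 0 < CBL & 0 < gBL], [/\ 0 < b, 0 < q & 0 < C] &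
  forall eps mu : R, 0 < eps -> eps <= mu -> mu <= 1 -> eps / mu <= q ->
  exists W1 W2 B1 B2 : R -> R,
  [/\ [/\ continuous W1, continuous W2, continuous B1 & continuous B2],
   [/\ classM mu 0 CW gW W1, classM mu 0 CW gW W2, smooth B1 & smooth B2],
   [/\ classBL (2 / al * eps) CBL gBL B1, classBL (2 / al * eps) CBL gBL B2
     & classBL (2 / al * eps) (CBL * (eps / mu) ^+ 2) gBL B2],
   [/\ W1 0 + B1 0 = 0, W1 1 + B1 1 = 0, W2 0 + B2 0 = 0 & W2 1 + B2 1 = 0] &
   forall x, I01 x ->
    `|- eps ^+ 2 * (derive1n 2 W1 x + derive1n 2 B1 x) + a11 x * (W1 x + B1 x) + a12 x * (W2 x + B2 x) - F1 x|
      <= C * expR (- (b / eps)) /\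
    `|- mu ^+ 2 * (derive1n 2 W2 x + derive1n 2 B2 x) + a21 x * (W1 x + B1 x) + a22 x * (W2 x + B2 x) - F2 x|
      <= C * expR (- (b / eps))]].
Proof.
have det x := coercive_det al0 (coer x).
have l11 x : al ^+ 2 <= a11 x by have [] := det x.
have ldet x : I01 x -> al ^+ 2 <= a22 x - a21 x * a12 x / a11 x by move=> _; have [] := det x.
have al20 : 0 < al ^+ 2 by rewrite exprn_gt0.
have [qL [CL [gL [bL [[qL0 CL0 gL0 bL0] HL]]]]] :=
  layer_functions Ca0 ga0 al0 c11 c12 c21 c22 A11 A12 A21 A22 (l11 0).
have l11r : al ^+ 2 <= refl a11 0 by rewrite /refl subr0.
have [qR [CR [gR [bR [[qR0 CR0 gR0 bR0] HR]]]]] :=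
  layer_functions Ca0 ga0 al0 (cont_refl c11) (cont_refl c12) (cont_refl c21) (cont_refl c22)
  (analytic_bd_refl A11) (analytic_bd_refl A12) (analytic_bd_refl A21) (analytic_bd_refl A22) l11r.
pose CH := CL + CR; have CH0 : 0 < CH by rewrite addr_gt0.
have Kq0 : 0 <= Kq Ca (al ^+ 2) := Kq_ge0 Ca0 al20.
pose g := 2 * ga + 4 * Ca * ga / al ^+ 2 + (8 + Kq Ca (al ^+ 2)) + gf.
have g40 : 0 <= 4 * Ca * ga / al ^+ 2 by rewrite divr_ge0 ?(ltW al20) // !mulr_ge0 // ltW.
have gk : rate_ok Ca ga (al ^+ 2) g.
  by rewrite /rate_ok /g; have := ltW ga0; have := ltW gf0; split; lra.
have gf1 : gf <= g by rewrite /g; have := ltW ga0; lra.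
have g1 : 1 <= g by rewrite /g; have := ltW ga0; have := ltW gf0; lra.
pose k1 := K1 Ca (al ^+ 2) g CH; pose kk := KK Ca (al ^+ 2).
have k10 : 0 <= k1 := K1_ge0 Ca0 ga0 al20 gk (ltW CH0).
have kk0 : 0 < kk.
  by have h1 := K0_ge1 Ca0 al20; have h2 := Ku_ge0 Ca0 al20; rewrite /kk /KK; lra.
pose M1 := kk * Cf; have M10 : 0 < M1 by rewrite mulr_gt0.
pose Cw := 2 * M1; have Cw0 : 0 < Cw by rewrite mulr_gt0.
(* D times e^(- b / eps) will bound the boundary defects. *)
pose D := 6 * CH * M1; have D0 : 0 < D by rewrite !mulr_gt0.
pose e2 : R := expR 1 ^+ 2; have e20 : 0 <= e2 by rewrite exprn_ge0 // expR_ge0.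
(* With r = 1 / z the ratio of the smooth expansion is at most 1/2. *)
pose z := 1 + 2 * (k1 * e2); have ke0 : 0 <= k1 * e2 by rewrite mulr_ge0.
have z0 : 0 < z by rewrite /z; lra.
pose r := z^-1; have r0 : 0 < r by rewrite invr_gt0.
have r1 : r <= 1 by rewrite invf_le1 // /z; lra.
have hr : k1 * expR 1 ^+ 2 * r ^+ 2 <= 1 / 2.
  have zr : z * r = 1 by rewrite mulfV // gt_eqF.
  have h1 : 2 * (k1 * e2 * r) <= 1 by move: zr; rewrite /z mulrDl -mulrA; lra.
  rewrite -/e2 expr2 mulrA; have h2 : k1 * e2 * r * r <= k1 * e2 * r.
    by rewrite ler_piMr // mulr_ge0 // ltW.
  lra.
pose kappa := r / 2; have kap0 : 0 < kappa by rewrite divr_gt0.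
(* As mu <= 1, the bound eps / mu <= q gives eps <= kappa, that is at least one
   term in the expansion, and tau <= eps / mu <= q, as the layers require. *)
pose q := Num.min kappa (Num.min qL qR).
have q0 : 0 < q by rewrite !lt_min kap0 qL0.
pose b := Num.min (kappa / 2) (Num.min (al / 2) (Num.min bL bR)).
have b0 : 0 < b by rewrite !lt_min !divr_gt0 //= bL0.
have eE1 : 1 <= expR 1 :> R by rewrite -[X in X <= _]expR0 ler_expR.
pose gW := g * expR 1; have gW1 : 1 <= gW by rewrite mulr_ege1.
pose C := 4 * M1 * g ^+ 2 + Cw * CH + 2 * Ca * D + 1.
have C0 : 0 < C.
  have g0 := le_trans ler01 g1.
  by apply: ltr_wpDl ltr01; pos.
exists (Cw + 2 * D), gW, (Cw * (CL + CR)), ((gL + gR) * (2 / al)), b, q, C.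
split.
- split; [|exact: lt_le_trans gW1|by rewrite mulr_gt0|].
    by rewrite addr_gt0 // mulr_gt0.
  by rewrite mulr_gt0 ?addr_gt0 // divr_gt0.
- by split.
move=> eps mu eps0 epsmu mu1 hq.
have mu0 : 0 < mu := lt_le_trans eps0 epsmu.
pose s := eps / mu; have s0 : 0 < s by rewrite divr_gt0.
pose tau := s ^+ 2; have tau0 : 0 <= tau by rewrite sqr_ge0.
move: (hq); rewrite /q !le_min => /and3P[hk hqL hqR].
have k1' : kappa <= 1 by rewrite /kappa; lra.
have s1 : s <= 1 by apply: le_trans k1'.
have taus : tau <= s by rewrite /tau expr2 ler_piMr // ltW.
have tau1 : tau <= 1 by apply: le_trans s1.
have [m [hm1 hm2]] : exists m : nat, eps * (2 * m.+1)%:R <= 2 * kappa /\ (1 / 2) ^+ m <= 4 * expR (- (kappa / 2 / eps)).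
  apply: number_of_terms => //; apply: le_trans hk.
  by rewrite -[X in X <= _]mulr1 ler_wpM2l ?(ltW eps0) // invf_ge1.
have [eL1 [eL2 [[nL1 nL2 _ _] [sL1 sL2 kL1 kL2] eL10 bdL resL]]] := HL eps tau eps0 tau0 (le_trans taus hqL).
have [eR1 [eR2 [[_ _ nR1 nR2] [sR1 sR2 kR1 kR2] eR10 bdR resR]]] := HR eps tau eps0 tau0 (le_trans taus hqR).
pose X := expR (- (b / eps)); have X0 : 0 < X by rewrite expR_gt0.
have X1 : X <= 1 by rewrite -expR0 ler_expR lerNl oppr0 divr_ge0 // ltW.
have hX c : b <= c -> expR (- (c / eps)) <= X.
  by move=> bc; rewrite ler_expR lerN2 ler_wpM2r // invr_ge0 ltW.
have bk : b <= kappa / 2 by rewrite /b ge_min lexx.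
have ba : b <= al / 2 by rewrite /b !ge_min lexx orbT.
have bbL : b <= bL by rewrite /b !ge_min lexx !orbT.
have bbR : b <= bR by rewrite /b !ge_min lexx !orbT.
have hmX : (1 / 2) ^+ m <= 4 * X by apply: le_trans hm2 _; rewrite ler_pM2l // hX.
have th0b : `|eL2 0| <= CH.
  have [_ h] := bdL 0%N 0 (lexx 0); apply: le_trans h _.
  by rewrite expr0 mulr1 mul0r mulr0 oppr0 expR0 mulr1 /CH lerDl ltW.
have th1b : `|eR2 0| <= CH.
  have [_ h] := bdR 0%N 0 (lexx 0); apply: le_trans h _.
  by rewrite expr0 mulr1 mul0r mulr0 oppr0 expR0 mulr1 /CH lerDr ltW.
have kr : 2 * kappa = r by rewrite /kappa mulrC divfK // pnatr_eq0.
have eps2 : eps * (2 * m.+1)%:R <= r by rewrite -kr.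
have sr : eps / mu <= r by apply: le_trans hk _; rewrite -kr ler_peMl ?(ltW kap0) // ler1n.
have bF1 := analytic_bd_classM mu0 mu1 (ltW Cf0) (ltW gf0) gf1 AF1.
have bF2 := analytic_bd_classM mu0 mu1 (ltW Cf0) (ltW gf0) gf1 AF2.
have [w1 [w2 [[kw1 kw2] [bw1 bw2] rw1 rw2 [ew0 ew1]]]] :=
  smooth_expansion Ca0 ga0 al20 A11 A12 A21 A22 c11 c12 c21 c22 l11 ldet mu0 mu1 gk (ltW CH0) (ltW Cf0)
   th0b th1b cF1 cF2 bF1 bF2 eps0 eps2 sr r1 hr.

have wb w : continuous w -> classM mu 0 Cw (g * expR 1) w -> forall x, cI01 x -> `|w x| <= Cw.
  move=> kw [_ bw]; apply: bd_closure => // x hx.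
  by apply: le_trans (bw 0%N x hx) _; rewrite /dwgt !expr0 !mulr1.
have h00 : cI01 (0 : R) by apply/cI01E; rewrite lexx ler01.
have h11 : cI01 (1 : R) by apply/cI01E; rewrite lexx ler01.
have b10 := wb _ kw1 bw1 0 h00; have b11' := wb _ kw1 bw1 1 h11.
pose B1 x := - w1 0 * eL1 x + - w1 1 * eR1 (1 - x).
pose B2 x := - (tau * w1 0) * eL2 x + - (tau * w1 1) * eR2 (1 - x).
have kB1 : continuous B1 := cD (cZ kL1) (cZ (cont_refl kR1)).
have kB2 : continuous B2 := cD (cZ kL2) (cZ (cont_refl kR2)).
have [sB1 dB1] := derive1n_layers (- w1 0) (- w1 1) sL1 sR1.
have [sB2 dB2] := derive1n_layers (- (tau * w1 0)) (- (tau * w1 1)) sL2 sR2.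
rewrite -/B1 in sB1 dB1; rewrite -/B2 in sB2 dB2.
have tb (w : R) : `|w| <= Cw -> `|- (tau * w)| <= Cw * tau.
  by move=> h; rewrite normrN normrM (ger0_norm tau0) mulrC ler_wpM2r.
have tb' (w : R) : `|w| <= Cw -> `|- (tau * w)| <= Cw.
  by move=> h; apply: le_trans (tb w h) _; rewrite ler_piMr // ltW.
have nb (w : R) : `|w| <= Cw -> `|- w| <= Cw by rewrite normrN.
have bl1 := classBL_layers al0 eps0 (ltW CL0) (ltW CR0) (ltW gL0) (ltW gR0) (nb _ b10) (nb _ b11')
  nL1 nR1 sL1 sR1 (fun n x hx => (bdL n x hx).1) (fun n x hx => (bdR n x hx).1).
have bl2 := classBL_layers al0 eps0 (ltW CL0) (ltW CR0) (ltW gL0) (ltW gR0) (tb' _ b10) (tb' _ b11')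
  nL2 nR2 sL2 sR2 (fun n x hx => (bdL n x hx).2) (fun n x hx => (bdR n x hx).2).
have bl3 := classBL_layers al0 eps0 (ltW CL0) (ltW CR0) (ltW gL0) (ltW gR0) (tb _ b10) (tb _ b11')
  nL2 nR2 sL2 sR2 (fun n x hx => (bdL n x hx).2) (fun n x hx => (bdR n x hx).2).
rewrite -/B1 in bl1; rewrite -/B2 in bl2 bl3; rewrite [Cw * tau * _]mulrAC in bl3.
(* Each layer is exponentially small at the opposite endpoint. *)
have far (e : R -> R) (CC gg : R) : 0 <= CC -> CC <= CH ->
    (forall n x, 0 <= x -> `|derive1n n e x| <= CC * (gg / eps) ^+ n * expR (- (al / 2 * (x / eps)))) ->
    `|e 1| <= CH * X.
  move=> CC0 CCH h; apply: le_trans (h 0%N 1 ler01) _; rewrite expr0 mulr1 mul1r.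
  by apply: ler_pM; rewrite ?expR_ge0 // hX.
have CLH : CL <= CH by rewrite /CH lerDl ltW.
have CRH : CR <= CH by rewrite /CH lerDr ltW.
have fL1 := far eL1 CL gL (ltW CL0) CLH (fun n x hx => (bdL n x hx).1).
have fL2 := far eL2 CL gL (ltW CL0) CLH (fun n x hx => (bdL n x hx).2).
have fR1 := far eR1 CR gR (ltW CR0) CRH (fun n x hx => (bdR n x hx).1).
have fR2 := far eR2 CR gR (ltW CR0) CRH (fun n x hx => (bdR n x hx).2).
have CHX0 : 0 <= CH * X by rewrite mulr_ge0 // ltW.
have DX : CH * M1 * (4 * X) + Cw * (CH * X) = D * X by rewrite /D /Cw; ring.
have DX1 : Cw * (CH * X) <= D * X by rewrite -DX lerDr !mulr_ge0 // ltW.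
have s10 : `|w1 0 + B1 0| <= D * X.
  rewrite /B1 eL10 subr0 mulr1 addrA subrr add0r; apply: le_trans DX1.
  exact: ler_norm_prod (nb _ b11') fR1.
have s11 : `|w1 1 + B1 1| <= D * X.
  rewrite /B1 subrr eR10 mulr1 addrC subrK; apply: le_trans DX1.
  exact: ler_norm_prod (nb _ b10) fL1.
have M1X : CH * M1 * (1 / 2) ^+ m <= CH * M1 * (4 * X) by rewrite ler_wpM2l // mulr_ge0 // ltW.
have s20 : `|w2 0 + B2 0| <= D * X.
  have -> : w2 0 + B2 0 = (w2 0 - (eps / mu) ^+ 2 * eL2 0 * w1 0) + - (tau * w1 1) * eR2 1.
    by rewrite /B2 subr0 /tau /s; ring.
  rewrite -DX; apply: le_trans (ler_normD _ _) _; apply: lerD; first exact: le_trans ew0 M1X.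
  exact: ler_norm_prod (tb' _ b11') fR2.
have s21 : `|w2 1 + B2 1| <= D * X.
  have -> : w2 1 + B2 1 = (w2 1 - (eps / mu) ^+ 2 * eR2 0 * w1 1) + - (tau * w1 0) * eL2 1.
    by rewrite /B2 subrr /tau /s; ring.
  rewrite -DX; apply: le_trans (ler_normD _ _) _; apply: lerD; first exact: le_trans ew1 M1X.
  exact: ler_norm_prod (tb' _ b10) fL2.
have [l1 [[kl1 sl1 l10 l11'] dl1 cl1 bl1']] := affine_lift s10 s11.
have [l2 [[kl2 sl2 l20 l21] dl2 cl2 bl2']] := affine_lift s20 s21.
have Wcls (w l : R -> R) : classM mu 0 Cw gW w -> smooth l -> (forall n x, I01 x -> `|derive1n n l x| <= 2 * (D * X)) ->
   classM mu 0 (Cw + 2 * D) gW (fun x => w x + l x).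
  move=> [sw bw] sl bl; have [swl dwl] := derive1n_add sw sl; split=> // n x hx.
  rewrite dwl // -mulrA mulrDl; apply: le_trans (ler_normD _ _) _; apply: lerD.
    by rewrite mulrA; exact: bw.
  apply: le_trans (bl n x hx) _; apply: (@le_trans _ _ (2 * D)).
    by rewrite ler_pM2l // ler_piMr // ltW.
  have T1 : 1 <= dwgt mu (n + 0) := dwgt_ge1 mu0 mu1 _.
  have D20 : 0 <= 2 * D by rewrite mulr_ge0 // ltW.
  apply: (ler_peMr D20); apply: mulr_ege1 T1; exact: exprn_ege1.
have dsum2 (w l : R -> R) : smooth w -> smooth l -> (forall x, I01 x -> derive1n 2 l x = 0) ->
  forall x, I01 x -> derive1n 2 (fun x => w x + l x) x = derive1n 2 w x.
  by move=> sw sl d0 x hx; have [_ ->] // := derive1n_add sw sl; rewrite d0 // addr0.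
exists (fun x => w1 x + l1 x), (fun x => w2 x + l2 x), B1, B2; split.
- split; [exact: cD kw1 kl1|exact: cD kw2 kl2|exact: kB1|exact: kB2].
- split; [exact: Wcls bw1 sl1 cl1|exact: Wcls bw2 sl2 cl2|exact: sB1|exact: sB2].
- split; [exact: bl1|exact: bl2|exact: bl3].
- by split; rewrite ?l10 ?l11' ?l20 ?l21; ring.
move=> x hx.
rewrite (dsum2 _ _ bw1.1 sl1 dl1 x hx) (dsum2 _ _ bw2.1 sl2 dl2 x hx) dB1 // dB2 //.
have hc := I01_cI01 hx; have hc' := refl_cI01 hc.
have [rL1 rL2] := resL x hc; have [rR1 rR2] := resR (1 - x) hc'.
rewrite /refl subKr in rR1 rR2.
have XL : CL * expR (- (bL / eps)) <= CL * X by rewrite ler_wpM2l ?(ltW CL0) // hX.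
have XR : CR * expR (- (bR / eps)) <= CR * X by rewrite ler_wpM2l ?(ltW CR0) // hX.
have nb11 := analytic_bd0 A11 hx; have nb12 := analytic_bd0 A12 hx.
have nb21 := analytic_bd0 A21 hx; have nb22 := analytic_bd0 A22 hx.
have lift (p p' : R) : `|p| <= Ca -> `|p'| <= Ca -> `|p * l1 x + p' * l2 x| <= 2 * Ca * D * X.
  move=> hp hp'; have -> : 2 * Ca * D * X = Ca * (D * X) + Ca * (D * X) by ring.
  by apply: le_trans (ler_normD _ _) _; apply: lerD; apply: ler_norm_prod => //; [exact: bl1'|exact: bl2'].
set x1L := derive1n 2 eL1 x; set x2L := derive1n 2 eL2 x.
set x1R := derive1n 2 eR1 _; set x2R := derive1n 2 eR2 _.
split.
- have -> : - eps ^+ 2 * (derive1n 2 w1 x + (- w1 0 * x1L + - w1 1 * ((-1) ^+ 2 * x1R))) +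
    a11 x * (w1 x + l1 x + B1 x) + a12 x * (w2 x + l2 x + B2 x) - F1 x =
    (- eps ^+ 2 * derive1n 2 w1 x + a11 x * w1 x + a12 x * w2 x - F1 x) +
    - w1 0 * (- eps ^+ 2 * x1L + a11 x * eL1 x + tau * a12 x * eL2 x) +
    - w1 1 * (- eps ^+ 2 * x1R + a11 x * eR1 (1 - x) + tau * a12 x * eR2 (1 - x)) +
    (a11 x * l1 x + a12 x * l2 x) by rewrite /B1 /B2; ring.
  apply: le_trans (ler_norm_sum4 (rw1 x hx) (ler_norm_prod (nb _ b10) (le_trans rL1 XL))
     (ler_norm_prod (nb _ b11') (le_trans rR1 XR)) (lift _ _ nb11 nb12)) _.
  have h1 : KK Ca (al ^+ 2) * Cf * g ^+ 2 * (1 / 2) ^+ m <= M1 * g ^+ 2 * (4 * X).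
    by apply: ler_wpM2l => //; rewrite mulr_ge0 ?sqr_ge0 // ltW.
  apply: (@le_trans _ _ (M1 * g ^+ 2 * (4 * X) + Cw * (CL * X) + Cw * (CR * X) + 2 * Ca * D * X)).
    by do 3 rewrite lerD2r.
  rewrite -/X; have -> : C * X = M1 * g ^+ 2 * (4 * X) + Cw * (CL * X) + Cw * (CR * X) + 2 * Ca * D * X + X.
    by rewrite /C /CH; ring.
  by rewrite lerDl ltW.
- have mt : mu ^+ 2 * tau = eps ^+ 2.
    by rewrite /tau /s expr_div_n mulrC divfK // expf_neq0 // gt_eqF.
  have -> : - mu ^+ 2 * (derive1n 2 w2 x + (- (tau * w1 0) * x2L + - (tau * w1 1) * ((-1) ^+ 2 * x2R))) +
    a21 x * (w1 x + l1 x + B1 x) + a22 x * (w2 x + l2 x + B2 x) - F2 x =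
    (- mu ^+ 2 * derive1n 2 w2 x + a21 x * w1 x + a22 x * w2 x - F2 x) +
    - w1 0 * (- (mu ^+ 2 * tau) * x2L + a21 x * eL1 x + tau * a22 x * eL2 x) +
    - w1 1 * (- (mu ^+ 2 * tau) * x2R + a21 x * eR1 (1 - x) + tau * a22 x * eR2 (1 - x)) +
    (a21 x * l1 x + a22 x * l2 x) by rewrite /B1 /B2; ring.
  rewrite mt rw2 // subrr.
  have z00 : `|0 : R| <= 0 by rewrite normr0.
  apply: le_trans (ler_norm_sum4 z00 (ler_norm_prod (nb _ b10) (le_trans rL2 XL))
     (ler_norm_prod (nb _ b11') (le_trans rR2 XR)) (lift _ _ nb21 nb22)) _.
  rewrite -/X; have -> : C * X = 0 + Cw * (CL * X) + Cw * (CR * X) + 2 * Ca * D * X + (4 * M1 * g ^+ 2 * X + X).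
    by rewrite /C /CH; ring.
  have g0 := le_trans ler01 g1.
  have h0 : 0 <= 4 * M1 * g ^+ 2 * X by pos.
  by rewrite lerDl addr_ge0 // ltW.
Qed.
End Approx.

(** * The decomposition of the solution *)

Section Final.
Context {R : realType}.
Implicit Types (f g u e : R -> R).
Notation leb := (@lebesgue_measure R).

Lemma second_deriv (r D E : R -> R) :
  (forall x, I01 x -> is_derive x 1 r (D x)) -> (forall x, I01 x -> is_derive x 1 D (E x)) ->
  twice_derivableI r /\ forall x, I01 x -> derive1n 2 r x = E x.
Proof.
move=> dr dD; have e1 y : I01 y -> D y = derive1 r y by move=> hy; rewrite (dE (dr y hy)).
have d2 x : I01 x -> is_derive x 1 (derive1 r) (E x) by move=> hx; exact: dI hx e1 (dD x hx).
split=> x hx; first by split; [have [] := dr x hx|have [] := d2 x hx].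
by rewrite derive1nS (_ : derive1n 1 r = derive1 r) //; exact: dE (d2 x hx).
Qed.

(** Composition with the clamp changes nothing on [0, 1]. *)
Lemma analytic_bd_clamp f (C g : R) : analyticI C g f ->
  continuous (fun x : R => f (clamp x)) /\ analytic_bd C g (fun x => f (clamp x)).
Proof.
move=> af; have [[cf _] _] := af; have [sf bf] := analyticI_pointwise af.
have e y : I01 y -> f y = f (clamp y) by move=> hy; rewrite clamp_id //; exact: I01_cI01.
split; first exact: clamp_comp.
split; first exact: smooth_ext e sf.
move=> n x hx; rewrite -(derive1n_ext n e hx); exact: bf.
Qed.

Lemma classA_of_classM (mu C g : R) (w : R -> R) : 0 < mu -> mu <= 1 -> 0 <= C -> 0 <= g -> continuous w -> classM mu 0 C g w -> classA mu C g w.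
Proof.
move=> mu0 mu1 C0 g0 cw [sw bw]; split; first by split; [exact: contw|exact: sw].
move=> n; apply: LpI_oo_le => [|x hx].
  by rewrite !mulr_ge0 ?exprn_ge0 // le_max ler0n.
by have := bw n x hx; rewrite /dwgt addn0.
Qed.

Lemma coercive_form (al : R) (A : R -> 'M[R]_2) : coercive al A -> forall x s t, cI01 x ->
  al ^+ 2 * (s ^+ 2 + t ^+ 2) <=
     s * (A x 0 0 * s + A x 0 1 * t) + t * (A x 1 0 * s + A x 1 1 * t).
Proof.
move=> cA x s t hx; have := cA (\col_(i < 2) (if i == 0 then s else t)) x hx.
rewrite !mxE !big_ord_recl !big_ord0 !mxE /= !big_ord_recl !big_ord0 !mxE /=.
have -> : lift ord0 ord0 = 1 :> 'I_2 by exact: val_inj.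
rewrite -[ord0]/(0 : 'I_2).
set a := A x 0 0; set b := A x 0 1; set c := A x 1 0; set d := A x 1 1 => h.
have -> : s ^+ 2 + t ^+ 2 = s * s + (t * t + 0) by ring.
apply: le_trans h _; rewrite le_eqVlt; apply/orP; left; apply/eqP; ring.
Qed.

Lemma residual_eq (e a b y1 y2 z1 z2 w F : R) : 0 < e ->
  - e * (e^-1 * (a * y1 + b * y2 - F) - w) + a * (y1 - z1) + b * (y2 - z2) =
  - (- e * w + a * z1 + b * z2 - F).
Proof.
by move=> e0; rewrite mulrBr mulrA mulNr mulfV ?gt_eqF //; ring.
Qed.

(** Testing with one component at a time separates the two equations. *)
Lemma weak_components (eps mu : R) (A : R -> 'M[R]_2) f g u v du dv :
  H10 u du -> H10 v dv ->
  (forall phi dphi psi dpsi : R -> R, H10 phi dphi -> H10 psi dpsi ->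
      \int[leb]_(x in I01)
        (eps ^+ 2 * du x * dphi x + mu ^+ 2 * dv x * dpsi x +
         (A x 0 0 * u x + A x 0 1 * v x) * phi x +
         (A x 1 0 * u x + A x 1 1 * v x) * psi x) =
      \int[leb]_(x in I01) (f x * phi x + g x * psi x)) ->
  (forall phi dphi, H10 phi dphi ->
    \int[leb]_(x in I01) (eps ^+ 2 * du x * dphi x +
       (A (clamp x) 0 0 * u (clamp x) + A (clamp x) 0 1 * v (clamp x)) * phi x) =
    \int[leb]_(x in I01) (f (clamp x) * phi x)) /\
  (forall psi dpsi, H10 psi dpsi ->
    \int[leb]_(x in I01) (mu ^+ 2 * dv x * dpsi x +
       (A (clamp x) 1 0 * u (clamp x) + A (clamp x) 1 1 * v (clamp x)) * psi x) =
    \int[leb]_(x in I01) (g (clamp x) * psi x)).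
Proof.
move=> hu hv weak; split=> [phi dphi hp|psi dpsi hp].
- transitivity (\int[leb]_(x in I01) (f x * phi x + g x * 0)); last first.
    by apply: eq_Rintegral => x /set_mem/I01_cI01/clamp_id hx; rewrite hx mulr0 addr0.
  rewrite -(weak phi dphi (fun=> 0) (fun=> 0) hp H10_zero).
  by apply: eq_Rintegral => x /set_mem/I01_cI01/clamp_id hx; rewrite hx !mulr0 !addr0.
- transitivity (\int[leb]_(x in I01) (f x * 0 + g x * psi x)); last first.
    by apply: eq_Rintegral => x /set_mem/I01_cI01/clamp_id hx; rewrite hx mulr0 add0r.
  rewrite -(weak (fun=> 0) (fun=> 0) psi dpsi H10_zero hp).
  by apply: eq_Rintegral => x /set_mem/I01_cI01/clamp_id hx; rewrite hx !mulr0 add0r addr0.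
Qed.

End Final.

(** The remainder is what is left of the classical solution; its second derivative
    is computed from the differential equation, so that the residual of the
    approximation is, up to sign, the image of the remainder under the operator. *)
Theorem theorem5p1 (R : realType) (f g : R -> R) (A : R -> 'M[R]_2)
    (Cf gf Cg gg Ca ga alpha : R)
    (Cf_gt0 : 0 < Cf) (gf_gt0 : 0 < gf) (Cg_gt0 : 0 < Cg) (gg_gt0 : 0 < gg)
    (Ca_gt0 : 0 < Ca) (ga_gt0 : 0 < ga) (alpha_gt0 : 0 < alpha)
    (f_analytic : analyticI Cf gf f) (g_analytic : analyticI Cg gg g)
    (A_analytic : forall i j : 'I_2, analyticI Ca ga (fun x => A x i j))
    (A_coercive : coercive alpha A) :
  exists CW gW CBL gBL delta b q C : R,
  [/\ [/\ 0 < CW, 0 < gW, 0 < CBL & 0 < gBL],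
      [/\ 0 < delta, 0 < b, 0 < q & 0 < C] &
  forall eps mu : R, 0 < eps -> eps <= mu -> mu <= 1 -> eps / mu <= q ->
  forall u v : R -> R, solution eps mu A f g u v ->
  exists w1 w2 u_BL v_BL r1 r2 : R -> R,
    (forall x : R, cI01 x ->
      u x = w1 x + u_BL x + r1 x /\ v x = w2 x + v_BL x + r2 x) /\
    (classA mu CW gW w1 /\ classA mu CW gW w2) /\
    (classBL (delta * eps) CBL gBL u_BL /\
     classBL (delta * eps) CBL gBL v_BL) /\
    (twice_derivableI r1 /\ twice_derivableI r2) /\
    ((bd_norm r1 r2)%:E +
       LpI +oo (enorm (L1 eps A r1 r2) (L2 mu A r1 r2))
       <= (C * expR (- (b / eps)))%:E)%E /\
    (energy_norm eps mu alpha r1 r2 <= (C * expR (- (b / eps)))%:E)%E /\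
    classBL (delta * eps) (CBL * (eps / mu) ^+ 2) gBL v_BL ].
Proof.
have [kF1 AF1] := analytic_bd_clamp f_analytic; have [kF2 AF2] := analytic_bd_clamp g_analytic.
have [c11 A11] := analytic_bd_clamp (A_analytic 0 0); have [c12 A12] := analytic_bd_clamp (A_analytic 0 1).
have [c21 A21] := analytic_bd_clamp (A_analytic 1 0); have [c22 A22] := analytic_bd_clamp (A_analytic 1 1).
have CC0 : 0 < Cf + Cg by rewrite addr_gt0.
have gg0 : 0 < gf + gg by rewrite addr_gt0.
have BF1 : analytic_bd (Cf + Cg) (gf + gg) (fun x => f (clamp x)).
  by apply: analytic_bd_mono AF1; rewrite ?lerDl ?(ltW Cf_gt0) ?(ltW gf_gt0) ?ltW.
have BF2 : analytic_bd (Cf + Cg) (gf + gg) (fun x => g (clamp x)).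
  by apply: analytic_bd_mono AF2; rewrite ?lerDr ?(ltW Cg_gt0) ?(ltW gg_gt0) ?ltW.
have coer x s t := coercive_form A_coercive s t (clamp_in x).
have [CW [gW [CBL [gBL [b [q [C [[CW0 gW0 CBL0 gBL0] [b0 q0 C0] H]]]]]]]] :=
  asymptotic_approx Ca_gt0 ga_gt0 alpha_gt0 CC0 gg0 A11 A12 A21 A22 BF1 BF2 c11 c12 c21 c22 kF1 kF2 coer.
pose C' := 2 * C + 2 * C / alpha.
have C'0 : 0 < C' by rewrite addr_gt0 ?divr_gt0 ?mulr_gt0.
exists CW, gW, CBL, gBL, (2 / alpha), b, q, C'.
split; [by split|by split=> //; rewrite divr_gt0|].
move=> eps mu eps0 epsmu mu1 hq u v [du [dv [hu hv weak]]].
have mu0 : 0 < mu := lt_le_trans eps0 epsmu.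
have [weak1 weak2] := weak_components hu hv weak.
have ku := H10_cont hu; have kv := H10_cont hv.
have [Y1 [D1 [kY1 kD1 dY1 dD1 eY1]]] := weak_classical (exprn_gt0 2 eps0) hu
  (cD (cM c11 ku) (cM c12 kv)) kF1 weak1.
have [Y2 [D2 [kY2 kD2 dY2 dD2 eY2]]] := weak_classical (exprn_gt0 2 mu0) hv
  (cD (cM c21 ku) (cM c22 kv)) kF2 weak2.
have [W1 [W2 [B1 [B2 [[kW1 kW2 kB1 kB2] [bW1 bW2 sB1 sB2] [bl1 bl2 bl3] [z10 z11 z20 z21] res]]]]] :=
  H eps mu eps0 epsmu mu1 hq.
have de0 : 0 < 2 / alpha * eps by rewrite mulr_gt0 // divr_gt0.
have extW (w : R -> R) : classM mu 0 CW gW w -> exists2 h : R -> R, continuous h & forall x, I01 x -> is_derive x 1 w (h x) /\ is_derive x 1 h (derive1n 2 w x).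
  move=> [sw bw]; have [h kh eh] := derive1n_extension sw (bw 2%N).
  exists h => // x hx; split; first by rewrite eh //; exact: (smooth_d 0 sw hx).
  by apply: dI hx _ (smooth_d 1 sw hx) => y hy; rewrite eh.
have extB (w : R -> R) : smooth w -> classBL (2 / alpha * eps) CBL gBL w ->
   exists2 h : R -> R, continuous h & forall x, I01 x -> is_derive x 1 w (h x) /\ is_derive x 1 h (derive1n 2 w x).
  move=> sw [_ bw]; have b2 x : I01 x -> `|derive1n 2 w x| <= CBL * gBL ^+ 2 * (2 / alpha * eps) ^- 2.
    move=> hx; apply: le_trans (bw 2%N x hx) _; rewrite ler_piMr //.
      by rewrite !mulr_ge0 ?exprn_ge0 ?invr_ge0 ?exprn_ge0 // ltW.
    rewrite -[X in _ <= X]expR0 ler_expR oppr_le0; apply: divr_ge0 (ltW de0).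
    by rewrite /dist_bd le_min !normr_ge0.
  have [h kh eh] := derive1n_extension sw b2.
  exists h => // x hx; split; first by rewrite eh //; exact: (smooth_d 0 sw hx).
  by apply: dI hx _ (smooth_d 1 sw hx) => y hy; rewrite eh.
have [dW1 kdW1 hW1] := extW _ bW1; have [dW2 kdW2 hW2] := extW _ bW2.
have [dB1 kdB1 hB1] := extB _ sB1 bl1; have [dB2 kdB2 hB2] := extB _ sB2 bl2.
pose r1 x := Y1 x - (W1 x + B1 x); pose r2 x := Y2 x - (W2 x + B2 x).
pose S1 x := D1 x - (dW1 x + dB1 x); pose S2 x := D2 x - (dW2 x + dB2 x).
have kr1 : continuous r1 := cB kY1 (cD kW1 kB1).
have kr2 : continuous r2 := cB kY2 (cD kW2 kB2).
have kS1 : continuous S1 := cB kD1 (cD kdW1 kdB1).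
have kS2 : continuous S2 := cB kD2 (cD kdW2 kdB2).
pose E1 x := (eps ^+ 2)^-1 * (A (clamp x) 0 0 * u (clamp x) + A (clamp x) 0 1 * v (clamp x) - f (clamp x))
   - (derive1n 2 W1 x + derive1n 2 B1 x).
pose E2 x := (mu ^+ 2)^-1 * (A (clamp x) 1 0 * u (clamp x) + A (clamp x) 1 1 * v (clamp x) - g (clamp x))
   - (derive1n 2 W2 x + derive1n 2 B2 x).
have dr1 x : I01 x -> is_derive x 1 r1 (S1 x).
  by move=> hx; exact: dB (dY1 x hx) (dD (hW1 x hx).1 (hB1 x hx).1).
have dr2 x : I01 x -> is_derive x 1 r2 (S2 x).
  by move=> hx; exact: dB (dY2 x hx) (dD (hW2 x hx).1 (hB2 x hx).1).
have dS1 x : I01 x -> is_derive x 1 S1 (E1 x).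
  by move=> hx; exact: dB (dD1 x hx) (dD (hW1 x hx).2 (hB1 x hx).2).
have dS2 x : I01 x -> is_derive x 1 S2 (E2 x).
  by move=> hx; exact: dB (dD2 x hx) (dD (hW2 x hx).2 (hB2 x hx).2).
have h00 : cI01 (0 : R) by apply/cI01E; rewrite lexx ler01.
have h11 : cI01 (1 : R) by apply/cI01E; rewrite lexx ler01.
have [u0 u1] : u 0 = 0 /\ u 1 = 0.
  by have [_ _ h ->] := hu; rewrite h // set_itv1 Rintegral_set1.
have [v0 v1] : v 0 = 0 /\ v 1 = 0.
  by have [_ _ h ->] := hv; rewrite h // set_itv1 Rintegral_set1.
have r10 : r1 0 = 0 by rewrite /r1 -eY1 // u0 z10 subrr.
have r11 : r1 1 = 0 by rewrite /r1 -eY1 // u1 z11 subrr.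
have r20 : r2 0 = 0 by rewrite /r2 -eY2 // v0 z20 subrr.
have r21 : r2 1 = 0 by rewrite /r2 -eY2 // v1 z21 subrr.
pose X := expR (- (b / eps)); have X0 : 0 < X by rewrite expR_gt0.
have CX0 : 0 <= C * X by rewrite mulr_ge0 // ltW.
pose l1 x := - eps ^+ 2 * E1 x + A (clamp x) 0 0 * r1 x + A (clamp x) 0 1 * r2 x.
pose l2 x := - mu ^+ 2 * E2 x + A (clamp x) 1 0 * r1 x + A (clamp x) 1 1 * r2 x.
have bl x : I01 x -> `|l1 x| <= C * X /\ `|l2 x| <= C * X.
  move=> hx; have hc := I01_cI01 hx; have cx := clamp_id hc.
  have [h1 h2] := res x hx; split; [move: h1|move: h2]; rewrite -normrN -/X => h.
    suff -> : l1 x = - (- eps ^+ 2 * (derive1n 2 W1 x + derive1n 2 B1 x) + A (clamp x) 0 0 * (W1 x + B1 x) +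
     A (clamp x) 0 1 * (W2 x + B2 x) - f (clamp x)) by exact: h.
    rewrite /l1 /E1 /r1 /r2 cx -eY1 // -eY2 //; exact: residual_eq (exprn_gt0 2 eps0).
  suff -> : l2 x = - (- mu ^+ 2 * (derive1n 2 W2 x + derive1n 2 B2 x) + A (clamp x) 1 0 * (W1 x + B1 x) +
     A (clamp x) 1 1 * (W2 x + B2 x) - g (clamp x)) by exact: h.
  rewrite /l2 /E2 /r1 /r2 cx -eY1 // -eY2 //; exact: residual_eq (exprn_gt0 2 mu0).
have S0 : 0 <= 2 * (C * X) by rewrite mulr_ge0.
have bS x : I01 x -> l1 x ^+ 2 + l2 x ^+ 2 <= (2 * (C * X)) ^+ 2.
  move=> hx; have [h1 h2] := bl x hx.
  have q1 : l1 x ^+ 2 <= (C * X) ^+ 2 by rewrite -real_normK ?num_real // lerXn2r // ?nnegrE.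
  have q2 : l2 x ^+ 2 <= (C * X) ^+ 2 by rewrite -real_normK ?num_real // lerXn2r // ?nnegrE.
  have -> : (2 * (C * X)) ^+ 2 = (C * X) ^+ 2 + (C * X) ^+ 2 + 2 * (C * X) ^+ 2 by ring.
  by apply: le_trans (lerD q1 q2) _; rewrite lerDl mulr_ge0 ?sqr_ge0.
have [t1 d21] := second_deriv dr1 dS1; have [t2 d22] := second_deriv dr2 dS2.
exists W1, W2, B1, B2, r1, r2; split.
  by move=> x hx; rewrite /r1 /r2 -eY1 // -eY2 //; split; ring.
split; first by split; apply: classA_of_classM; rewrite // ltW.
split; first by split.
split; first by split.
have CS : 2 * (C * X) <= C' * X.
  have -> : C' * X = 2 * (C * X) + 2 * C / alpha * X by rewrite /C'; ring.
  by rewrite lerDl mulr_ge0 ?(ltW X0) // divr_ge0 ?mulr_ge0 // ltW.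
split.
  have -> : bd_norm r1 r2 = 0.
    by rewrite /bd_norm /enorm r10 r11 r20 r21 expr0n /= addr0 sqrtr0 maxxx.
  rewrite add0e; apply: le_trans (_ : (2 * (C * X))%:E <= _)%E; last by rewrite lee_fin.
  apply: LpI_oo_le => // x hx; rewrite /enorm ger0_norm ?sqrtr_ge0 //.
  rewrite -[X in _ <= X](ger0_norm S0) -sqrtr_sqr ler_sqrt ?sqr_ge0 //.
  have := bS x hx; rewrite /l1 /l2 /L1 /L2 d21 // d22 // clamp_id //; exact: I01_cI01.
split; last exact: bl3.
have e := energy_norm_le alpha_gt0 S0 (fun x s t _ => coer x s t) kr1 kr2 kS1 kS2 r10 r11 r20 r21
  dr1 dr2 dS1 dS2 bS.
apply: le_trans e _; rewrite lee_fin -/X.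
have -> : C' * X = 2 * C * X + 2 * (C * X) / alpha by rewrite /C'; ring.
by rewrite lerDr mulr_ge0 ?(ltW X0) // mulr_ge0 // ltW.
Qed.
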